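(* Assume in addition $\kappa\in C^3_{\mathrm{per}}([0,T];L^\infty(D))$. There is a constant $C$, depending on $D$, $\kappa$ and $\Omega$ but not on $h$ or $K$, such that the following holds. Let $\widehat u^\omega_{h,K}\in\widehat V_{h,K}$ and $\omega_{h,K}\in\mathbb C$ be an eigenmode and eigenvalue of the fully discrete coupled harmonics eigenvalue problem with $\operatorname{Re}\omega_{h,K}\in(-\Omega/2,\Omega/2]$ and $\|\widehat u^\omega_{h,K}\|_{K,D}=1$, and let $$U^\omega_{h,K}(t)=\sum_{n=-K}^K\big(\widehat u^\omega_{h,K}\big)_n e^{-i(\omega_{h,K}+n\Omega)t}.$$ Then for every $t\ge0$ there is a defect $\delta^\omega_{h,K}(t)\in H^1(D)$ such that for all $v_h\in X_h$ $$(v_h,\partial_t^2U^\omega_{h,K}(t))_{L^2(D)}+(\nabla v_h,\kappa(t)\nabla U^\omega_{h,K}(t))_{L^2(D)}+\kappa_0(v_h,\partial_tU^\omega_{h,K}(t))_{L^2(\Gamma)}=(\nabla v_h,\nabla\delta^\omega_{h,K}(t))_{L^2(D)},$$ and $$\sup_{v_h\in X_h,\ \|v_h\|_{L^2(D)}=1}\big|(\nabla v_h,\nabla\delta^\omega_{h,K}(t))_{L^2(D)}\big|\le C\,\frac{C_{\mathrm{inv}}(h)^4}{K^2}\,e^{(\operatorname{Im}\omega_{h,K})\,t}.$$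
   Context: $D\subset\mathbb R^d$ is a bounded Lipschitz domain with boundary $\Gamma$, $\kappa_0>0$ is a fixed constant, $T>0$, $\Omega=2\pi/T$. The real-valued coefficient $\kappa\in C^1_{\mathrm{per}}(0,T;L^\infty(D))$ is $T$-periodic and $C^1$ in time with values in $L^\infty(D)$, with $0<c_\kappa=\operatorname*{ess\,inf}_{D\times[0,T]}\kappa\le\operatorname*{ess\,sup}_{D\times[0,T]}\kappa=C_\kappa<\infty$. Its Fourier coefficients are defined by $\kappa(x,t)=\sum_{n\in\mathbb Z}\widehat\kappa_n(x)e^{-in\Omega t}$. $C^3_{\mathrm{per}}$ denotes $T$-periodic $C^3$ functions of time. $(X_h)_{h>0}$ is a family of finite-dimensional subspaces of (complex-valued) $H^1(D)$, with mesh width $h\to0$, and $C_{\mathrm{inv}}(h)$ is a constant with $\|\nabla u_h\|_{L^2(D)}\le C_{\mathrm{inv}}(h)\|u_h\|_{L^2(D)}$ for all $u_h\in X_h$; it tends to infinity as $h\to0$. For a positive integer $K$ put $\widehat V_{h,K}=X_h^{2K+1}$ with elements $\widehat u=(\widehat u_n)_{|n|\le K}$. Let $(\widehat\varphi,\widehat\psi)_{K,D}=\sum_{|n|\le K}(\widehat\varphi_n,\widehat\psi_n)_{L^2(D)}$, $(\widehat\varphi,\widehat\psi)_{K,\Gamma}=\sum_{|n|\le K}(\widehat\varphi_n,\widehat\psi_n)_{L^2(\Gamma)}$ (conjugate-linear in the test function, written first), $\|\widehat\varphi\|_{K,D}^2=(\widehat\varphi,\widehat\varphi)_{K,D}$,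 $(\mathcal D\widehat u)_n=-in\Omega\widehat u_n$, and $(\mathcal T_\kappa\nabla\widehat u)_n=\sum_{|m|\le K}\widehat\kappa_{n-m}\nabla\widehat u_m$ with the gradient acting entrywise. Fully discrete coupled harmonics eigenvalue problem: find $\omega_{h,K}\in\mathbb C$ and a nontrivial $(\widehat u,\widehat z)\in\widehat V_{h,K}^2$ such that for all $(\widehat v,\widehat\eta)\in\widehat V_{h,K}^2$ $$(\widehat v,\mathcal D\widehat u-\widehat z)_{K,D}=i\omega_{h,K}(\widehat v,\widehat u)_{K,D},$$ $$(\widehat\eta,\mathcal D\widehat z)_{K,D}+(\nabla\widehat\eta,\mathcal T_\kappa\nabla\widehat u)_{K,D}+\kappa_0(\widehat\eta,\widehat z)_{K,\Gamma}=i\omega_{h,K}(\widehat\eta,\widehat z)_{K,D}.$$ The component $\widehat u=\widehat u^\omega_{h,K}$ is called the eigenmode.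
   Formalization: The bound is proved for all h with C_inv(h) ≥ c_0, where c_0 > 0 is arbitrary and C may also depend on c_0; without a lower bound on C_inv(h) the claim fails (e.g. X_h = span{1+εg}, ε→0: defect of order ε², bound of order ε⁴). *)

(* Defs.v *)
From HB Require Import structures.
From mathcomp Require Import all_boot all_order all_algebra.
From mathcomp Require Import all_classical all_reals all_analysis.
From mathcomp Require Import ess_sup_inf.

Set Implicit Arguments.
Unset Strict Implicit.
Unset Printing Implicit Defensive.
Import Order.TTheory GRing.Theory Num.Theory.
Import numFieldNormedType.Exports.
(* Last, so that Re and Im are the real components of R[i]. *)
From mathcomp Require Import complex.

Local Open Scope classical_set_scope.
Local Open Scope ring_scope.

Section OuterMeasures.
Context {R : realType} {T : pointedType}.
Local Open Scope ereal_scope.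

Definition gauge_outer (w : set T -> \bar R) (A : set T) : \bar R :=
  ereal_inf [set \sum_(k <oo) w (F k)
            | F in [set F : (set T)^nat | A `<=` \bigcup_k F k]].

Lemma gauge_outerE (w : set T -> \bar R) :
  gauge_outer w = mu_ext (T := g_sigma_algebraType [set: set T]) w.
Proof.
apply/funext => A; rewrite /gauge_outer /mu_ext; congr ereal_inf.
apply/seteqP; split=> [_ [F AF <-]|_ [F [_ AF] <-]]; exists F => //.
by split=> // i; exact: sub_sigma_algebra.
Qed.

Section gauge.
Variable w : set T -> \bar R.
Hypothesis w_ge0 : forall A, 0 <= w A.

Lemma gauge_outer0 : w set0 = 0 -> gauge_outer w set0 = 0.
Proof. by move=> w0; rewrite gauge_outerE; exact: mu_ext0. Qed.

Lemma gauge_outer_ge0 A : 0 <= gauge_outer w A.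
Proof. by rewrite gauge_outerE; exact: mu_ext_ge0. Qed.

Lemma le_gauge_outer : {homo gauge_outer w : A B / A `<=` B >-> A <= B}.
Proof.
rewrite gauge_outerE; exact: (@le_mu_ext _ (g_sigma_algebraType [set: set T])).
Qed.

Lemma gauge_outer_sub : sigma_subadditive (gauge_outer w).
Proof.
rewrite gauge_outerE.
exact: (@mu_ext_sigma_subadditive _ (g_sigma_algebraType [set: set T])).
Qed.
End gauge.

Section restriction.
Variables (mu : {outer_measure set T -> \bar R}) (A : set T).

Definition outer_restr (X : set T) : \bar R := mu (X `&` A).

Let restr0 : outer_restr set0 = 0.
Proof. by rewrite /outer_restr set0I outer_measure0. Qed.

Let restr_ge0 X : 0 <= outer_restr X.
Proof. exact: outer_measure_ge0. Qed.

Let restr_le : {homo outer_restr : X Y / X `<=` Y >-> X <= Y}.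
Proof. by move=> X Y XY; apply: le_outer_measure; exact: setSI. Qed.

Let restr_sub : sigma_subadditive outer_restr.
Proof.
by move=> F; rewrite /outer_restr setI_bigcupl;
  exact: outer_measure_sigma_subadditive.
Qed.

HB.instance Definition _ := isOuterMeasure.Build R T outer_restr
  restr0 restr_ge0 restr_le restr_sub.
End restriction.
End OuterMeasures.

Section LebesgueHausdorff.
Context {R : realType}.
Local Open Scope ereal_scope.

Definition box {d} (a b : 'rV[R]_d) : set 'rV[R]_d :=
  [set x : 'rV[R]_d | forall j, (a 0%R j <= x 0%R j <= b 0%R j)%R].

Definition box_volume {d} (A : set 'rV[R]_d) : \bar R :=
  ereal_inf [set (\prod_(j < d) (p.2 0 j - p.1 0 j))%R%:E
            | p in [set p : 'rV[R]_d * 'rV[R]_d |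
                (forall j, (p.1 0 j <= p.2 0 j)%R) /\ A `<=` box p.1 p.2]].

Definition lebesgue_outer {n} : set 'rV[R]_n.+1 -> \bar R :=
  gauge_outer box_volume.

Let box_volume_ge0 d (A : set 'rV[R]_d) : 0 <= box_volume A.
Proof.
apply: le_ereal_inf_tmp => _ [p [ab _] <-].
by rewrite lee_fin; apply: prodr_ge0 => j _; rewrite subr_ge0.
Qed.

Let box_volume0 n : box_volume (set0 : set 'rV[R]_n.+1) = 0.
Proof.
apply/eqP; rewrite eq_le box_volume_ge0 andbT; apply: ereal_inf_lbound.
exists (0%R, 0%R) => /=; first by split.
by rewrite big_ord_recl subrr mul0r.
Qed.

HB.instance Definition _ n := isOuterMeasure.Build R 'rV[R]_n.+1
  (@lebesgue_outer n)
  (gauge_outer0 (@box_volume_ge0 _) (box_volume0 n))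
  (gauge_outer_ge0 (@box_volume_ge0 _))
  (@le_gauge_outer _ _ _)
  (gauge_outer_sub (@box_volume_ge0 _)).

(* Volume of the unit ball of R^m; it normalises the Hausdorff measure so that
   it agrees with the surface measure. *)
Fixpoint ball_volume (m : nat) : R :=
  match m with
  | 0%N => 1
  | 1%N => 2
  | k.+2 => 2 * pi / k.+2%:R * ball_volume k
  end.

Definition euclid_norm {d} (x : 'rV[R]_d) : R :=
  Num.sqrt (\sum_(j < d) x 0 j ^+ 2).

Definition euclid_diam {d} (A : set 'rV[R]_d) : \bar R :=
  ereal_sup [set (euclid_norm (p.1 - p.2))%:E
            | p in [set p : 'rV[R]_d * 'rV[R]_d | A p.1 /\ A p.2]].

Definition hausdorff_gauge {d} (m : nat) (e : R) (A : set 'rV[R]_d) : \bar R :=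
  if A == set0 then 0
  else if euclid_diam A <= e%:E
       then (ball_volume m * (fine (euclid_diam A) / 2) ^+ m)%R%:E
       else +oo.

Definition hausdorff_outer {d} (m : nat) (A : set 'rV[R]_d) : \bar R :=
  ereal_sup [set gauge_outer (hausdorff_gauge m e) A | e in [set e | (0 < e)%R]].

Let ball_volume_ge0 m : (0 <= ball_volume m)%R.
Proof.
suff : (0 <= ball_volume m)%R /\ (0 <= ball_volume m.+1)%R by case.
elim: m => [|m [h0 h1]]; first by split=> /=.
by split=> //; rewrite [ball_volume _]/= mulr_ge0// divr_ge0// mulr_ge0// pi_ge0.
Qed.

Let hausdorff_gauge_ge0 d m e (A : set 'rV[R]_d) :
  0 <= hausdorff_gauge m e A.
Proof.
rewrite /hausdorff_gauge; case: ifPn => [_ //|A0]; case: ifPn => // _.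
rewrite lee_fin mulr_ge0// exprn_ge0// divr_ge0// fine_ge0//.
move/set0P : A0 => [x Ax]; apply: ereal_sup_ge; exists 0 => //=.
exists (x, x) => //=; rewrite subrr /euclid_norm big1 ?sqrtr0// => j _.
by rewrite mxE expr0n.
Qed.

Let hausdorff_gauge0 d m e : hausdorff_gauge m e (set0 : set 'rV[R]_d) = 0.
Proof. by rewrite /hausdorff_gauge eqxx. Qed.

Let hausdorff0 d m : hausdorff_outer m (set0 : set 'rV[R]_d) = 0.
Proof.
rewrite /hausdorff_outer -[RHS](ereal_sup1 0); congr ereal_sup.
have E e : gauge_outer (hausdorff_gauge m e) (set0 : set 'rV[R]_d) = 0.
  by apply: gauge_outer0; [exact: hausdorff_gauge_ge0|exact: hausdorff_gauge0].
apply/seteqP; split=> [_ [e _ <-] /=|_ -> /=]; first exact: E.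
by exists 1%R => //=; exact: ltr01.
Qed.

Let hausdorff_ge0 d m (A : set 'rV[R]_d) : 0 <= hausdorff_outer m A.
Proof.
apply: ereal_sup_ge; exists (gauge_outer (hausdorff_gauge m 1) A).
  by exists 1%R => //=; exact: ltr01.
by apply: gauge_outer_ge0; exact: hausdorff_gauge_ge0.
Qed.

Let le_hausdorff d m :
  {homo @hausdorff_outer d m : A B / A `<=` B >-> A <= B}.
Proof.
move=> A B AB; apply: ge_ereal_sup => _ [e e0 <-]; apply: ereal_sup_ge.
exists (gauge_outer (hausdorff_gauge m e) B); first by exists e.
exact: le_gauge_outer.
Qed.

Let hausdorff_sub d m : sigma_subadditive (@hausdorff_outer d m).
Proof.
move=> F; apply: ge_ereal_sup => _ [e e0 <-].
apply: (@le_trans _ _ (\sum_(i <oo) gauge_outer (hausdorff_gauge m e) (F i))).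
  by apply: gauge_outer_sub; exact: hausdorff_gauge_ge0.
apply: lee_nneseries => [i _ _|i _].
  by apply: gauge_outer_ge0; exact: hausdorff_gauge_ge0.
by apply: ereal_sup_ubound; exists e.
Qed.

HB.instance Definition _ d m := isOuterMeasure.Build R 'rV[R]_d
  (@hausdorff_outer d m) (@hausdorff0 d m) (@hausdorff_ge0 d m)
  (@le_hausdorff d m) (@hausdorff_sub d m).
End LebesgueHausdorff.

(* The ambient space is R^(n+1).  Both measures are Caratheodory measures of
   outer measures restricted to a set A, so that integrals over A are integrals
   over the whole space; for A open (resp. closed) the measurable sets are those
   whose trace on A is Lebesgue (resp. H^n) measurable. *)
Section Measures.
Context {R : realType} {n : nat}.
Implicit Types A : set 'rV[R]_n.+1.

Definition volume_outer A : {outer_measure set 'rV[R]_n.+1 -> \bar R} :=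
  outer_restr lebesgue_outer A.

Definition surface_outer A : {outer_measure set 'rV[R]_n.+1 -> \bar R} :=
  outer_restr (hausdorff_outer n) A.

Definition volume A :
    {measure set (caratheodory_type (volume_outer A)) -> \bar R} :=
  volume_outer A.

Definition surface A :
    {measure set (caratheodory_type (surface_outer A)) -> \bar R} :=
  surface_outer A.
End Measures.

Notation volume_space A := (caratheodory_type (volume_outer A)).
Notation surface_space A := (caratheodory_type (surface_outer A)).

Section Complex.
Context {R : realType}.

Definition cexp (z : R[i]) : R[i] :=
  (expR (Re z))%:C%C * (cos (Im z) +i* sin (Im z))%C.

Definition cderive (f : R -> R[i]) (t : R) : R[i] :=
  (derive1 (fun s => Re (f s)) t +i* derive1 (fun s => Im (f s)) t)%C.

Context {d} {T : measurableType d} (mu : {measure set T -> \bar R}).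

Definition cintegral (A : set T) (f : T -> R[i]) : R[i] :=
  (\int[mu]_(x in A) Re (f x) +i* \int[mu]_(x in A) Im (f x))%C.

Definition L2 (f : T -> R[i]) : Prop :=
  [/\ measurable_fun setT (fun x => Re (f x)),
      measurable_fun setT (fun x => Im (f x)) &
      (\int[mu]_x ((Re (f x) ^+ 2 + Im (f x) ^+ 2)%R)%:E < +oo)%E].

Definition ip (f g : T -> R[i]) : R[i] :=
  cintegral setT (fun x => (f x)^*%C * g x).

Definition ip_vec {m} (F G : T -> 'rV[R[i]]_m) : R[i] :=
  \sum_(j < m) ip (fun x => F x 0 j) (fun x => G x 0 j).

Definition norm2 (f : T -> R[i]) : R := Num.sqrt (Re (ip f f)).

Definition norm2_vec {m} (F : T -> 'rV[R[i]]_m) : R :=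
  Num.sqrt (Re (ip_vec F F)).

End Complex.

Section Sobolev.
Context {R : realType} {n : nat}.
Local Notation E := 'rV[R]_n.+1.

Definition boundary (D : set E) : set E := closure D `\` interior D.

(* In suitable orthonormal coordinates y centred at a boundary point, D is
   locally the epigraph of a Lipschitz function of the first n coordinates. *)
Definition lipschitz_domain (D : set E) : Prop :=
  [/\ open D, connected D, D !=set0, bounded_set D &
   forall x0, boundary D x0 ->
     exists (Q : 'M[R]_n.+1) (phi : 'rV[R]_n -> R) (r : R),
       [/\ Q *m Q^T = 1%:M, lipschitz phi, 0 < r &
        forall x, `|x - x0| < r ->
          let y := (x - x0) *m Q in
          D x <-> phi (col' ord_max y) < y 0 ord_max]].

Definition partial (j : 'I_n.+1) (f : E -> R) : E -> R :=
  fun x => 'D_(delta_mx 0 j) f x.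

Fixpoint Ck (k : nat) (f : E -> R) : Prop :=
  continuous f /\
  match k with
  | 0%N => True
  | k'.+1 => forall j, (forall x, derivable f x (delta_mx 0 j)) /\
                       Ck k' (partial j f)
  end.

Definition smooth (f : E -> R) : Prop := forall k, Ck k f.

Definition test_function (D : set E) (f : E -> R) : Prop :=
  smooth f /\
  exists S : set E, [/\ compact S, S `<=` D & forall x, ~ S x -> f x = 0].

Variable D : set E.

(* A Sobolev function is represented by the pair (u, grad u), which makes the
   gradient the second projection; linear operations act componentwise. *)
Definition sobolev_pair : Type := ((E -> R[i]^o) * (E -> 'rV[R[i]]_n.+1))%type.
HB.instance Definition _ := GRing.Lmodule.on sobolev_pair.

Definition fval (p : sobolev_pair) : volume_space D -> R[i] := p.1.
Definition grad (p : sobolev_pair) : volume_space D -> 'rV[R[i]]_n.+1 := p.2.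

Definition H1 : set sobolev_pair := [set p |
  [/\ L2 (volume D) (fval p),
      forall j, L2 (volume D) (fun x => grad p x 0 j) &
      forall j (f : E -> R), test_function D f ->
        cintegral (volume D) setT (fun x => fval p x * (partial j f x)%:C%C) =
        - cintegral (volume D) setT (fun x => grad p x 0 j * (f x)%:C%C)]].

Definition norm_H1 (p : sobolev_pair) : R :=
  Num.sqrt (norm2 (volume D) (fval p) ^+ 2 +
            norm2_vec (volume D) (grad p) ^+ 2).

Definition boundary_space := surface_space (boundary D).

(* The bounded linear operator H^1(D) -> L^2(boundary) which restricts smooth
   functions to the boundary; these properties determine it up to null sets. *)
Definition trace_operator (tr : sobolev_pair -> boundary_space -> R[i]) : Prop :=
  let sigma := surface (boundary D) in
  [/\ forall p, H1 p -> L2 sigma (tr p),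
      forall (a : R[i]) p q, H1 p -> H1 q ->
        \forall x \ae sigma, tr (a *: p + q) x = a * tr p x + tr q x,
      exists M : R, forall p, H1 p -> norm2 sigma (tr p) <= M * norm_H1 p &
      forall p (f g : E -> R), H1 p -> smooth f -> smooth g ->
        (\forall x \ae volume D, fval p x = (f x +i* g x)%C) ->
        \forall x \ae sigma, tr p x = (f x +i* g x)%C].

(* Finite-dimensional subspaces of H^1(D), as spans of finite families. *)
Definition fin_dim_subspace (X : set sobolev_pair) : Prop :=
  X `<=` H1 /\
  exists (N : nat) (b : 'I_N -> sobolev_pair),
    X = [set p | exists c : 'I_N -> R[i], p = \sum_(i < N) c i *: b i].

Definition discrete_spaces (X : R -> set sobolev_pair) (Cinv : R -> R) : Prop :=
  [/\ forall h, 0 < h -> fin_dim_subspace (X h),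
      forall h p, 0 < h -> X h p ->
        norm2_vec (volume D) (grad p) <= Cinv h * norm2 (volume D) (fval p) &
      Cinv h @[h --> 0^'+] --> +oo].

Definition Linf (f : volume_space D -> R) : Prop :=
  measurable_fun setT f /\ ('N[volume D]_+oo[EFin \o f] < +oo)%E.

Definition Linf_continuous (k : R -> volume_space D -> R) : Prop :=
  forall t, 'N[volume D]_+oo[EFin \o (fun x => k s x - k t x)%R]%E
              @[s --> t] --> 0%E.

Definition Linf_derivative (k k' : R -> volume_space D -> R) : Prop :=
  forall t, 'N[volume D]_+oo[EFin \o
              (fun x => (k (t + s) x - k t x) / s - k' t x)%R]%E
              @[s --> 0^'] --> 0%E.

Fixpoint C_Linf (m : nat) (k : R -> volume_space D -> R) : Prop :=
  [/\ forall t, Linf (k t), Linf_continuous k &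
   match m with
   | 0%N => True
   | m'.+1 => exists k', Linf_derivative k k' /\ C_Linf m' k'
   end].

Definition C_per (m : nat) (T : R) (k : R -> volume_space D -> R) : Prop :=
  C_Linf m k /\ forall t, \forall x \ae volume D, k (t + T) x = k t x.

Definition space_time (T : R) :=
  mrestr (volume D \x lebesgue_measure)%E
    (measurableX (@measurableT _ (volume_space D))
                 (measurable_itv `[0%R, T] : measurable (_ : set (measurableTypeR R)))).

Definition coefficient (T : R) (k : R -> volume_space D -> R) : Prop :=
  let k_ (p : volume_space D * measurableTypeR R) := k p.2 p.1 in
  [/\ measurable_fun setT k_, C_per 1 T k,
      (0 < ess_inf (space_time T) (EFin \o k_))%E &
      (ess_sup (space_time T) (EFin \o k_) < +oo)%E].

(* With the convention kappa(x,t) = sum_m kappa_m(x) e^{-i m Omega t}. *)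
Definition fourier_coef (T : R) (k : R -> volume_space D -> R) (m : int)
    (x : volume_space D) : R[i] :=
  (T^-1)%:C%C * cintegral lebesgue_measure `[0, T]
    (fun t : measurableTypeR R =>
       (k t x)%:C%C * cexp ('i%C * m%:~R * (2 * pi / T * t)%:C%C)).

Section Harmonics.
Variables (T : R) (k : R -> volume_space D -> R) (kappa0 : R).
Variable tr : sobolev_pair -> boundary_space -> R[i].
Variable K : nat.

Let Omega : R := 2 * pi / T.

(* Elements of X_h^{2K+1} are families over 'I_(2K+1); position i carries the
   harmonic of frequency i - K. *)
Definition harm (i : 'I_(2 * K + 1)) : int := (i : nat)%:Z - K%:Z.

Definition harmonics := 'I_(2 * K + 1) -> sobolev_pair.

Definition ip_K (v u : harmonics) : R[i] :=
  \sum_i ip (volume D) (fval (v i)) (fval (u i)).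

Definition ip_grad_K (v : harmonics)
    (G : 'I_(2 * K + 1) -> volume_space D -> 'rV[R[i]]_n.+1) : R[i] :=
  \sum_i ip_vec (volume D) (grad (v i)) (G i).

Definition ip_boundary_K (v u : harmonics) : R[i] :=
  \sum_i ip (surface (boundary D)) (tr (v i)) (tr (u i)).

Definition norm_K (u : harmonics) : R := Num.sqrt (Re (ip_K u u)).

Definition D_op (u : harmonics) : harmonics :=
  fun i => (- 'i%C * (harm i)%:~R * Omega%:C%C) *: u i.

Definition T_op (u : harmonics) :
    'I_(2 * K + 1) -> volume_space D -> 'rV[R[i]]_n.+1 :=
  fun i x => \sum_j fourier_coef T k (harm i - harm j) x *: grad (u j) x.

Definition eigenpair (X : set sobolev_pair) (omega : R[i]) (u z : harmonics) :=
  [/\ (forall i, X (u i)) /\ (forall i, X (z i)),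
      norm_K u != 0 \/ norm_K z != 0 &
      forall v eta : harmonics, (forall i, X (v i)) -> (forall i, X (eta i)) ->
        ip_K v (fun i => D_op u i - z i) = 'i%C * omega * ip_K v u /\
        ip_K eta (D_op z) + ip_grad_K eta (T_op u)
          + kappa0%:C%C * ip_boundary_K eta z = 'i%C * omega * ip_K eta z].

Definition eigenmode (X : set sobolev_pair) (omega : R[i]) (u : harmonics) :=
  exists z, eigenpair X omega u z.

Definition mode (omega : R[i]) (u : harmonics) (t : R) : sobolev_pair :=
  \sum_i cexp (- 'i%C * (omega + (harm i)%:~R * Omega%:C%C) * t%:C%C) *: u i.

End Harmonics.

(* For functions with values in a finite-dimensional space of pairs the
   derivative in time is the pointwise one. *)
Definition time_deriv (U : R -> sobolev_pair) (t : R) : sobolev_pair :=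
  (fun x => cderive (fun s => (U s).1 x) t,
   fun x => \row_j cderive (fun s => (U s).2 x 0 j) t).

Definition grad_form (v p : sobolev_pair) : R[i] :=
  ip_vec (volume D) (grad v) (grad p).

Definition wave_form (k : R -> volume_space D -> R) (kappa0 : R)
    (tr : sobolev_pair -> boundary_space -> R[i])
    (U : R -> sobolev_pair) (t : R) (v : sobolev_pair) : R[i] :=
  ip (volume D) (fval v) (fval (time_deriv (time_deriv U) t))
  + ip_vec (volume D) (grad v) (fun x => (k t x)%:C%C *: grad (U t) x)
  + kappa0%:C%C *
      ip (surface (boundary D)) (tr v) (tr (time_deriv U t)).

End Sobolev.
Arguments sobolev_pair : clear implicits.
Arguments boundary_space {R n} D.
Arguments mode {R n} T {K} omega u t.
Arguments harmonics : clear implicits.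

(* Main.v *)
Require Import Defs.
From HB Require Import structures.
From mathcomp Require Import all_boot all_order all_algebra.
From mathcomp Require Import ring lra zify.
From mathcomp Require Import all_classical all_reals all_analysis.
From mathcomp Require Import ess_sup_inf measurable_realfun.
From mathcomp Require Import complex.

(** A trial function u and a test function v enter the coupled harmonics problem
    only through the time-periodic scalar function
    a(t) = (grad v, kappa(t) grad u).  It is C^3 with derivatives bounded by a
    multiple of |grad v| |grad u|, and by Fubini its Fourier coefficients are the
    numbers (grad v, kappa_l grad u), which are therefore O(|l|^-3).

    Multiplying the n-th discrete equation by e^{-i(omega + n Omega)t} and summing,
    the residual of U is the sum over m of e^{-i(omega + m Omega)t} times the part
    of the Fourier series of (grad v, kappa(t) grad u_m) with frequencies outside
    [-K - m, K - m].  That tail is O((K + 1 - |m|)^-2) |grad v| |grad u_m|.  Testing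
    the m-th equation with u_m, multiplying by the conjugate of omega + m Omega and
    taking real parts removes the boundary term, whatever kappa0 is, and yields
    |u_m| = O(Cinv^2 (1 + |m|)^-2).  Summing the products of the two bounds gives
    Cinv^4 / K^2.  The residual only depends on grad v, so the defect is its Riesz
    representative in X_h for the Dirichlet form. *)

Set Implicit Arguments.
Unset Strict Implicit.
Unset Printing Implicit Defensive.
Import Order.TTheory GRing.Theory Num.Theory.
Import numFieldNormedType.Exports.

Local Open Scope classical_set_scope.
Local Open Scope ring_scope.

(** Bounding the tail requires that [a t] equals its Fourier series at every [t]. Cubic decay makes
    the partial sums converge, and Fejer means identify the limit.

    At each [t] the bounds on kappa hold only for almost every [x], and the null set may vary with
    [t].

    The first equation determines z_m only weakly in the volume, while the boundary term involves
    its trace. The inverse inequality bridges this: in X_h, null in the volume means null gradient,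
    hence null trace.

    The window for Re omega gives |Re omega + m Omega| >= (Omega / 4) (1 + |m|) for m <> 0. The
    zeroth harmonic may have real frequency 0 and is bounded by normalisation alone; writing that
    bound 1 as a multiple of Cinv^2 is what brings [c0] into the constant.

    The weights (1 + |m|)^-2 and (K + 1 - |m|)^-2 peak at opposite ends of 0 <= |m| <= K, where the
    other one is of size K^-2. Of the four powers of Cinv, two come from the decay, one from |grad
    u_m| and one from |grad v|. *)

Local Notation normc := ComplexField.Normc.normc.
Local Notation Re := complex.Re.
Local Notation Im := complex.Im.

(** * Fourier series of smooth periodic functions *)

Section RealFourier.
Context {R : realType}.
Notation leb := (@lebesgue_measure R).
Implicit Types (f g : R -> R) (a b t x l p T B : R).

Lemma derive_continuous f f' :
  (forall x, is_derive x (1 : R) f (f' x)) -> continuous f.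
Proof.
by move=> df x; apply: differentiable_continuous; apply/derivable1_diffP; case: (df x).
Qed.

Lemma continuous_integrable_itv a b f :
  continuous f -> leb.-integrable `[a, b] (EFin \o f).
Proof.
move=> cf; apply: continuous_compact_integrable; first exact: segment_compact.
exact: continuous_subspaceT.
Qed.

Lemma cos_phase_continuous l p : continuous (fun s : R => cos (l * s + p)).
Proof.
move=> x; apply: continuous_comp; last exact: continuous_cos.
by apply: continuousD; [apply: continuousM; [exact: cst_continuous|]|exact: cst_continuous].
Qed.

Lemma Rint_parts f f' g g' a b : a < b ->
  (forall x, is_derive x (1 : R) f (f' x)) -> continuous f' ->
  (forall x, is_derive x (1 : R) g (g' x)) -> continuous g' ->
  \int[leb]_(x in `[a, b]) (f x * g' x) =
  f b * g b - f a * g a - \int[leb]_(x in `[a, b]) (f' x * g x).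
Proof.
move=> ab df cf dg cg; apply: Rintegration_by_parts => //.
- exact: continuous_subspaceT.
- have c := derive_continuous df.
  split; [|apply: cvg_at_right_filter; exact: c|apply: cvg_at_left_filter; exact: c].
  by move=> x _; case: (df x).
- by move=> x _; rewrite derive1E; exact: derive_val.
- exact: continuous_subspaceT.
- have c := derive_continuous dg.
  split; [|apply: cvg_at_right_filter; exact: c|apply: cvg_at_left_filter; exact: c].
  by move=> x _; case: (dg x).
- by move=> x _; rewrite derive1E; exact: derive_val.
Qed.

Lemma periodic_mulz f T (n : int) x :
  (forall u, f (u + T) = f u) -> f (x + n%:~R * T) = f x.
Proof.
move=> fT; have fN m y : f (y + m%:R * T) = f y.
  elim: m y => [|m IH] y; first by rewrite mul0r addr0.
  by rewrite mulrSr mulrDl mul1r addrA fT IH.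
case: n => m; first exact: fN.
by rewrite NegzE mulrNz mulNr -[LHS](fN m.+1) subrK.
Qed.

Lemma cosDz p (n : int) : cos (n%:~R * (2 * pi) + p) = cos p :> R.
Proof.
by rewrite addrC periodic_mulz// => u; rewrite mulr_natl cosD2pi.
Qed.

Lemma sinDz p (n : int) : sin (n%:~R * (2 * pi) + p) = sin p :> R.
Proof.
by rewrite addrC periodic_mulz// => u; rewrite mulr_natl sinD2pi.
Qed.

(** The free phase [p] absorbs the sine that appears when the cosine is integrated, a sine being a
    cosine with phase [- pi / 2]. The right-hand side thus has the shape of the left-hand one, so
    the identity iterates and serves sine integrals as well. Periodicity of [f] cancels the boundary
    terms. *)
Lemma Rint_parts_cos f f' T p (n : int) : 0 < T -> n != 0 ->
  (forall x, is_derive x (1 : R) f (f' x)) -> continuous f' -> f T = f 0 ->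
  let l := n%:~R * (2 * pi / T) in
  \int[leb]_(s in `[0, T]) (f s * cos (l * s + p)) =
  - l^-1 * \int[leb]_(s in `[0, T]) (f' s * cos (l * s + (p - pi / 2))).
Proof.
move=> T0 n0 df cf fT l.
have l0 : l != 0.
  by rewrite mulf_neq0 ?intr_eq0// gt_eqF// divr_gt0// mulr_gt0// pi_gt0.
have lT : l * T = n%:~R * (2 * pi) by rewrite /l; field; rewrite gt_eqF.
have dg (x : R) : is_derive x (1 : R) (fun s => l^-1 * sin (l * s + p)) (cos (l * x + p)).
  apply: is_derive_eq.
  by rewrite /GRing.scale/= !(mulr0, addr0, add0r, mul0r, mulr1) mulrCA mulVf ?mulr1.
rewrite (Rint_parts T0 df cf dg (@cos_phase_continuous l p)).
rewrite lT sinDz mulr0 add0r fT subrr sub0r mulNr; congr (- _).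
rewrite -RintegralZl//; last first.
  apply: continuous_integrable_itv => x; apply: continuousM; first exact: cf.
  exact: cos_phase_continuous.
by apply: eq_Rintegral => s _; rewrite addrA cosBpihalf; ring.
Qed.

(** The bound on [f] serves the mean value, the one on [f2] the quadratic remainder at a point, the
    one on [f3] the cubic decay of the coefficients. They are asked on one period only, where
    compactness supplies them. *)
Definition smooth_periodic T B f := exists f1 f2 f3,
  [/\ [/\ forall x, is_derive x (1 : R) f (f1 x),
          forall x, is_derive x (1 : R) f1 (f2 x),
          forall x, is_derive x (1 : R) f2 (f3 x) & continuous f3],
      forall x, f (x + T) = f x &
      forall x, 0 <= x <= T -> [/\ `|f x| <= B, `|f2 x| <= B & `|f3 x| <= B]].

Lemma derive_periodic f f' T :
  (forall x, is_derive x (1 : R) f (f' x)) ->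
  (forall x, f (x + T) = f x) -> forall x, f' (x + T) = f' x.
Proof.
move=> df fT x.
have d1 : is_derive x (1 : R) (f \o (fun s => s + T)) (f' (x + T) * 1).
  by apply: is_derive1_comp; apply: is_derive_eq; rewrite addr0.
have E : f \o (fun s => s + T) = f by apply/funext => s /=; rewrite fT.
rewrite E mulr1 in d1.
by rewrite -(@derive_val _ _ _ _ _ _ _ d1) -(@derive_val _ _ _ _ _ _ _ (df x)).
Qed.

(** Three integrations by parts, possible because [f], [f1] and [f2] are all periodic. Each gives a
    factor [(2 * pi / T)^-1 / |n|], and the last integral is at most [B * T]. *)
Lemma smooth_periodic_bound T B f (n : int) p : 0 < T -> n != 0 ->
  smooth_periodic T B f ->
  `|\int[leb]_(s in `[0, T]) (f s * cos (n%:~R * (2 * pi / T) * s + p))|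
    <= B * T / (2 * pi / T) ^+ 3 / `|n|%:R ^+ 3.
Proof.
move=> T0 n0 [f1 [f2 [f3 [[d0 d1 d2 c3] fT fB]]]].
have f1T := derive_periodic d0 fT; have f2T := derive_periodic d1 f1T.
have P g : (forall x, g (x + T) = g x) -> g T = g 0.
  by move=> /(_ 0); rewrite add0r.
rewrite (Rint_parts_cos p T0 n0 d0 (derive_continuous d1) (P _ fT)).
rewrite (Rint_parts_cos _ T0 n0 d1 (derive_continuous d2) (P _ f1T)).
rewrite (Rint_parts_cos _ T0 n0 d2 c3 (P _ f2T)).
set l := n%:~R * _; set q := _ - pi / 2.
rewrite !normrM !normrN !mulrA.
have -> : `|l^-1| = (2 * pi / T)^-1 / `|n|%:R.
  rewrite normfV normrM invfM mulrC; congr (_ / _).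
    by rewrite gtr0_norm// divr_gt0// mulr_gt0// pi_gt0.
  by rewrite -intr_norm -abszE.
have : `|\int[leb]_(s in `[0, T]) (f3 s * cos (l * s + q))| <= B * T.
  have I : leb.-integrable `[0, T] (EFin \o (fun s => f3 s * cos (l * s + q))).
    apply: continuous_integrable_itv => x; apply: continuousM; first exact: c3.
    exact: cos_phase_continuous.
  apply: (le_trans (le_normr_Rintegral _ I)) => //.
  apply: (@le_trans _ _ (\int[leb]_(s in `[0, T]) B)).
    apply: le_Rintegral => //.
    - by have := integrable_norm I.
    - by apply: continuous_integrable_itv; exact: cst_continuous.
    move=> s /=; rewrite in_itv/= => sT; rewrite normrM.
    have [_ _ b3] := fB s sT.
    by rewrite -[leRHS]mulr1 ler_pM// cos_max.
  by rewrite Rintegral_cst//= lebesgue_measure_itv/= lte_fin T0/= oppr0 addr0.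
set w := 2 * pi / T; set m := `|n|%:R => IB.
have w0 : 0 < w by rewrite divr_gt0// mulr_gt0// pi_gt0.
have m0 : 0 < m by rewrite ltr0n absz_gt0.
have -> : B * T / w ^+ 3 / m ^+ 3 = w^-1 / m / w / m / w / m * (B * T).
  by field; rewrite !gt_eqF.
move: IB; move: (B * T) => BT IB; by rewrite !mulrA ler_wpM2l// !mulr_ge0// invr_ge0 ltW.
Qed.

Lemma Rint_cos0 T p (n : int) : 0 < T -> n != 0 ->
  \int[leb]_(s in `[0, T]) cos (n%:~R * (2 * pi / T) * s + p) = 0.
Proof.
move=> T0 n0.
have := @Rint_parts_cos (fun=> 1) (fun=> 0) T p n T0 n0.
move=> /(_ (fun=> is_derive_cst _ _ _) (fun=> @cst_continuous _ _ _ _) erefl) /=.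
under eq_Rintegral do rewrite mul1r.
by move=> ->; under eq_Rintegral do rewrite mul0r; rewrite Rintegral_cst// mul0r mulr0.
Qed.

(** For [x >= 0], applying [z cos z <= sin z] at [z = x / 4] gives [sin (x / 2) = 2 sin (x / 4) cos
    (x / 4) >= (x / 4) (2 cos^2 (x / 4)) = (x / 4) (1 + cos (x / 2)) >= x / 4]; then
    [1 - cos x = 2 sin^2 (x / 2)]. *)
Lemma jordan_cos x : `|x| <= pi -> x ^+ 2 <= 8 * (1 - cos x).
Proof.
wlog x0 : x / 0 <= x => [H|].
  move=> xpi; have [x0|x0] := leP 0 x; first exact: H.
  have := H (- x); rewrite sqrrN cosN normrN; apply=> //; by rewrite oppr_ge0 ltW.
rewrite ger0_norm// => xpi.
have scos (z : R) : 0 <= z <= pi -> z * cos z <= sin z.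
  move=> /andP[z0 zpi].
  have dh (y : R) : is_derive y (1 : R) (fun s => sin s - s * cos s) (y * sin y).
    apply: is_derive_eq.
    by rewrite /GRing.scale/= !(mulr0, addr0, add0r, mul0r, mulr1); ring.
  have [c cz] := MVT_segment z0 (fun y _ => dh y)
    (continuous_subspaceT (derive_continuous dh)).
  rewrite sin0 mul0r !subr0 -subr_ge0 => ->.
  move: cz; rewrite in_itv/= => /andP[c0 cz].
  by rewrite !mulr_ge0// sin_ge0_pi// c0 (le_trans cz).
have pi0 := @pi_ge0 R.
have s4 : x / 4 * cos (x / 4) <= sin (x / 4).
  by apply: scos; apply/andP; split; lra.
have e2 : sin (x / 2) = 2 * sin (x / 4) * cos (x / 4).
  by rewrite [x / 2](_ : _ = (x / 4) *+ 2) ?sin_mulr2n -mulr_natl; [ring|field].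
have e3 : cos (x / 2) = 2 * cos (x / 4) ^+ 2 - 1.
  by rewrite [x / 2](_ : _ = (x / 4) *+ 2) ?cos_mulr2n -mulr_natl; [ring|field].
have e1 : 1 - cos x = 2 * sin (x / 2) ^+ 2.
  rewrite {1}[x](_ : _ = (x / 2) *+ 2) ?cos_mulr2n; last by rewrite -mulr_natl; field.
  by rewrite -mulr_natl cos2sin2; ring.
have h2 : 0 <= cos (x / 2).
  by rewrite cos_ge0_pihalf//; apply/andP; split; lra.
have h4 : 0 <= cos (x / 4).
  by rewrite cos_ge0_pihalf//; apply/andP; split; lra.
have : x / 4 <= sin (x / 2).
  rewrite e2; apply: (@le_trans _ _ (2 * (x / 4 * cos (x / 4)) * cos (x / 4))).
    nra.
  by rewrite ler_wpM2r// ler_wpM2l.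
rewrite e1; nra.
Qed.

End RealFourier.

Section RealIntegrable.
Context d (T : measurableType d) (R : realType) (mu : {measure set T -> \bar R}).
Context (D : set T) (mD : measurable D).
Implicit Types f g : T -> R.

Lemma integrable_EFinD f g : mu.-integrable D (EFin \o f) ->
  mu.-integrable D (EFin \o g) -> mu.-integrable D (EFin \o (fun x => f x + g x)).
Proof. by move=> fi gi; exact: (integrableD mD fi gi). Qed.

Lemma integrable_EFinB f g : mu.-integrable D (EFin \o f) ->
  mu.-integrable D (EFin \o g) -> mu.-integrable D (EFin \o (fun x => f x - g x)).
Proof. by move=> fi gi; exact: (integrableB mD fi gi). Qed.

Lemma integrable_EFinZl (k : R) f : mu.-integrable D (EFin \o f) ->
  mu.-integrable D (EFin \o (fun x => k * f x)).
Proof. by move=> fi; exact: (integrableZl mD k fi). Qed.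

Lemma integrable_EFin_norm f : mu.-integrable D (EFin \o f) ->
  mu.-integrable D (EFin \o (fun x => `|f x|)).
Proof. by move=> fi; exact: (integrable_norm fi). Qed.

End RealIntegrable.

Lemma Rintegral_sum d (T : measurableType d) (R : realType)
    (mu : {measure set T -> \bar R}) (D : set T) (I : Type) (f : I -> T -> R)
    (s : seq I) : measurable D ->
  (forall i, mu.-integrable D (EFin \o f i)) ->
  mu.-integrable D (EFin \o (fun x => \sum_(i <- s) f i x)) /\
  \int[mu]_(x in D) (\sum_(i <- s) f i x) = \sum_(i <- s) \int[mu]_(x in D) f i x.
Proof.
move=> mD fi; elim: s => [|i s [Is IH]].
  split; last first.
    by under eq_Rintegral do rewrite big_nil; rewrite big_nil Rintegral_cst// mul0r.
  by under [X in EFin \o X]eq_fun do rewrite big_nil; exact: integrable0.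
split.
  rewrite (_ : EFin \o _ = (EFin \o f i) \+ (EFin \o (fun x => (\sum_(j <- s) f j x)%R)))%E.
    by apply: integrableD => //; exact: fi.
  by apply/funext => x /=; rewrite big_cons EFinD.
by under eq_Rintegral do rewrite big_cons; rewrite RintegralD// IH big_cons.
Qed.

(** * Fejer kernel and second-order expansion of a periodic function *)

Section Fejer.
Context {R : realType}.
Notation leb := (@lebesgue_measure R).
Implicit Types (f g : R -> R) (a b t x l p T B : R).

Definition dirichlet (N : nat) (x : R) : R :=
  \sum_(i < (2 * N).+1) cos ((i%:Z - N%:Z)%:~R * x).

Lemma sum_symmetric (V : zmodType) (G : int -> V) N :
  \sum_(i < (2 * N.+1).+1) G (i%:Z - N.+1%:Z) =
  \sum_(i < (2 * N).+1) G (i%:Z - N%:Z) + (G N.+1%:Z + G (- N.+1%:Z)).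
Proof.
rewrite mulnS add2n [in LHS]big_ord_recl [in LHS]big_ord_recr/= /bump/=.
rewrite [LHS]addrC -[LHS]addrA; congr (_ + (_ + _)); last by congr G; lia.
- by apply: eq_bigr => i _; congr G; lia.
- by congr G; lia.
Qed.

Lemma sum_symmetric0 (V : zmodType) (G : int -> V) N :
  \sum_(i < (2 * N).+1) G (i%:Z - N%:Z) =
  G 0 + \sum_(k < N) (G k.+1%:Z + G (- k.+1%:Z)).
Proof.
elim: N => [|N IH]; first by rewrite big_ord0 addr0 big_ord1.
by rewrite sum_symmetric IH big_ord_recr /= !addrA.
Qed.

Lemma dirichlet_telescope N x :
  dirichlet N x * (1 - cos x) = cos (N%:R * x) - cos (N.+1%:R * x).
Proof.
elim: N => [|N IH]; first by rewrite /dirichlet big_ord1 subrr !mul0r cos0 !mul1r.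
rewrite /dirichlet (sum_symmetric (fun n => cos (n%:~R * x))) mulrDl IH.
rewrite mulrNz mulNr cosN -[N.+1%:~R]/(N.+1%:R : R).
have -> : N%:R * x = N.+1%:R * x - x by rewrite -natr1; ring.
have -> : N.+2%:R * x = N.+1%:R * x + x by rewrite -[in LHS]natr1; ring.
by rewrite cosB cosD; ring.
Qed.

(** Closed form of [M] times the Fejer kernel, with the denominator multiplied out so that it also
    holds where [cos x = 1]. The right-hand side stays between 0 and 2 whatever [M] is. *)
Lemma fejer_telescope M x :
  (\sum_(N < M) dirichlet N x) * (1 - cos x) = 1 - cos (M%:R * x).
Proof.
elim: M => [|M IH]; first by rewrite big_ord0 !mul0r cos0 subrr.
by rewrite big_ord_recr /= mulrDl IH dirichlet_telescope; ring.
Qed.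

Lemma period_representative T t x : 0 < T ->
  exists n : int, `|x + n%:~R * T - t| <= T / 2.
Proof.
move=> T0; exists (- Num.floor ((x - t) / T + 1 / 2)).
have /andP[] := floor_itv ((x - t) / T + 1 / 2).
set m := Num.floor _; rewrite intrD intrN => h1 h2.
have e : x - t = (x - t) / T * T by rewrite divfK// gt_eqF.
rewrite ler_norml; apply/andP; split; nra.
Qed.

Lemma periodic_bounded T B f : 0 < T -> (forall x, f (x + T) = f x) ->
  (forall x, 0 <= x <= T -> `|f x| <= B) -> forall x, `|f x| <= B.
Proof.
move=> T0 fT fB x; have [n nx] := period_representative (T / 2) x T0.
rewrite -(periodic_mulz n x fT) fB//.
by move: nx; rewrite ler_norml => /andP[? ?]; apply/andP; split; lra.
Qed.

Lemma mean_value_center (h h' : R -> R) A t r :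
  (forall x, is_derive x (1 : R) h (h' x)) -> h t = 0 ->
  (forall x, `|x - t| <= r -> `|h' x| <= A) ->
  forall x, `|x - t| <= r -> `|h x| <= A * `|x - t|.
Proof.
move=> dh ht hA x xr.
have ch := derive_continuous dh.
have [tx|xt] := leP t x.
- have [c] := MVT_segment tx (fun y _ => dh y) (continuous_subspaceT ch).
  rewrite in_itv/= ht subr0 => /andP[c1 c2] ->.
  rewrite normrM ler_wpM2r// hA// (le_trans _ xr)// !ger0_norm ?subr_ge0//; lra.
- have [c] := MVT_segment (ltW xt) (fun y _ => dh y) (continuous_subspaceT ch).
  rewrite in_itv/= ht sub0r => /andP[c1 c2] /(congr1 Num.norm).
  rewrite normrN normrM distrC => ->.
  rewrite ler_wpM2r// hA// (le_trans _ xr)// !ler0_norm ?subr_le0//; lra.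
Qed.

(** A Taylor expansion with periodic ingredients: the sine replaces the linear term and [1 - cos]
    the quadratic one. The estimate is obtained for [|s - t| <= T / 2], by two mean value steps and
    [jordan_cos], and periodicity of both sides extends it to all [s]. *)
Lemma second_order_remainder T B f t : 0 < T -> smooth_periodic T B f ->
  exists d L : R, 0 <= L /\ forall s,
  `|f s - (f t + d * sin (2 * pi / T * (s - t)))| <=
    L * (1 - cos (2 * pi / T * (s - t))).
Proof.
move=> T0 [f1 [f2 [f3 [[d0 d1 d2 c3] fT fB]]]].
set w := 2 * pi / T.
have w0 : 0 < w by rewrite divr_gt0// mulr_gt0// pi_gt0.
have f1T := derive_periodic d0 fT; have f2T := derive_periodic d1 f1T.
have B2 : forall x, `|f2 x| <= B.
  by apply: (periodic_bounded T0 f2T) => x /fB [].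
(* Bound for the second derivative of the remainder: [B] for [f2], the rest for the sine term with
   slope [f1 t] at [t]. *)
pose A := B + w * `|f1 t|.
have A0 : 0 <= A.
  by rewrite addr_ge0 ?(le_trans _ (B2 0))// mulr_ge0// ltW.
exists (f1 t / w), (8 * A / w ^+ 2); split.
  by apply: divr_ge0; [apply: mulr_ge0|apply: exprn_ge0; exact: ltW].
pose g s := f s - (f t + f1 t / w * sin (w * (s - t))).
pose g1 s := f1 s - f1 t * cos (w * (s - t)).
pose g2 s := f2 s + f1 t * w * sin (w * (s - t)).
have dg (x : R) : is_derive x (1 : R) g (g1 x).
  apply: is_derive_eq.
  by rewrite /g1 /GRing.scale/=; field; rewrite gt_eqF.
have dg1 (x : R) : is_derive x (1 : R) g1 (g2 x).
  apply: is_derive_eq.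
  by rewrite /g2 /GRing.scale/=; ring.
have gt0 : g t = 0 by rewrite /g subrr mulr0 sin0 mulr0 addr0 subrr.
have g1t0 : g1 t = 0 by rewrite /g1 subrr mulr0 cos0 mulr1 subrr.
have G2 x : `|g2 x| <= A.
  rewrite (le_trans (ler_normD _ _))// lerD// normrM.
  rewrite -[leRHS]mulr1 ler_pM// ?sin_max// normrM mulrC.
  by rewrite ger0_norm// ltW.
have gb s : `|s - t| <= T / 2 -> `|g s| <= 8 * A / w ^+ 2 * (1 - cos (w * (s - t))).
  move=> sT.
  have H1 r x : `|x - t| <= r -> `|g1 x| <= A * r.
    move=> xr; apply: (le_trans (mean_value_center dg1 g1t0 (fun y _ => G2 y) xr)).
    by rewrite ler_wpM2l.
  have := mean_value_center dg gt0 (H1 `|s - t|) (lexx _).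
  move=> /le_trans; apply.
  have -> : A * `|s - t| * `|s - t| = A * (s - t) ^+ 2.
    by rewrite -mulrA -normrM -expr2 ger0_norm ?sqr_ge0.
  have : (w * (s - t)) ^+ 2 <= 8 * (1 - cos (w * (s - t))).
    apply: jordan_cos; rewrite normrM gtr0_norm//.
    rewrite (le_trans (ler_wpM2l (ltW w0) sT))// /w.
    by rewrite (_ : _ * (T / 2) = pi)//; field; rewrite gt_eqF.
  rewrite exprMn => H.
  rewrite (_ : 8 * A / w ^+ 2 * _ = A / w ^+ 2 * (8 * (1 - cos (w * (s - t))))); last by ring.
  apply: le_trans (ler_wpM2l _ H); last by rewrite divr_ge0// exprn_ge0// ltW.
  by rewrite [leRHS]mulrA divfK// expf_neq0// gt_eqF.
move=> s; have [n ns] := period_representative t s T0.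
have := gb _ ns; rewrite /g (periodic_mulz _ _ fT).
have -> : w * (s + n%:~R * T - t) = n%:~R * (2 * pi) + w * (s - t).
  by rewrite /w; field; rewrite gt_eqF.
by rewrite cosDz sinDz.
Qed.
End Fejer.

Section FourierInversion.
Context {R : realType}.
Notation leb := (@lebesgue_measure R).
Implicit Types (f g : R -> R) (a b t x l p T B : R).

(** For real [f] this is [T] times the real part of the [n]-th term of the Fourier series at [t];
    the imaginary parts cancel in symmetric sums. With the shift kept inside the cosine, a symmetric
    sum is the integral of [f] against a Dirichlet kernel centred at [t]. *)
Definition cos_integral T f t (n : int) : R :=
  \int[leb]_(s in `[0, T]) (f s * cos (n%:~R * (2 * pi / T * (s - t)))).

Lemma cos_integral_phase T f t n : cos_integral T f t n =
  \int[leb]_(s in `[0, T])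
    (f s * cos (n%:~R * (2 * pi / T) * s + (- (n%:~R * (2 * pi / T * t))))).
Proof. by apply: eq_Rintegral => s _; congr (_ * cos _); ring. Qed.

Lemma continuous_cos_harmonic T t (n : int) :
  continuous (fun s : R => cos (n%:~R * (2 * pi / T * (s - t)))).
Proof.
have -> : (fun s : R => cos (n%:~R * (2 * pi / T * (s - t)))) =
  (fun s => cos (n%:~R * (2 * pi / T) * s + (- (n%:~R * (2 * pi / T * t))))).
  by apply/funext => s; congr cos; ring.
exact: cos_phase_continuous.
Qed.

Lemma cos_integral_integrable T f t (n : int) : continuous f ->
  leb.-integrable `[0, T]
    (EFin \o (fun s => f s * cos (n%:~R * (2 * pi / T * (s - t))))).
Proof.
move=> cf; apply: continuous_integrable_itv => x; apply: continuousM; first exact: cf.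
exact: continuous_cos_harmonic.
Qed.

Lemma cos_integral1 T t (n : int) : 0 < T ->
  cos_integral T (fun=> 1) t n = if n == 0 then T else 0.
Proof.
move=> T0; rewrite cos_integral_phase.
under eq_Rintegral do rewrite mul1r.
have [->|n0] := eqVneq n 0; last exact: Rint_cos0.
under eq_Rintegral do rewrite !mul0r oppr0 addr0 cos0.
by rewrite Rintegral_cst//= lebesgue_measure_itv/= lte_fin T0/= oppr0 addr0 mul1r.
Qed.

Lemma Rint_sin_harmonic T t (n : int) : 0 < T ->
  leb.-integrable `[0, T] (EFin \o (fun s => sin (n%:~R * (2 * pi / T * (s - t))))) /\
  \int[leb]_(s in `[0, T]) sin (n%:~R * (2 * pi / T * (s - t))) = 0.
Proof.
move=> T0.
have -> : (fun s => sin (n%:~R * (2 * pi / T * (s - t)))) = (fun s =>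
    cos (n%:~R * (2 * pi / T) * s + (- (n%:~R * (2 * pi / T * t)) - pi / 2))).
  by apply/funext => s; rewrite addrA cosBpihalf; congr sin; ring.
split; first by apply: continuous_integrable_itv; exact: cos_phase_continuous.
have [->|n0] := eqVneq n 0; last exact: Rint_cos0.
under eq_Rintegral do rewrite !mul0r oppr0 !add0r cosN cos_pihalf.
by rewrite Rintegral_cst// mul0r.
Qed.

(** [2 sin th cos (n th) = sin ((n + 1) th) - sin ((n - 1) th)], and both sines integrate to zero
    over a period, including the case where a multiplier is 0. *)
Lemma cos_integral_sin T t (n : int) : 0 < T ->
  cos_integral T (fun s => sin (2 * pi / T * (s - t))) t n = 0.
Proof.
move=> T0; rewrite /cos_integral.
have [i1 e1] := @Rint_sin_harmonic T t (n + 1) T0.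
have [i2 e2] := @Rint_sin_harmonic T t (n - 1) T0.
transitivity (\int[leb]_(s in `[0, T]) (2^-1 *
   (sin ((n + 1)%:~R * (2 * pi / T * (s - t))) -
    sin ((n - 1)%:~R * (2 * pi / T * (s - t)))))).
  apply: eq_Rintegral => s _; set th := 2 * pi / T * (s - t).
  have -> : (n + 1)%:~R * th = n%:~R * th + th by rewrite intrD; ring.
  have -> : (n - 1)%:~R * th = n%:~R * th - th by rewrite intrB; ring.
  by rewrite sinB sinD; field.
rewrite RintegralZl//; last first.
  exact: (integrable_EFinB _ i1 i2).
by rewrite RintegralB// e1 e2 subrr mulr0.
Qed.

Lemma fejer_mean T f t M : 0 < T -> continuous f ->
  leb.-integrable `[0, T]
    (EFin \o (fun s => f s * \sum_(N < M) dirichlet N (2 * pi / T * (s - t)))) /\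
  \int[leb]_(s in `[0, T]) (f s * \sum_(N < M) dirichlet N (2 * pi / T * (s - t)))
  = \sum_(N < M) \sum_(i < (2 * N).+1) cos_integral T f t (i%:Z - N%:Z).
Proof.
move=> T0 cf.
have mI : measurable (`[0, T]%classic : set (measurableTypeR R)) by [].
have I (N : nat) := Rintegral_sum (index_enum 'I_(2 * N).+1) mI
  (fun i => @cos_integral_integrable T f t (i%:Z - N%:Z) cf).
have := Rintegral_sum (index_enum 'I_M) mI (fun N => (I N).1).
have -> : (fun x => \sum_(N < M) \sum_(i < (2 * N).+1)
    f x * cos ((i%:Z - N%:Z)%:~R * (2 * pi / T * (x - t)))) =
  (fun s => f s * \sum_(N < M) dirichlet N (2 * pi / T * (s - t))).
  apply/funext => s; rewrite mulr_sumr; apply: eq_bigr => N _.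
  by rewrite mulr_sumr.
move=> [J ->]; split=> //; apply: eq_bigr => N _; exact: (I N).2.
Qed.

(* The sine is orthogonal to the Fejer kernel F; once it is subtracted, what is
   left of f - f t is O(1 - cos), and (1 - cos) M F = 1 - cos (M _) is bounded. *)
Lemma fejer_error T B f t : 0 < T -> smooth_periodic T B f ->
  exists L : R, forall M : nat,
  `|\sum_(N < M) \sum_(i < (2 * N).+1) cos_integral T f t (i%:Z - N%:Z)
    - M%:R * (T * f t)| <= L.
Proof.
move=> T0 sf; have [d [L [L0 HL]]] := second_order_remainder t T0 sf.
have cf : continuous f.
  by case: sf => [? [? [? [[d0 _ _ _] _ _]]]]; exact: derive_continuous d0.
exists (2 * L * T) => M.
pose w := 2 * pi / T; pose F s := \sum_(N < M) dirichlet N (w * (s - t)).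
have c1 : continuous (fun _ : R => 1 : R) by move=> x; exact: cst_continuous.
have cs : continuous (fun s : R => sin (w * (s - t))).
  apply: (@derive_continuous _ _ (fun s => w * cos (w * (s - t)))) => x.
  by apply: is_derive_eq; rewrite /GRing.scale/=; ring.
have [If Ef] := @fejer_mean T f t M T0 cf.
have [I1 E1] := @fejer_mean T (fun=> 1) t M T0 c1.
have [Is Es] := @fejer_mean T _ t M T0 cs.
rewrite -Ef.
have E1' : \int[leb]_(s in `[0, T]) (1 * F s) = M%:R * T.
  rewrite E1 (eq_bigr (fun=> T)) ?sumr_const ?card_ord ?mulr_natl// => N _.
  rewrite (sum_symmetric0 (cos_integral T (fun=> 1) t)) cos_integral1//= big1 ?addr0//.
  by move=> k _; rewrite !cos_integral1//= addr0.
have Es' : \int[leb]_(s in `[0, T]) (sin (w * (s - t)) * F s) = 0.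
  rewrite Es big1// => N _; rewrite big1// => i _; exact: cos_integral_sin.
have mI : measurable (`[0, T]%classic : set (measurableTypeR R)) by [].
have I2 := integrable_EFinZl mI (f t) I1.
have I3 := integrable_EFinZl mI d Is.
have -> : M%:R * (T * f t) = \int[leb]_(s in `[0, T])
   (f t * (1 * F s) + d * (sin (w * (s - t)) * F s)).
  by rewrite RintegralD// RintegralZl// E1' RintegralZl// Es'; ring.
rewrite -RintegralB//; last first.
  exact: (integrable_EFinD mI I2 I3).
have Ig : leb.-integrable `[0, T] (EFin \o (fun s => f s * F s -
   (f t * (1 * F s) + d * (sin (w * (s - t)) * F s)))).
  exact: (integrable_EFinB mI If (integrable_EFinD mI I2 I3)).
apply: (le_trans (le_normr_Rintegral _ Ig)) => //.
apply: (@le_trans _ _ (\int[leb]_(s in `[0, T]) (2 * L))); last first.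
  by rewrite Rintegral_cst//= lebesgue_measure_itv/= lte_fin T0/= oppr0 addr0.
apply: le_Rintegral => //.
- exact: integrable_EFin_norm.
- by apply: continuous_integrable_itv => x; exact: cst_continuous.
move=> s _; rewrite (_ : _ - _ = (f s - (f t + d * sin (w * (s - t)))) * F s); last by ring.
have := fejer_telescope M (w * (s - t)); rewrite -/(F s) => FE.
have := HL s; rewrite -/w; move: (f s - _) => gs Hg.
have c2 : 0 <= 1 - cos (w * (s - t)) by rewrite subr_ge0 cos_le1.
rewrite normrM (le_trans (ler_wpM2r _ Hg))//.
rewrite -mulrA -{1}(ger0_norm c2) -normrM [_ * F s]mulrC FE mulrC ler_wpM2r//.
have := cos_max (M%:R * (w * (s - t))); rewrite !ler_norml => /andP[? ?].
by apply/andP; split; lra.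
Qed.

Lemma cos_integral_bound T B f t (n : int) : 0 < T -> n != 0 ->
  smooth_periodic T B f ->
  `|cos_integral T f t n| <= B * T / (2 * pi / T) ^+ 3 / `|n|%:R ^+ 3.
Proof. by move=> T0 n0 sf; rewrite cos_integral_phase; exact: smooth_periodic_bound. Qed.

Lemma smooth_periodic_bound_ge0 T B f : 0 < T -> smooth_periodic T B f -> 0 <= B.
Proof.
move=> T0 [? [? [? [_ _ /(_ 0)]]]]; rewrite lexx ltW// => /(_ isT)[b _ _].
exact: le_trans b.
Qed.

(** Cubic decay makes the partial sums converge to some [p], so their Cesaro means converge to [p]
    too. By [fejer_error] the sum of the first [M] partial sums differs from [M * (T * f t)] by a
    bounded amount, so the means tend to [T * f t], which is therefore [p]. *)
Lemma fourier_inversion T B f t : 0 < T -> smooth_periodic T B f ->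
  \sum_(i < (2 * N).+1) cos_integral T f t (i%:Z - N%:Z) @[N --> \oo] --> T * f t.
Proof.
move=> T0 sf; have [L HL] := fejer_error t T0 sf.
set P := (X in X @ \oo).
pose c := cos_integral T f t; pose u k := c k.+1%:Z + c (- k.+1%:Z).
pose C := B * T / (2 * pi / T) ^+ 3.
have C0 : 0 <= C.
  apply: divr_ge0; first by rewrite mulr_ge0 ?(smooth_periodic_bound_ge0 T0 sf) ?ltW.
  by rewrite exprn_ge0// divr_ge0 ?mulr_ge0 ?pi_ge0 ?ltW.
have PE : P = (fun N => c 0 + series u N).
  by apply/funext => N; rewrite /P sum_symmetric0 /series/= big_mkord.
(* A telescoping majorant of the two cubic bounds [C / k.+1 ^+ 3], one for each sign of the
   frequency. *)
have uB k : `|u k| <= 4 * C * (k.+1%:R^-1 - k.+2%:R^-1).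
  have b1 := @cos_integral_bound T B f t k.+1%:Z T0 isT sf.
  have b2 := @cos_integral_bound T B f t (- k.+1%:Z) T0 isT sf.
  rewrite (le_trans (ler_normD _ _))// (le_trans (lerD b1 b2))//.
  rewrite abszN absz_nat -/C -mulr2n -[leLHS]mulr_natl.
  have -> : 4 * C * (k.+1%:R^-1 - k.+2%:R^-1) = 2 * (C * (2 * (k.+1%:R^-1 - k.+2%:R^-1))).
    by ring.
  apply: ler_wpM2l => //; apply: ler_wpM2l => //.
  rewrite -[k.+2]addn1 natrD; set m := k.+1%:R.
  have m1 : 1 <= m by rewrite ler1n.
  have -> : 2 * (m^-1 - (m + 1)^-1) = 2 * m ^+ 2 / (m + 1) / m ^+ 3.
    by field; apply/andP; split; apply: lt0r_neq0; lra.
  rewrite -[leLHS]mul1r; apply: ler_wpM2r; first by rewrite invr_ge0 exprn_ge0//; lra.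
  rewrite ler_pdivlMr; last by lra.
  nra.
have cu : cvgn (series u).
  apply: normed_cvg; apply: nondecreasing_is_cvgn.
    by apply: nondecreasing_series => k _ _; exact: normr_ge0.
  exists (4 * C) => _ [N _ <-]; rewrite /series/=.
  apply: (@le_trans _ _ (\sum_(0 <= k < N) (4 * C * (k.+1%:R^-1 - k.+2%:R^-1)))).
    by apply: ler_sum => k _; exact: uB.
  rewrite -mulr_sumr -[leRHS]mulr1; apply: ler_wpM2l; first exact: mulr_ge0.
  under eq_bigr do rewrite -opprB.
  rewrite sumrN telescope_sumr// invr1 opprB gerBl invr_ge0//.
have [p Pp] : exists p, P @ \oo --> p.
  by exists (c 0 + limn (series u)); rewrite PE; apply: cvgD => //; exact: cvg_cst.
suff -> : T * f t = p by [].
have := cesaro Pp => Ap; symmetry.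
apply: (cvg_unique _ Ap) => //.
apply/cvgrPdist_le => e e0.
near=> M.
rewrite /arithmetic_mean/= /series/= big_mkord.
have -> : T * f t - M.+1%:R^-1 * \sum_(i < M.+1) P i =
   M.+1%:R^-1 * - (\sum_(i < M.+1) P i - M.+1%:R * (T * f t)).
  by field; rewrite nat1r.
rewrite normrM normrN ger0_norm ?invr_ge0// mulrC ler_pdivrMr// (le_trans (HL _))//.
rewrite -ler_pdivrMl// mulrC.
apply: (@le_trans _ _ M%:R); last by rewrite ler_nat.
near: M; exact: nbhs_infty_ger.
Unshelve. all: by end_near. Qed.
End FourierInversion.

(** * Moduli of complex numbers and the complex exponential *)

Section ComplexNumbers.
Context {R : rcfType}.
Implicit Types (x y z : R[i]).

Lemma Re_add x y : Re (x + y) = Re x + Re y. Proof. by case: x; case: y. Qed.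
Lemma Im_add x y : Im (x + y) = Im x + Im y. Proof. by case: x; case: y. Qed.
Lemma Re_opp x : Re (- x) = - Re x. Proof. by case: x. Qed.
Lemma Im_opp x : Im (- x) = - Im x. Proof. by case: x. Qed.
Lemma Re_mul x y : Re (x * y) = Re x * Re y - Im x * Im y.
Proof. by case: x; case: y. Qed.
Lemma Im_mul x y : Im (x * y) = Re x * Im y + Im x * Re y.
Proof. by case: x; case: y. Qed.
Lemma Re_conj x : Re (x^*)%C = Re x. Proof. by case: x. Qed.
Lemma Im_conj x : Im (x^*)%C = - Im x. Proof. by case: x. Qed.

Lemma Re_sum I (s : seq I) (F : I -> R[i]) :
  Re (\sum_(i <- s) F i) = \sum_(i <- s) Re (F i).
Proof. exact: (big_morph _ Re_add). Qed.

Lemma Im_sum I (s : seq I) (F : I -> R[i]) :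
  Im (\sum_(i <- s) F i) = \sum_(i <- s) Im (F i).
Proof. exact: (big_morph _ Im_add). Qed.

Lemma complex_ext x y : Re x = Re y -> Im x = Im y -> x = y.
Proof. by case: x => a b; case: y => c d /= -> ->. Qed.

Lemma Re_int (n : int) : Re (n%:~R : R[i]) = n%:~R.
Proof. by rewrite -(rmorph_int (real_complex R)). Qed.
Lemma Im_int (n : int) : Im (n%:~R : R[i]) = 0.
Proof. by rewrite -(rmorph_int (real_complex R)). Qed.

Lemma normc_ge0 x : 0 <= normc x.
Proof. by case: x => a b; exact: sqrtr_ge0. Qed.

Lemma normc_sqr x : normc x ^+ 2 = Re x ^+ 2 + Im x ^+ 2.
Proof. by case: x => a b; rewrite sqr_sqrtr ?addr_ge0 ?sqr_ge0. Qed.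

Lemma normc_le_ReIm x : normc x <= `|Re x| + `|Im x|.
Proof.
rewrite -(@ler_pXn2r _ 2) ?nnegrE ?addr_ge0 ?normc_ge0// normc_sqr.
rewrite -(real_normK (num_real (Re x))) -(real_normK (num_real (Im x))).
have : 0 <= `|Re x| * `|Im x| by rewrite mulr_ge0.
nra.
Qed.

Lemma Re_le_normc x : `|Re x| <= normc x.
Proof.
rewrite -(@ler_pXn2r _ 2) ?nnegrE ?normc_ge0// normc_sqr real_normK ?num_real//.
by rewrite lerDl sqr_ge0.
Qed.

Lemma normc_real (a : R) : normc a%:C%C = `|a|.
Proof. by rewrite /= expr0n addr0 sqrtr_sqr. Qed.

Lemma normc_sum I (s : seq I) (F : I -> R[i]) :
  normc (\sum_(i <- s) F i) <= \sum_(i <- s) normc (F i).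
Proof.
elim/big_rec2: _ => [|i a x _ H]; first by rewrite ComplexField.Normc.normc0.
by apply: (le_trans (le_normcD _ _)); rewrite lerD2l.
Qed.

Lemma sumr_conj I (s : seq I) (F : I -> R[i]) :
  ((\sum_(i <- s) F i)^*)%C = \sum_(i <- s) ((F i)^*)%C.
Proof. exact: raddf_sum. Qed.

End ComplexNumbers.

Section ComplexExponential.
Context {R : realType}.

Lemma cexpD (x y : R[i]) : cexp (x + y) = cexp x * cexp y.
Proof.
apply: complex_ext; rewrite /cexp ?(Re_mul, Im_mul, Re_add, Im_add)/= expRD cosD ?sinD; ring.
Qed.

Lemma normc_cexp (x : R[i]) : normc (cexp x) = expR (Re x).
Proof.
rewrite /cexp ComplexField.Normc.normcM normc_real ger0_norm ?expR_ge0//=.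
by rewrite cos2Dsin2 sqrtr1 mulr1.
Qed.

Lemma cexp_imag (a : R) : cexp ('i%C * a%:C%C) = (cos a +i* sin a)%C.
Proof.
have e : 0 * a - 1 * 0 = 0 :> R by ring.
apply: complex_ext; rewrite /cexp !(Re_mul, Im_mul)/= e expR0 mul0r add0r !mul1r mul0r.
  exact: subr0.
exact: addr0.
Qed.

Lemma cexp_harmonic (n : int) (a : R) :
  cexp ('i%C * n%:~R * a%:C%C) = (cos (n%:~R * a) +i* sin (n%:~R * a))%C.
Proof.
rewrite -mulrA -[n%:~R in LHS](rmorph_int (real_complex R)) -rmorphM; exact: cexp_imag.
Qed.

Lemma cexp_harmonicN (n : int) (a : R) :
  cexp (- 'i%C * n%:~R * a%:C%C) = (cos (n%:~R * a) -i* sin (n%:~R * a))%C.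
Proof.
rewrite !mulNr -[- _]mulrN -[- (a%:C)%C](rmorphN (real_complex R)).
by rewrite cexp_harmonic mulrN cosN sinN.
Qed.
End ComplexExponential.

(** * Tails of a series outside a shifted frequency window *)

Section WindowSums.
Context {R : realFieldType}.

(** For [b >= 1] one has [b ^- 3 <= 2 / b ^+ 2 - 2 / (b + 1) ^+ 2], and the right-hand side
    telescopes. *)
Lemma sum_inv_cubes (a : R) r : 1 <= a ->
  \sum_(i < r) (a + i%:R) ^- 3 <= 2 / a ^+ 2.
Proof.
move=> a1.
apply: (@le_trans _ _ (\sum_(0 <= i < r)
    (- (2 / (a + i.+1%:R) ^+ 2) - - (2 / (a + i%:R) ^+ 2)))).
  rewrite big_mkord; apply: ler_sum => i _; rewrite -[i.+1]addn1 natrD addrA.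
  have : 1 <= a + i%:R by rewrite ler_wpDr.
  move: (a + _) => b b1; rewrite opprK [leRHS]addrC.
  have -> : 2 / b ^+ 2 - 2 / (b + 1) ^+ 2 = (2 * b * (2 * b + 1) / (b + 1) ^+ 2) / b ^+ 3.
    by field; apply/andP; split; apply: lt0r_neq0; lra.
  rewrite -[leLHS]mul1r; apply: ler_wpM2r.
    by rewrite invr_ge0 exprn_ge0//; lra.
  rewrite ler_pdivlMr; last by rewrite exprn_gt0//; lra.
  nra.
rewrite telescope_sumr// opprK addr0 addrC gerBl divr_ge0// exprn_ge0//.
by rewrite addr_ge0//; lra.
Qed.

(** The window is [-K - m, K - m], which [2 * K <= N] places inside [-N, N]. The lower tail is
    listed backwards, so that both tails move away from zero as [i] grows. *)
Lemma window_split (G : int -> R) (K N : nat) (m : int) :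
  (`|m| <= K)%N -> (2 * K <= N)%N ->
  \sum_(i < (2 * N).+1) G (i%:Z - N%:Z) =
  \sum_(i < absz (N%:Z - K%:Z - m)%R) G (- (K%:Z + m + 1 + i%:Z))
  + \sum_(i < 2 * K + 1) G (i%:Z - K%:Z - m)
  + \sum_(i < absz (N%:Z - K%:Z + m)%R) G (K%:Z - m + 1 + i%:Z).
Proof.
move=> mK KN.
rewrite -(big_mkord xpredT (fun i => G (i%:Z - N%:Z))).
set p := absz (N%:Z - K%:Z - m)%R; set r := absz (N%:Z - K%:Z + m)%R.
rewrite (@big_cat_nat _ _ _ p 0)//=; last by rewrite /p; lia.
rewrite (@big_cat_nat _ _ _ (2 * K + 1 + p) p) ?leq_addl//=; last by rewrite /p; lia.
rewrite addrA; congr (_ + _ + _).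
- rewrite big_mkord (reindex_inj rev_ord_inj)/=; apply: eq_bigr => i _; congr G.
  by have := ltn_ord i; rewrite /p; lia.
- rewrite -{1}[p]add0n big_addn addnK big_mkord; apply: eq_bigr => i _; congr G.
  by rewrite /p; lia.
- rewrite -{1}[(2 * K + 1 + p)%N]add0n big_addn big_mkord.
  have -> : ((2 * N).+1 - (2 * K + 1 + p) = r)%N by rewrite /p /r; lia.
  by apply: eq_bigr => i _; congr G; rewrite /p; lia.
Qed.

Lemma window_tail (G : int -> R) (c : R) (K N : nat) (m : int) : 0 <= c ->
  (forall n : int, n != 0 -> `|G n| <= c / `|n|%N%:R ^+ 3) ->
  (`|m| <= K)%N -> (2 * K <= N)%N ->
  `|\sum_(i < (2 * N).+1) G (i%:Z - N%:Z) - \sum_(i < 2 * K + 1) G (i%:Z - K%:Z - m)|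
    <= 4 * c / (K%:R + 1 - `|m|%N%:R) ^+ 2.
Proof.
move=> c0 HG mK KN; rewrite (window_split G mK KN) addrAC addrK.
have mKR : (`|m|%N%:R : R) <= K%:R by rewrite ler_nat.
have M1 : 1 <= K%:R + 1 - `|m|%N%:R :> R by lra.
set M := K%:R + 1 - _ in M1 *.
(* Treats both tails: [e = m] below the window, [e = - m] above it. The moduli start at
   [K + e + 1 >= K + 1 - |m|] and increase by one. *)
have tail (e : int) (r : nat) (H : nat -> int) :
   (absz (K%:Z + 1 - `|m|%N%:Z)%R <= absz (K%:Z + e + 1)%R)%N ->
   (`|e| <= K)%N ->
   (forall i, absz (H i) = (absz (K%:Z + e + 1)%R + i)%N) ->
  `|\sum_(i < r) G (H i)| <= 2 * c / M ^+ 2.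
  move=> He eK HH; set a := absz (K%:Z + e + 1)%R in He HH.
  have a1 : 1 <= a%:R :> R by rewrite ler1n /a; lia.
  have aM : M <= a%:R.
    have -> : M = (absz (K%:Z + 1 - `|m|%N%:Z)%R)%:R.
      rewrite /M; have -> : K%:R + 1 - `|m|%N%:R = (K%:Z + 1 - `|m|%N%:Z)%:~R :> R.
        by rewrite intrB intrD.
      have -> : (K%:Z + 1 - `|m|%N%:Z) = (absz (K%:Z + 1 - `|m|%N%:Z)%R)%:Z by lia.
      by [].
    by rewrite ler_nat.
  apply: (le_trans (ler_norm_sum _ _ _)).
  apply: (@le_trans _ _ (\sum_(i < r) c * (a%:R + i%:R) ^- 3)).
    apply: ler_sum => i _; apply: (le_trans (HG _ _)); last by rewrite HH natrD.
    by rewrite -absz_gt0 HH; lia.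
  rewrite -mulr_sumr (le_trans (ler_wpM2l c0 (sum_inv_cubes r a1)))//.
  rewrite mulrA [c * 2]mulrC ler_wpM2l ?mulr_ge0// lef_pV2 ?posrE ?exprn_gt0//; try lra.
  by rewrite lerXn2r ?nnegrE//; lra.
apply: (le_trans (ler_normD _ _)).
rewrite (_ : 4 * c / M ^+ 2 = 2 * c / M ^+ 2 + 2 * c / M ^+ 2); last by ring.
apply: lerD.
- apply: (tail m _ (fun i => - (K%:Z + m + 1 + i%:Z))); [lia|lia|].
  by move=> i; lia.
- apply: (tail (- m) _ (fun i => K%:Z - m + 1 + i%:Z)); [lia|lia|].
  by move=> i; lia.
Qed.
End WindowSums.

(** * Complex Fourier coefficients: decay and truncation error *)

Section FourierCoefficients.
Context {R : realType}.
Notation leb := (@lebesgue_measure R).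
Implicit Types (f : R -> R) (a : R -> R[i]) (t T B : R) (n : int).

Definition sin_integral T f t n : R :=
  \int[leb]_(s in `[0, T]) (f s * sin (n%:~R * (2 * pi / T * (s - t)))).

Lemma sin_integral_phase T f t n : sin_integral T f t n =
  \int[leb]_(s in `[0, T])
    (f s * cos (n%:~R * (2 * pi / T) * s + (- (n%:~R * (2 * pi / T * t)) - pi / 2))).
Proof.
by apply: eq_Rintegral => s _; rewrite addrA cosBpihalf; congr (_ * sin _); ring.
Qed.

Lemma sin_integral_bound T B f t n : 0 < T -> n != 0 -> smooth_periodic T B f ->
  `|sin_integral T f t n| <= B * T / (2 * pi / T) ^+ 3 / `|n|%N%:R ^+ 3.
Proof. by move=> T0 n0 sf; rewrite sin_integral_phase; exact: smooth_periodic_bound. Qed.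

Lemma sin_integral_integrable T f t n : continuous f ->
  leb.-integrable `[0, T]
    (EFin \o (fun s => f s * sin (n%:~R * (2 * pi / T * (s - t))))).
Proof.
move=> cf; apply: continuous_integrable_itv => x; apply: continuousM; first exact: cf.
have -> : (fun s : R => sin (n%:~R * (2 * pi / T * (s - t)))) =
  (fun s => cos (n%:~R * (2 * pi / T) * s + (- (n%:~R * (2 * pi / T * t)) - pi / 2))).
  by apply/funext => s; rewrite addrA cosBpihalf; congr sin; ring.
exact: cos_phase_continuous.
Qed.

Lemma sin_integralN T f t n : continuous f ->
  sin_integral T f t (- n) = - sin_integral T f t n.
Proof.
move=> cf; rewrite -[RHS]mulN1r /sin_integral -RintegralZl//; last exact: sin_integral_integrable.
by apply: eq_Rintegral => s _; rewrite mulrNz mulNr sinN; ring.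
Qed.

Lemma cos_integral_shift T f t n : continuous f ->
  cos_integral T f t n = cos (n%:~R * (2 * pi / T * t)) * cos_integral T f 0 n
                       + sin (n%:~R * (2 * pi / T * t)) * sin_integral T f 0 n.
Proof.
move=> cf.
have I1 := @cos_integral_integrable _ T f 0 n cf.
have I2 := @sin_integral_integrable T f 0 n cf.
have mI : measurable (`[0, T]%classic : set (measurableTypeR R)) by [].
rewrite [in RHS]/cos_integral [in RHS]/sin_integral.
rewrite -(RintegralZl (cos (n%:~R * (2 * pi / T * t))) mI I1).
rewrite -(RintegralZl (sin (n%:~R * (2 * pi / T * t))) mI I2).
rewrite -(RintegralD mI (integrable_EFinZl mI _ I1) (integrable_EFinZl mI _ I2)).
apply: eq_Rintegral => s _; rewrite !subr0.
rewrite (_ : n%:~R * (2 * pi / T * (s - t)) =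
  n%:~R * (2 * pi / T * s) - n%:~R * (2 * pi / T * t)); last by ring.
by rewrite cosB; ring.
Qed.

Lemma sin_integral_shift T f t n : continuous f ->
  sin_integral T f t n = cos (n%:~R * (2 * pi / T * t)) * sin_integral T f 0 n
                       - sin (n%:~R * (2 * pi / T * t)) * cos_integral T f 0 n.
Proof.
move=> cf.
have I1 := @cos_integral_integrable _ T f 0 n cf.
have I2 := @sin_integral_integrable T f 0 n cf.
have mI : measurable (`[0, T]%classic : set (measurableTypeR R)) by [].
rewrite [in RHS]/cos_integral [in RHS]/sin_integral.
rewrite -(RintegralZl (sin (n%:~R * (2 * pi / T * t))) mI I1).
rewrite -(RintegralZl (cos (n%:~R * (2 * pi / T * t))) mI I2).
rewrite -(RintegralB mI (integrable_EFinZl mI _ I2) (integrable_EFinZl mI _ I1)).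
apply: eq_Rintegral => s _; rewrite !subr0.
rewrite (_ : n%:~R * (2 * pi / T * (s - t)) =
  n%:~R * (2 * pi / T * s) - n%:~R * (2 * pi / T * t)); last by ring.
by rewrite sinB; ring.
Qed.

Definition time_coef T a n : R[i] :=
  (T^-1)%:C%C * cintegral leb `[0, T]
    (fun s : measurableTypeR R => a s * cexp ('i%C * n%:~R * (2 * pi / T * s)%:C%C)).

Definition time_term T a t n : R[i] :=
  time_coef T a n * cexp (- 'i%C * n%:~R * (2 * pi / T * t)%:C%C).

Definition csmooth_periodic T B a :=
  smooth_periodic T B (fun s => Re (a s)) /\ smooth_periodic T B (fun s => Im (a s)).

Lemma smooth_periodic_continuous T B f : smooth_periodic T B f -> continuous f.
Proof. by move=> [? [? [? [[d0 _ _ _] _ _]]]]; exact: derive_continuous d0. Qed.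

(** Reduces a complex term to real integrals. The shift formulas move the exponential at [t] inside
    the integrals, where the real bounds and the real inversion theorem apply. *)
Lemma time_termE T B a t n : csmooth_periodic T B a ->
  let a1 := fun s => Re (a s) in let a2 := fun s => Im (a s) in
  time_term T a t n = (T^-1)%:C%C *
    ((cos_integral T a1 t n - sin_integral T a2 t n) +i*
     (sin_integral T a1 t n + cos_integral T a2 t n))%C.
Proof.
move=> [s1 s2] a1 a2.
have c1 : continuous a1 := smooth_periodic_continuous s1.
have c2 : continuous a2 := smooth_periodic_continuous s2.
have mI : measurable (`[0, T]%classic : set (measurableTypeR R)) by [].
rewrite /time_term /time_coef -mulrA; congr (_ * _).
have -> : cintegral leb `[0, T] (fun s : measurableTypeR R =>
    a s * cexp ('i%C * n%:~R * (2 * pi / T * s)%:C%C)) =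
   ((cos_integral T a1 0 n - sin_integral T a2 0 n) +i*
     (sin_integral T a1 0 n + cos_integral T a2 0 n))%C.
  rewrite /cintegral; congr (_ +i* _)%C.
    rewrite -(RintegralB mI (cos_integral_integrable T 0 n c1)
      (sin_integral_integrable T 0 n c2)).
    by apply: eq_Rintegral => s _; rewrite cexp_harmonic Re_mul/= subr0.
  rewrite -(RintegralD mI (sin_integral_integrable T 0 n c1)
    (cos_integral_integrable T 0 n c2)).
  by apply: eq_Rintegral => s _; rewrite cexp_harmonic Im_mul/= subr0.
rewrite cexp_harmonicN.
rewrite (cos_integral_shift T t n c1) (cos_integral_shift T t n c2).
rewrite (sin_integral_shift T t n c1) (sin_integral_shift T t n c2).
by apply: complex_ext; rewrite ?Re_mul ?Im_mul/=; ring.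
Qed.

Lemma time_term_bound T B a t n : 0 < T -> n != 0 -> csmooth_periodic T B a ->
  let c := 2 * B / (2 * pi / T) ^+ 3 / `|n|%N%:R ^+ 3 in
  `|Re (time_term T a t n)| <= c /\ `|Im (time_term T a t n)| <= c.
Proof.
move=> T0 n0 sa c; have [s1 s2] := sa.
have b1 := cos_integral_bound t T0 n0 s1.
have b2 := cos_integral_bound t T0 n0 s2.
have b3 := sin_integral_bound t T0 n0 s1.
have b4 := sin_integral_bound t T0 n0 s2.
have cE : c = T^-1 * (B * T / (2 * pi / T) ^+ 3 / `|n|%N%:R ^+ 3 +
                 B * T / (2 * pi / T) ^+ 3 / `|n|%N%:R ^+ 3).
  have : 0 < (2 * pi / T) ^+ 3 by rewrite exprn_gt0// divr_gt0// mulr_gt0// pi_gt0.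
  have : 0 < `|n|%N%:R ^+ 3 :> R by rewrite exprn_gt0// ltr0n absz_gt0.
  rewrite /c; move: (_ ^+ 3) (_ ^+ 3) => x y x0 y0.
  by field; rewrite !gt_eqF.
rewrite (time_termE _ _ sa) Re_mul Im_mul/= !mul0r subr0 addr0 !normrM.
rewrite cE ger0_norm ?invr_ge0 ?(ltW T0)//.
split; rewrite ler_wpM2l ?invr_ge0 ?(ltW T0)//.
  by rewrite (le_trans (ler_normB _ _))// lerD.
by rewrite (le_trans (ler_normD _ _))// lerD.
Qed.

Lemma time_coef0_bound T B a : 0 < T -> csmooth_periodic T B a ->
  normc (time_coef T a 0) <= 2 * B.
Proof.
move=> T0 [s1 s2].
have bd f : smooth_periodic T B f -> `|T^-1 * \int[leb]_(s in `[0, T]) f s| <= B.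
  move=> sf; have If := continuous_integrable_itv 0 T (smooth_periodic_continuous sf).
  rewrite normrM ger0_norm ?invr_ge0 ?(ltW T0)// mulrC ler_pdivrMr//.
  apply: (le_trans (le_normr_Rintegral _ If)) => //.
  apply: (@le_trans _ _ (\int[leb]_(s in `[0, T]) B)).
    apply: le_Rintegral => //.
    - exact: integrable_EFin_norm.
    - by apply: continuous_integrable_itv => x; exact: cst_continuous.
    move=> s /=; rewrite in_itv/= => sT.
    by case: sf => [? [? [? [_ _ /(_ s sT)[]]]]].
  by rewrite Rintegral_cst//= lebesgue_measure_itv/= lte_fin T0/= oppr0 addr0.
apply: (le_trans (normc_le_ReIm _)); rewrite mulr_natl mulr2n.
rewrite /time_coef Re_mul Im_mul/= !mul0r subr0 addr0.
apply: lerD.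
  under eq_Rintegral do rewrite cexp_harmonic Re_mul/= mul0r cos0 sin0 mulr0 mulr1 subr0.
  exact: bd.
under eq_Rintegral do rewrite cexp_harmonic Im_mul/= mul0r cos0 sin0 mulr0 mulr1 add0r.
exact: bd.
Qed.

Lemma normc_time_term T a t n : normc (time_term T a t n) = normc (time_coef T a n).
Proof.
rewrite /time_term ComplexField.Normc.normcM cexp_harmonicN/= sqrrN cos2Dsin2.
by rewrite sqrtr1 mulr1.
Qed.

(** Quadratic decay in [1 + |n|] covers [n = 0] as well; the summand 2 of the constant is for that
    case. For [n != 0] the real and imaginary parts together give
    [4 * B / (2 * pi / T) ^+ 3 / |n| ^+ 3], and [|n| ^- 3 <= 4 / (1 + |n|) ^+ 2] produces 16. *)
Lemma time_coef_bound T B a n : 0 < T -> csmooth_periodic T B a ->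
  normc (time_coef T a n) <= (2 + 16 / (2 * pi / T) ^+ 3) * B / (1 + `|n|%N%:R) ^+ 2.
Proof.
move=> T0 sa.
have B0 : 0 <= B := smooth_periodic_bound_ge0 T0 sa.1.
have w0 : 0 < (2 * pi / T) ^+ 3 by rewrite exprn_gt0// divr_gt0// mulr_gt0// pi_gt0.
have [->|n0] := eqVneq n 0.
  rewrite absz0 addr0 expr1n divr1 (le_trans (time_coef0_bound T0 sa))//.
  by rewrite ler_wpM2r// lerDl divr_ge0// ltW.
have [b1 b2] := @time_term_bound T B a 0 n T0 n0 sa.
rewrite -(normc_time_term T a 0) (le_trans (normc_le_ReIm _))// (le_trans (lerD b1 b2))//.
have n1 : 1 <= `|n|%N%:R :> R by rewrite ler1n absz_gt0.
move: w0 n1; move: (_ ^+ 3) `|n|%N%:R => w m w0 m1.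
rewrite -[leLHS]mulr2n -[leLHS]mulr_natl.
have -> : 2 * (2 * B / w / m ^+ 3) = 4 * B / w * m ^- 3.
  by field; rewrite !gt_eqF//; lra.
apply: (@le_trans _ _ (16 / w * B / (1 + m) ^+ 2)); last first.
  rewrite ler_wpM2r ?invr_ge0 ?sqr_ge0// ler_wpM2r// lerDr//.
have -> : 16 / w * B / (1 + m) ^+ 2 = 4 * B / w * (4 / (1 + m) ^+ 2).
  by field; rewrite !gt_eqF//; lra.
apply: ler_wpM2l; first by rewrite divr_ge0 ?mulr_ge0// ltW.
rewrite ler_pdivlMr ?exprn_gt0//; last by lra.
rewrite mulrC ler_pdivrMr ?exprn_gt0//; last by lra.
have : m ^+ 2 <= m ^+ 3 by rewrite ler_weXn2l.
nra.
Qed.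

(** By inversion the difference is a limit of symmetric partial sums minus the window, and
    [window_tail] bounds these uniformly in [N]. Real and imaginary parts contribute 8 each. *)
Lemma window_error T B a t (K : nat) (m : int) : 0 < T -> csmooth_periodic T B a ->
  (`|m| <= K)%N ->
  normc (a t - \sum_(i < 2 * K + 1) time_term T a t (i%:Z - K%:Z - m)) <=
    16 / (2 * pi / T) ^+ 3 * B / (K%:R + 1 - `|m|%N%:R) ^+ 2.
Proof.
move=> T0 sa mK; have [s1 s2] := sa.
have B0 : 0 <= B := smooth_periodic_bound_ge0 T0 s1.
have c1 := smooth_periodic_continuous s1; have c2 := smooth_periodic_continuous s2.
have w0 : 0 < (2 * pi / T) ^+ 3 by rewrite exprn_gt0// divr_gt0// mulr_gt0// pi_gt0.
set M := K%:R + _ - _.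
(* Sine integrals are odd in the frequency, so symmetric sums retain only the cosine integrals,
   which [fourier_inversion] handles. *)
have sin0 f N : continuous f ->
    \sum_(i < (2 * N).+1) sin_integral T f t (i%:Z - N%:Z) = 0.
  move=> cf; rewrite (sum_symmetric0 (sin_integral T f t)).
  rewrite big1 => [|k _]; last by rewrite sin_integralN// subrr.
  have := @sin_integralN T f t 0 cf; rewrite oppr0; lra.
have cvgRe : \sum_(i < (2 * N).+1) Re (time_term T a t (i%:Z - N%:Z)) @[N --> \oo]
    --> Re (a t).
  rewrite (_ : (fun N => _) = (fun N => T^-1 * \sum_(i < (2 * N).+1)
      cos_integral T (fun s => Re (a s)) t (i%:Z - N%:Z))); last first.
    apply/funext => N; under eq_bigr do rewrite (time_termE _ _ sa) Re_mul/= mul0r subr0.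
    by rewrite -mulr_sumr sumrB sin0// subr0.
  rewrite -[Re (a t)](mulKf (lt0r_neq0 T0)).
  by apply: cvgMr; exact: fourier_inversion s1.
have cvgIm : \sum_(i < (2 * N).+1) Im (time_term T a t (i%:Z - N%:Z)) @[N --> \oo]
    --> Im (a t).
  rewrite (_ : (fun N => _) = (fun N => T^-1 * \sum_(i < (2 * N).+1)
      cos_integral T (fun s => Im (a s)) t (i%:Z - N%:Z))); last first.
    apply/funext => N; under eq_bigr do rewrite (time_termE _ _ sa) Im_mul/= mul0r addr0.
    by rewrite -mulr_sumr big_split/= sin0// add0r.
  rewrite -[Im (a t)](mulKf (lt0r_neq0 T0)).
  by apply: cvgMr; exact: fourier_inversion s2.
have lim (G : int -> R) l :
    (forall n, n != 0 -> `|G n| <= 2 * B / (2 * pi / T) ^+ 3 / `|n|%N%:R ^+ 3) ->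
    \sum_(i < (2 * N).+1) G (i%:Z - N%:Z) @[N --> \oo] --> l ->
    `|l - \sum_(i < 2 * K + 1) G (i%:Z - K%:Z - m)| <=
      4 * (2 * B / (2 * pi / T) ^+ 3) / M ^+ 2.
  move=> GB Gl.
  set S := \sum_(i < 2 * K + 1) _.
  have H : `|\sum_(i < (2 * N).+1) G (i%:Z - N%:Z) - S| @[N --> \oo] --> `|l - S|.
    by apply: cvg_norm; apply: cvgB => //; exact: cvg_cst.
  apply: (cvgr_to_le H); near=> N; apply: window_tail => //.
    by apply: divr_ge0; [exact: mulr_ge0|exact: ltW].
  near: N; exact: nbhs_infty_ge.
apply: (le_trans (normc_le_ReIm _)).
rewrite Re_add Im_add Re_opp Im_opp Re_sum Im_sum.
rewrite (_ : 16 / _ * B / _ = 4 * (2 * B / (2 * pi / T) ^+ 3) / M ^+ 2 +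
  4 * (2 * B / (2 * pi / T) ^+ 3) / M ^+ 2); last by ring.
apply: lerD.
- by apply: (lim (fun n => Re (time_term T a t n))) => // n n0;
    have [] := time_term_bound t T0 n0 sa.
- by apply: (lim (fun n => Im (time_term T a t n))) => // n n0;
    have [] := time_term_bound t T0 n0 sa.
Unshelve. all: by end_near. Qed.

End FourierCoefficients.

(** * Pairing with a time-dependent coefficient *)

Section EssentialBounds.
Context d (X : measurableType d) (R : realType) (mu : {measure set X -> \bar R}).
Implicit Types (F g : X -> R) (k : R -> X -> R) (b e t : R).

Definition ess_bounded F b := {ae mu, forall x, `|F x| <= b}.

Lemma Lnorm_ess_bounded F b :
  ('N[mu]_+oo[EFin \o F] <= b%:E)%E -> ess_bounded F b.
Proof.
rewrite Lnorm.unlock; case: ifPn => [_ /ess_supP H|mu0 _].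
  by apply: filterS H => x /=; rewrite lee_fin.
(* On a space of measure zero the norm carries no information about [F], but there every property
   holds almost everywhere. *)
have m0 : mu setT = 0 by apply/eqP; move: mu0; rewrite lt0e measure_ge0 andbT negbK.
by exists setT; split.
Qed.

Lemma ess_bounded_le F b b' : b <= b' -> ess_bounded F b -> ess_bounded F b'.
Proof. by move=> bb; apply: filterS => x /= /le_trans; apply. Qed.

Lemma ess_boundedD F G b c : ess_bounded F b -> ess_bounded G c ->
  ess_bounded (fun x => F x + G x) (b + c).
Proof.
by move=> Fb Gc; apply: filterS2 Fb Gc => x Fb Gc; rewrite (le_trans (ler_normD _ _))// lerD.
Qed.

Lemma ess_bounded_integrable F g b : 0 <= b ->
  measurable_fun setT F -> ess_bounded F b ->
  mu.-integrable setT (EFin \o g) ->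
  mu.-integrable setT (EFin \o (fun x => F x * g x)) /\
  (\int[mu]_x `|(F x * g x)%:E| <= (b * \int[mu]_x `|g x|)%:E)%E.
Proof.
move=> b0 mF Fb Ig; have mg : measurable_fun setT g.
  by apply/measurable_EFinP; exact: measurable_int Ig.
have mFg : measurable_fun setT (fun x => F x * g x) by exact: measurable_funM.
have Ibg : mu.-integrable setT (EFin \o (fun x => b * `|g x|)).
  by apply: integrable_EFinZl => //; exact: integrable_EFin_norm.
have le : (\int[mu]_x `|(F x * g x)%:E| <= \int[mu]_x (b * `|g x|)%:E)%E.
  apply: ae_ge0_le_integral => //.
  - by apply: measurableT_comp => //; exact/measurable_EFinP.
  - by move=> x _; rewrite lee_fin mulr_ge0.
  - exact: measurable_int Ibg.
  - apply: filterS Fb => x /= Fb _; rewrite lee_fin normrM ler_wpM2r//.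
have e : (\int[mu]_x (b * `|g x|)%:E = (b * \int[mu]_x `|g x|)%:E)%E.
  rewrite -RintegralZl//; last exact: integrable_EFin_norm.
  by rewrite /Rintegral fineK//; exact: integrable_fin_num Ibg.
split; last by rewrite -e.
by apply/integrableP; split; [exact/measurable_EFinP|rewrite (le_lt_trans le)// e ltry].
Qed.

Lemma ess_bounded_Rintegral F g b : 0 <= b ->
  measurable_fun setT F -> ess_bounded F b ->
  mu.-integrable setT (EFin \o g) ->
  `|\int[mu]_x (F x * g x)| <= b * \int[mu]_x `|g x|.
Proof.
move=> b0 mF Fb Ig; have [I le] := ess_bounded_integrable b0 mF Fb Ig.
rewrite -lee_fin EFin_normr_Rintegral//; apply: le_trans le.
by apply: le_abse_integral => //; exact: measurable_int I.
Qed.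

(* The real integral is [fine] of the extended one, hence 0 when the latter is
   infinite (or of the form oo - oo, which is -oo). *)
Lemma Rintegral_nonintegrable F : measurable_fun setT F ->
  ~ mu.-integrable setT (EFin \o F) -> \int[mu]_x F x = 0.
Proof.
move=> mF nI; have mE : measurable_fun setT (EFin \o F) by exact/measurable_EFinP.
rewrite /Rintegral integralE.
have : ~ ((\int[mu]_x ((EFin \o F)^\+ x)%E < +oo)%E /\
    (\int[mu]_x ((EFin \o F)^\- x)%E < +oo)%E).
  move=> [p m]; apply: nI; apply/integrableP; split=> //.
  under eq_integral do rewrite -/((abse \o (EFin \o F)) _).
  rewrite fune_abse ge0_integralD//; first exact: lte_add_pinfty.
  - exact: measurable_funepos.
  - exact: measurable_funeneg.
have : (0 <= \int[mu]_x ((EFin \o F)^\+ x)%E)%E by exact: integral_ge0.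
have : (0 <= \int[mu]_x ((EFin \o F)^\- x)%E)%E by exact: integral_ge0.
case: (\int[mu]_x ((EFin \o F)^\+ x)%E)%E => [r| |];
  case: (\int[mu]_x ((EFin \o F)^\- x)%E)%E => [s| |]//= _ _ H.
by exfalso; apply: H; rewrite !ltry.
Qed.

(** If [F] is not integrable both sides take the default value 0. This matters for the inner time
    integral in [Fubini_segment]: at a fixed [x] the function [t |-> k t x] is only known to be
    measurable. *)
Lemma RintegralZl_measurable F c : measurable_fun setT F ->
  \int[mu]_x (c * F x) = c * \int[mu]_x F x.
Proof.
move=> mF; have [I|nI] := pselect (mu.-integrable setT (EFin \o F)).
  exact: RintegralZl.
have [->|c0] := eqVneq c 0.
  by under eq_Rintegral do rewrite mul0r; rewrite Rintegral_cst// !mul0r.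
rewrite (Rintegral_nonintegrable mF nI) mulr0 Rintegral_nonintegrable//.
  exact: measurable_funM.
move=> I; apply: nI; have := integrable_EFinZl measurableT c^-1 I.
by congr (mu.-integrable _ _); apply/funext => x /=; rewrite mulrA mulVf// mul1r.
Qed.

Lemma ae_integrable (f g : X -> \bar R) : measurable_fun setT g -> ae_eq mu setT f g ->
  mu.-integrable setT f -> mu.-integrable setT g.
Proof.
move=> mg fg /integrableP[mf foo]; apply/integrableP; split=> //.
rewrite (ae_eq_integral (fun x => `|f x|)%E)//; [exact: measurableT_comp|exact: measurableT_comp|].
by apply: filterS fg => x /= fg _; rewrite fg.
Qed.

End EssentialBounds.

Section Fubini.
Context d1 d2 (X : measurableType d1) (Y : measurableType d2) (R : realType).
Context (m1 : {sigma_finite_measure set X -> \bar R}).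
Context (m2 : {sigma_finite_measure set Y -> \bar R}).

(** The slices in [y] are integrable only for almost every [x], so there the real inner integral
    agrees almost everywhere with the extended one. The slices in [x] are assumed integrable for
    every [y], which makes the other side exact. *)
Lemma Rintegral_Fubini (f : X * Y -> R) :
  (m1 \x m2)%E.-integrable setT (EFin \o f) ->
  (forall y, m1.-integrable setT (EFin \o (fun x => f (x, y)))) ->
  m1.-integrable setT (EFin \o (fun x => \int[m2]_y f (x, y))) /\
  \int[m1]_x \int[m2]_y f (x, y) = \int[m2]_y \int[m1]_x f (x, y).
Proof.
move=> If I1.
have IF := integrable_fubini_F If.
have mF : measurable_fun setT (fun x => (\int[m2]_y f (x, y))%:E).
  apply/measurable_EFinP; apply: measurableT_comp => //.
  exact: measurable_int IF.
have E : ae_eq m1 setT (fun x => (\int[m2]_y (f (x, y))%:E)%E)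
    (fun x => (\int[m2]_y f (x, y))%:E).
  apply: filterS (ae_integrable1 If) => x Ix _.
  by rewrite /Rintegral fineK//; exact: integrable_fin_num Ix.
split; first by exact: ae_integrable E IF.
transitivity (fine (\int[m1]_x \int[m2]_y (f (x, y))%:E)%E).
  congr fine; symmetry; apply: ae_eq_integral => //; exact: measurable_int IF.
rewrite /Rintegral; congr fine.
rewrite [LHS](Fubini If); apply: eq_integral => y _.
by rewrite fineK//; exact: integrable_fin_num (I1 y).
Qed.
End Fubini.

Section TimeDependentPairing.
Context {R : realType} {n : nat} (D : set 'rV[R]_n.+1).
Local Notation mu := (volume D).
Implicit Types (F g : volume_space D -> R) (k : R -> volume_space D -> R) (b e t T : R).

Definition pairing k g t : R := \int[mu]_x (k t x * g x).

Lemma Linf_ess_bounded F : Linf F -> exists2 b, 0 <= b & ess_bounded mu F b.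
Proof.
move=> [_]; move E : (Lnorm _ _ _) => N Ny.
exists (`|fine N|) => //; apply: (@ess_bounded_le _ _ _ _ _ (fine N)); first exact: ler_norm.
apply: Lnorm_ess_bounded; rewrite E; case: N Ny {E} => [r| |]//= _; exact: leNye.
Qed.

Lemma near_ess_bounded (S : set_system R) (G : R -> volume_space D -> R) e :
  Filter S -> 0 < e ->
  'N[mu]_+oo[EFin \o G s]%E @[s --> S] --> 0%E ->
  \forall s \near S, ess_bounded mu (G s) e.
Proof.
move=> FS e0 H; have e0' : (0%R%:E < e%:E)%E by rewrite lte_fin.
have N0 : \forall s \near S, ('N[mu]_+oo[EFin \o G s] < e%:E)%E by exact: (H _ (open_ereal_lt' e0')).
by apply: filterS N0 => s /ltW; exact: Lnorm_ess_bounded.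
Qed.

(** Near each [t] an essential bound of [k t] plus 1 works, by continuity in the L^infinity norm;
    compactness of [[0, T]] makes the bound uniform. The exceptional null set still depends on
    [t]. *)
Lemma ess_bounded_segment T k : (forall t, Linf (k t)) -> Linf_continuous k ->
  exists2 b, 0 <= b & forall t, 0 <= t <= T -> ess_bounded mu (k t) b.
Proof.
move=> kL kc.
have /compact_near_coveringP C := @segment_compact R 0 T.
have : \forall b \near +oo, `[0, T]%classic `<=` (fun t => ess_bounded mu (k t) b).
  apply: C => t _.
  have [b b0 tb] := Linf_ess_bounded (kL t).
  near=> s c => /=.
  apply: (@ess_bounded_le _ _ _ _ _ (1 + b)).
    by near: c; apply: nbhs_pinfty_ge; exact: num_real.
  have -> : k s = (fun x => (k s x - k t x) + k t x) by apply/funext => x; rewrite subrK.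
  apply: ess_boundedD => //.
  near: s; exact: (near_ess_bounded _ ltr01 (kc t)).
move=> [M [_ H]]; exists (Num.max 0 (M + 1)); first by rewrite le_max lexx.
move=> t tT; apply: (H (Num.max 0 (M + 1))) => /=; last by rewrite in_itv.
by rewrite lt_max ltrDl ltr01 orbT.
Unshelve. all: by end_near. Qed.

Lemma Linf_integrable F g : Linf F -> mu.-integrable setT (EFin \o g) ->
  mu.-integrable setT (EFin \o (fun x => F x * g x)).
Proof.
move=> FL Ig; have [b b0 Fb] := Linf_ess_bounded FL.
by case: FL => mF _; case: (ess_bounded_integrable b0 mF Fb Ig).
Qed.

Lemma pairing_continuous k g : (forall t, Linf (k t)) -> Linf_continuous k ->
  mu.-integrable setT (EFin \o g) -> continuous (pairing k g).
Proof.
move=> kL kc Ig t; apply/cvgrPdist_le => e e0.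
pose N := \int[mu]_x `|g x|.
have N0 : 0 <= N by exact: Rintegral_ge0.
have eN : 0 < e / (N + 1) by rewrite divr_gt0// ltr_wpDl.
near=> s.
rewrite distrC /pairing -RintegralB//; [|exact: Linf_integrable..].
under eq_Rintegral do rewrite -mulrBl.
have H : ess_bounded mu (fun x => k s x - k t x) (e / (N + 1)).
  near: s; exact: (near_ess_bounded _ eN (kc t)).
have mF : measurable_fun setT (fun x => k s x - k t x).
  by apply: measurable_funB; [case: (kL s)|case: (kL t)].
apply: (le_trans (ess_bounded_Rintegral (ltW eN) mF H Ig)).
by rewrite mulrAC ler_pdivrMr ?ltr_wpDl// ler_wpM2l ?(ltW e0)// lerDl.
Unshelve. all: by end_near. Qed.

(** The difference quotients converge in the L^infinity norm, and pairing with a fixed integrable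
    [g] is continuous for that norm. *)
Lemma pairing_derive k k' g t : (forall t, Linf (k t)) -> (forall t, Linf (k' t)) ->
  Linf_derivative k k' ->
  mu.-integrable setT (EFin \o g) ->
  is_derive t (1 : R) (pairing k g) (pairing k' g t).
Proof.
move=> kL kL' kd Ig.
pose N := \int[mu]_x `|g x|.
have N0 : 0 <= N by exact: Rintegral_ge0.
have H : h^-1 *: ((pairing k g \o shift t) (h *: (1 : R)) - pairing k g t)
    @[h --> 0^'] --> pairing k' g t.
  apply/cvgrPdist_le => e e0.
  (* [N + 1] because [N] itself may vanish. *)
  have eN : 0 < e / (N + 1) by rewrite divr_gt0// ltr_wpDl.
  near=> s.
  have s0 : s != 0 by near: s; exact: nbhs_dnbhs_neq.
  have B : ess_bounded mu (fun x => (k (t + s) x - k t x) / s - k' t x) (e / (N + 1)).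
    near: s; exact: (near_ess_bounded _ eN (kd t)).
  have mB : measurable_fun setT (fun x => (k (t + s) x - k t x) / s - k' t x).
    apply: measurable_funB; last by case: (kL' t).
    apply: measurable_funM; last exact: measurable_cst.
    by apply: measurable_funB; [case: (kL (t + s))|case: (kL t)].
  have -> : s^-1 *: ((pairing k g \o shift t) (s *: (1 : R)) - pairing k g t) =
      \int[mu]_x (s^-1 * (k (t + s) x * g x - k t x * g x)).
    rewrite /GRing.scale/= mulr1 [s + t]addrC RintegralZl ?RintegralB//;
      do ?[exact: Linf_integrable].
    by apply: integrable_EFinB => //; exact: Linf_integrable.
  rewrite distrC /pairing -RintegralB//; last 2 first.
  - apply: integrable_EFinZl => //.
    by apply: integrable_EFinB => //; exact: Linf_integrable.
  - exact: Linf_integrable.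
  have -> : \int[mu]_x (s^-1 * (k (t + s) x * g x - k t x * g x) - k' t x * g x) =
    \int[mu]_x (((k (t + s) x - k t x) / s - k' t x) * g x).
    by apply: eq_Rintegral => x _; ring.
  apply: (le_trans (ess_bounded_Rintegral (ltW eN) mB B Ig)).
  by rewrite mulrAC ler_pdivrMr ?ltr_wpDl// ler_wpM2l ?(ltW e0)// lerDl.
by apply: DeriveDef; [exact: cvgP H|exact: cvg_lim H].
Unshelve. all: by end_near. Qed.

Lemma pairing_bound k g b t : 0 <= b -> Linf (k t) -> ess_bounded mu (k t) b ->
  mu.-integrable setT (EFin \o g) ->
  `|pairing k g t| <= b * \int[mu]_x `|g x|.
Proof. by move=> b0 [mk _] kb Ig; exact: ess_bounded_Rintegral. Qed.

(** The number [b] is chosen before [g]: it depends on [k] alone, and [g] enters only through its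
    L^1 norm. The final constant owes its independence of the discrete space to this order of
    quantifiers. *)
Lemma pairing_smooth_periodic T k : 0 < T -> C_per 3 T k ->
  exists b, [/\ 0 <= b, forall t, 0 <= t <= T -> ess_bounded mu (k t) b &
    forall g, mu.-integrable setT (EFin \o g) ->
      smooth_periodic T (b * \int[mu]_x `|g x|) (pairing k g)].
Proof.
move=> T0 [[kL kc [k1 [kd [k1L k1c [k2 [k1d [k2L k2c [k3 [k2d [k3L k3c _]]]]]]]]]] kT].
have [b b0 kb] := ess_bounded_segment T kL kc.
have [b2 b20 k2b] := ess_bounded_segment T k2L k2c.
have [b3 b30 k3b] := ess_bounded_segment T k3L k3c.
exists (b + b2 + b3); split; first by rewrite !addr_ge0.
  by move=> t /kb; apply: ess_bounded_le; lra.
move=> g Ig; exists (pairing k1 g), (pairing k2 g), (pairing k3 g); split.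
- split.
  + by move=> x; exact: pairing_derive.
  + by move=> x; exact: pairing_derive.
  + by move=> x; exact: pairing_derive.
  + exact: pairing_continuous.
- move=> t; rewrite /pairing /Rintegral; congr fine.
  apply: ae_eq_integral; first exact: measurableT.
  + exact: measurable_int (Linf_integrable (kL (t + T)) Ig).
  + exact: measurable_int (Linf_integrable (kL t) Ig).
  + by apply: filterS (kT t) => x /= -> _.
- move=> t tT; have N0 : 0 <= \int[mu]_x `|g x| by exact: Rintegral_ge0.
  split.
  + apply: le_trans (pairing_bound b0 (kL t) (kb t tT) Ig) _.
    by rewrite ler_wpM2r//; lra.
  + apply: le_trans (pairing_bound b20 (k2L t) (k2b t tT) Ig) _.
    by rewrite ler_wpM2r//; lra.
  + apply: le_trans (pairing_bound b30 (k3L t) (k3b t tT) Ig) _.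
    by rewrite ler_wpM2r//; lra.
Qed.

End TimeDependentPairing.

Section FubiniSegment.
Context d (X : measurableType d) (R : realType).
Context (m1 : {sigma_finite_measure set X -> \bar R}).
Notation leb := (@lebesgue_measure R).

(** Extending [p] by zero outside [[0, T]] allows Fubini on the whole line. All slices in [x] are
    then integrable, although [k t] is controlled only for [t] in [[0, T]], and the double integral
    is at most [T * b] times the L^1 norm of [g]. *)
Lemma Fubini_segment (k : R -> X -> R) (g : X -> R) (p : R -> R) (T b : R) :
  0 < T -> 0 <= b ->
  measurable_fun setT (fun z : X * measurableTypeR R => k z.2 z.1) ->
  (forall t, 0 <= t <= T -> ess_bounded m1 (k t) b) ->
  m1.-integrable setT (EFin \o g) ->
  measurable_fun setT (p : measurableTypeR R -> R) -> (forall t, `|p t| <= 1) ->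
  m1.-integrable setT
    (EFin \o (fun x => (\int[leb]_(t in `[0, T]) (k t x * p t)) * g x)) /\
  \int[m1]_x ((\int[leb]_(t in `[0, T]) (k t x * p t)) * g x) =
  \int[leb]_(t in `[0, T]) ((\int[m1]_x (k t x * g x)) * p t).
Proof.
move=> T0 b0 mk kb Ig mp p1.
have mI : measurable (`[0, T]%classic : set (measurableTypeR R)) by [].
pose P : measurableTypeR R -> R := p \_ `[0, T].
have mP : measurable_fun setT P.
  by apply/(measurable_restrict _ mI measurableT); exact: measurable_funS mp.
pose f (z : X * measurableTypeR R) := g z.1 * (k z.2 z.1 * P z.2).
have mg : measurable_fun setT g by apply/measurable_EFinP; exact: measurable_int Ig.
have mf : measurable_fun setT f.
  apply: measurable_funM; first exact: measurableT_comp.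
  by apply: measurable_funM => //; exact: measurableT_comp.
have mkt t : measurable_fun setT (k t).
  exact: (measurableT_comp mk (pair2_measurable t)).
have mkx x : measurable_fun setT (fun t : measurableTypeR R => k t x).
  exact: (measurableT_comp mk (pair1_measurable x)).
pose N := \int[m1]_x `|g x|.
have N0 : 0 <= N by exact: Rintegral_ge0.
have PE t : ~ (0 <= t <= T) -> P t = 0.
  by move=> tT; rewrite /P patchE/= ifF//; apply/negbTE/negP; rewrite inE/= in_itv.
have PT t : 0 <= t <= T -> P t = p t.
  by move=> tT; rewrite /P patchE/= ifT// inE/= in_itv.
have fE t : (fun x => f (x, t)) = (fun x => P t * (k t x * g x)).
  by apply/funext => x; rewrite /f/=; ring.
have slice t : m1.-integrable setT (EFin \o (fun x => f (x, t))).
  rewrite fE; have [tT|tT] := pselect (0 <= t <= T).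
    apply: integrable_EFinZl => //.
    by have [] := ess_bounded_integrable b0 (mkt t) (kb t tT) Ig.
  rewrite (_ : EFin \o _ = fun=> 0%E); first exact: integrable0.
  by apply/funext => x /=; rewrite (PE _ tT) mul0r.
have If : (m1 \x leb)%E.-integrable setT (EFin \o f).
  apply/integrable21ltyP; first exact/measurable_EFinP.
  have le : (\int[leb]_t \int[m1]_x `|(f (x, t))%:E| <=
      \int[leb]_(t in `[0%R, T]) (b * N)%R%:E)%E.
    rewrite [leRHS]integral_mkcond; apply: ge0_le_integral => //.
    - by move=> t _; exact: integral_ge0.
    - apply: (measurable_fun_fubini_tonelli_G (fun z => `|(f z)%:E|%E)) => //.
      by apply: measurableT_comp => //; exact/measurable_EFinP.
    - apply/measurable_restrict => //.
    - move=> t _; rewrite patchE; case: ifPn.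
        rewrite inE/= in_itv/= => tT.
        have [I le] := ess_bounded_integrable b0 (mkt t) (kb t tT) Ig.
        apply: le_trans le; apply: ge0_le_integral => //.
        + exact: (measurableT_comp (@abse_measurable R setT) (measurable_int m1 (slice t))).
        + exact: (measurableT_comp (@abse_measurable R setT) (measurable_int m1 I)).
        + move=> x _; rewrite lee_fin (_ : f (x, t) = (k t x * g x) * P t); last first.
            by rewrite /f/=; ring.
          by rewrite normrM PT// -[leRHS]mulr1 ler_wpM2l.
      rewrite notin_setE/= in_itv/= => tT.
      rewrite (eq_integral (fun=> 0%E)) ?integral0// => x _.
      by rewrite -[f (x, t)]/((fun x => f (x, t)) x) fE PE// mul0r normr0.
  apply: le_lt_trans le _.
  by rewrite integral_cst//= lebesgue_measure_itv/= lte_fin T0 -EFinB -EFinM ltry.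
have [I E] := Rintegral_Fubini If slice.
have inner x : \int[leb]_t f (x, t) = (\int[leb]_(t in `[0, T]) (k t x * p t)) * g x.
  rewrite /f/= RintegralZl_measurable; last exact: measurable_funM.
  rewrite mulrC; congr (_ * _); rewrite [RHS]Rintegral_mkcond; apply: eq_Rintegral => t _.
  by rewrite /P !patchE; case: ifP; rewrite ?mulr0.
split.
  by rewrite (_ : (fun x => _ * g x) = (fun x => \int[leb]_t f (x, t)))//; apply/funext => x.
transitivity (\int[m1]_x \int[leb]_t f (x, t)); first by apply: eq_Rintegral => x _.
rewrite E [RHS]Rintegral_mkcond; apply: eq_Rintegral => t _.
rewrite patchE; case: ifPn.
  rewrite inE/= in_itv/= => tT; have [It _] := ess_bounded_integrable b0 (mkt t) (kb t tT) Ig.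
  by rewrite fE (RintegralZl _ measurableT It) PT// [LHS]mulrC.
rewrite notin_setE/= in_itv/= => tT; rewrite fE PE//.
by under eq_Rintegral do rewrite mul0r; rewrite Rintegral_cst// mul0r.
Qed.
End FubiniSegment.

Section FiniteVolume.
Context {R : realType} {n : nat}.

Lemma lebesgue_outer_box_le (D : set 'rV[R]_n.+1) (M : R) : 0 <= M ->
  (forall x, D x -> forall j, `|x 0 j| <= M) -> (lebesgue_outer D < +oo)%E.
Proof.
move=> M0 DM.
have v0 : (box_volume (set0 : set 'rV[R]_n.+1) <= 0)%E.
  apply: ereal_inf_lbound; exists (0%R, 0%R) => /=; first by split.
  by rewrite big_ord_recl subrr mul0r.
have vge0 (A : set 'rV[R]_n.+1) : (0 <= box_volume A)%E.
  apply: le_ereal_inf_tmp => _ [p [ab _] <-].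
  by rewrite lee_fin; apply: prodr_ge0 => j _; rewrite subr_ge0.
have v0E : box_volume (set0 : set 'rV[R]_n.+1) = 0%E by apply/eqP; rewrite eq_le v0 vge0.
pose F (i : nat) : set 'rV[R]_n.+1 := if i == 0%N then D else set0.
have le : (lebesgue_outer D <= \sum_(i <oo) box_volume (F i))%E.
  by apply: ereal_inf_lbound; exists F => // x Dx; exists 0%N.
apply: (le_lt_trans le).
rewrite (nneseries_split _ 1%N)// big_mkord big_ord_recl/= big_ord0 adde0.
rewrite ereal_series (@eq_eseriesr _ _ (fun=> 0%E)); last by case=> //= i _; rewrite /F/= v0E.
rewrite eseries0// adde0.
apply: le_lt_trans (ltry (\prod_(j < n.+1)
  ((const_mx M : 'rV[R]_n.+1) 0 j - (const_mx (- M) : 'rV[R]_n.+1) 0 j))).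
apply: ereal_inf_lbound; exists (const_mx (- M), const_mx M) => //=; split.
  by move=> j; rewrite !mxE; lra.
by move=> x Dx j; rewrite !mxE -ler_norml; exact: DM.
Qed.

Lemma norm_coord_le (x : 'rV[R]_n.+1) j : `|x 0 j| <= `|x|.
Proof.
rewrite /Num.norm/= mx_normrE.
exact: (le_bigmax _ (fun ij : 'I_1 * 'I_n.+1 => `|x ij.1 ij.2|) (0, j)).
Qed.

Lemma volume_finite (D : set 'rV[R]_n.+1) : bounded_set D ->
  (volume D setT < +oo)%E.
Proof.
move=> bD; have [M HM] : exists M, forall x, D x -> `|x| <= M.
  by case: bD => M [_ /(_ (M + 1))]; rewrite ltrDl ltr01 => /(_ isT) H; exists (M + 1).
rewrite /volume/= /volume_outer/= /outer_restr setTI.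
apply: (@lebesgue_outer_box_le _ (Num.max 0 M)); first by rewrite le_max lexx.
move=> x Dx j; rewrite le_max; apply/orP; right; apply: le_trans (HM x Dx).
exact: norm_coord_le.
Qed.

Lemma Fubini_volume (D : set 'rV[R]_n.+1) (k : R -> volume_space D -> R)
    (g : volume_space D -> R) (p : R -> R) (T b : R) :
  bounded_set D -> 0 < T -> 0 <= b ->
  measurable_fun setT (fun z : volume_space D * measurableTypeR R => k z.2 z.1) ->
  (forall t, 0 <= t <= T -> ess_bounded (volume D) (k t) b) ->
  (volume D).-integrable setT (EFin \o g) ->
  continuous p -> (forall t, `|p t| <= 1) ->
  (volume D).-integrable setT
    (EFin \o (fun x => (\int[lebesgue_measure]_(t in `[0, T]) (k t x * p t)) * g x)) /\
  \int[volume D]_x ((\int[lebesgue_measure]_(t in `[0, T]) (k t x * p t)) * g x) =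
  \int[lebesgue_measure]_(t in `[0, T]) (pairing k g t * p t).
Proof.
move=> bD T0 b0 mk kb Ig cp p1.
have fin : fin_num_fun (volume D).
  move=> A mA; rewrite ge0_fin_numE ?measure_ge0//.
  by apply: le_lt_trans (volume_finite bD); apply: le_measure; rewrite ?inE.
(* [volume D] is finite because [D] is bounded, so the finite-measure structure that Fubini asks for
   is built from that hypothesis. *)
pose H := Measure_isFinite.Build _ _ _ (volume D) fin.
pose m1 := HB.pack_for {finite_measure set (volume_space D) -> \bar R}
  (Measure.sort (volume D)) H.
apply: (@Fubini_segment _ _ _ m1 k g p T b) => //.
exact: continuous_measurable_fun.
Qed.
End FiniteVolume.

(** * Complex inner products *)

Section ComplexIntegrals.
Context d (X : measurableType d) (R : realType) (mu : {measure set X -> \bar R}).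
Implicit Types (f g q : X -> R[i]) (c : R[i]).

Definition cintegrable q :=
  mu.-integrable setT (EFin \o (fun x => Re (q x))) /\
  mu.-integrable setT (EFin \o (fun x => Im (q x))).

Lemma cintegralD f g : cintegrable f -> cintegrable g ->
  cintegral mu setT (fun x => f x + g x) = cintegral mu setT f + cintegral mu setT g.
Proof.
move=> [f1 f2] [g1 g2]; apply: complex_ext; rewrite ?Re_add ?Im_add/= -RintegralD//;
  by apply: eq_Rintegral => x _; rewrite ?Re_add ?Im_add.
Qed.

Lemma cintegrableZ c f : cintegrable f -> cintegrable (fun x => c * f x).
Proof.
move=> [f1 f2]; split.
- under [X in EFin \o X]funext => x do rewrite Re_mul.
  by apply: integrable_EFinB => //; exact: integrable_EFinZl.
- under [X in EFin \o X]funext => x do rewrite Im_mul.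
  by apply: integrable_EFinD => //; exact: integrable_EFinZl.
Qed.

Lemma cintegralZ c f : cintegrable f ->
  cintegral mu setT (fun x => c * f x) = c * cintegral mu setT f.
Proof.
move=> [f1 f2]; apply: complex_ext; rewrite ?Re_mul ?Im_mul/=.
- rewrite -!RintegralZl// -RintegralB//; [|exact: integrable_EFinZl..].
  by apply: eq_Rintegral => x _; rewrite Re_mul.
- rewrite -!RintegralZl// -RintegralD//; [|exact: integrable_EFinZl..].
  by apply: eq_Rintegral => x _; rewrite Im_mul.
Qed.

Lemma eq_cintegral f g : f =1 g -> cintegral mu setT f = cintegral mu setT g.
Proof. by move=> /funext ->. Qed.

Lemma cintegral_sum I (s : seq I) (F : I -> X -> R[i]) :
  (forall i, cintegrable (F i)) ->
  cintegrable (fun x => \sum_(i <- s) F i x) /\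
  cintegral mu setT (fun x => \sum_(i <- s) F i x) =
    \sum_(i <- s) cintegral mu setT (F i).
Proof.
move=> IF; have [r1 r2] := Rintegral_sum s (@measurableT _ X) (fun i => (IF i).1).
have [i1 i2] := Rintegral_sum s (@measurableT _ X) (fun i => (IF i).2).
split; first split.
- by under [X in EFin \o X]funext => x do rewrite Re_sum.
- by under [X in EFin \o X]funext => x do rewrite Im_sum.
apply: complex_ext; rewrite ?Re_sum ?Im_sum/=.
- by under eq_Rintegral do rewrite Re_sum; exact: r2.
- by under eq_Rintegral do rewrite Im_sum; exact: i2.
Qed.

Lemma ae_eq_cintegral f g : cintegrable f ->
  measurable_fun setT (fun x => Re (g x)) -> measurable_fun setT (fun x => Im (g x)) ->
  {ae mu, forall x, f x = g x} ->
  cintegral mu setT f = cintegral mu setT g.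
Proof.
move=> [f1 f2] m1 m2 fg; rewrite /cintegral /Rintegral; congr (fine _ +i* fine _)%C.
- apply: ae_eq_integral => //; [exact: measurable_int f1|exact/measurable_EFinP|].
  by apply: filterS fg => x /= -> _.
- apply: ae_eq_integral => //; [exact: measurable_int f2|exact/measurable_EFinP|].
  by apply: filterS fg => x /= -> _.
Qed.

Definition sqnorm f x : R := Re (f x) ^+ 2 + Im (f x) ^+ 2.

Lemma L2_sqnorm_integrable f : L2 mu f -> mu.-integrable setT (EFin \o sqnorm f).
Proof.
move=> [m1 m2 foo]; apply/integrableP; split.
  by apply/measurable_EFinP; apply: measurable_funD; exact: measurable_funX.
under eq_integral do rewrite /= ger0_norm ?addr_ge0 ?sqr_ge0//.
exact: foo.
Qed.

Lemma weighted_AMGM (a b s : R) : 0 < s -> `|a * b| <= (s * a ^+ 2 + s^-1 * b ^+ 2) / 2.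
Proof.
move=> s0; have r0 : 0 < s^-1 by rewrite invr_gt0.
have sr : s * s^-1 = 1 by rewrite mulfV// gt_eqF.
move: (s^-1) r0 sr => r r0 sr.
have h1 : 0 <= r * (s * a + b) ^+ 2 by rewrite mulr_ge0 ?sqr_ge0// ltW.
have h2 : 0 <= r * (s * a - b) ^+ 2 by rewrite mulr_ge0 ?sqr_ge0// ltW.
have e1 : r * (s * a + b) ^+ 2 = s * a ^+ 2 + 2 * (a * b) + r * b ^+ 2.
  transitivity ((s * r) * s * a ^+ 2 + 2 * (s * r) * (a * b) + r * b ^+ 2); first by ring.
  by rewrite sr; ring.
have e2 : r * (s * a - b) ^+ 2 = s * a ^+ 2 - 2 * (a * b) + r * b ^+ 2.
  transitivity ((s * r) * s * a ^+ 2 - 2 * (s * r) * (a * b) + r * b ^+ 2); first by ring.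
  by rewrite sr; ring.
rewrite ler_norml; apply/andP; split; lra.
Qed.

Lemma conj_mul_bound f g x s : 0 < s ->
  `|Re ((f x)^*%C * g x)| <= (s * sqnorm f x + s^-1 * sqnorm g x) / 2 /\
  `|Im ((f x)^*%C * g x)| <= (s * sqnorm f x + s^-1 * sqnorm g x) / 2.
Proof.
move=> s0; rewrite Re_mul Im_mul Re_conj Im_conj /sqnorm.
move: (Re (f x)) (Im (f x)) (Re (g x)) (Im (g x)) => a b u v.
have := weighted_AMGM a u s0; have := weighted_AMGM b v s0.
have := weighted_AMGM a v s0; have := weighted_AMGM b u s0.
move: (s^-1) => r; rewrite !ler_norml => /andP[? ?] /andP[? ?] /andP[? ?] /andP[? ?].
by split; apply/andP; split; lra.
Qed.

Lemma L2_cintegrable f g : L2 mu f -> L2 mu g ->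
  cintegrable (fun x => (f x)^*%C * g x).
Proof.
move=> Lf Lg; have If := L2_sqnorm_integrable Lf; have Ig := L2_sqnorm_integrable Lg.
have H : mu.-integrable setT (EFin \o (fun x => sqnorm f x + sqnorm g x)).
  exact: integrable_EFinD.
have le x : `|Re ((f x)^*%C * g x)| <= `|sqnorm f x + sqnorm g x| /\
    `|Im ((f x)^*%C * g x)| <= `|sqnorm f x + sqnorm g x|.
  have [h1 h2] := conj_mul_bound f g x ltr01; rewrite invr1 !mul1r in h1 h2.
  have f0 : 0 <= sqnorm f x by rewrite addr_ge0 ?sqr_ge0.
  have g0 : 0 <= sqnorm g x by rewrite addr_ge0 ?sqr_ge0.
  by rewrite (ger0_norm (addr_ge0 f0 g0)); split; lra.
case: Lf => m1 m2 _; case: Lg => n1 n2 _.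
split; (apply: le_integrable H => //; last by move=> x _; rewrite /= lee_fin; case: (le x));
  apply/measurable_EFinP.
- under eq_fun do rewrite Re_mul Re_conj Im_conj mulNr opprK.
  by apply: measurable_funD; exact: measurable_funM.
- under eq_fun do rewrite Im_mul Re_conj Im_conj mulNr.
  by apply: measurable_funB; exact: measurable_funM.
Qed.

Lemma Re_ip_self f : Re (ip mu f f) = \int[mu]_x sqnorm f x.
Proof.
rewrite /ip/=; apply: eq_Rintegral => x _.
by rewrite Re_mul Re_conj Im_conj /sqnorm; ring.
Qed.

Lemma Im_ip_self f : Im (ip mu f f) = 0.
Proof.
rewrite /ip/=; transitivity (\int[mu]_x (0 : R)); last by rewrite Rintegral_cst// mul0r.
by apply: eq_Rintegral => x _; rewrite Im_mul Re_conj Im_conj; ring.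
Qed.

Lemma ip_self f : ip mu f f = ((norm2 mu f) ^+ 2)%:C%C.
Proof.
apply: complex_ext => /=; last exact: Im_ip_self.
rewrite sqr_sqrtr// Re_ip_self; apply: Rintegral_ge0 => x _.
by rewrite addr_ge0 ?sqr_ge0.
Qed.

Section Vector.
Context {m : nat}.
Implicit Types F G : X -> 'rV[R[i]]_m.

Definition dot F G x : R[i] := \sum_(j < m) (F x 0 j)^*%C * G x 0 j.

Definition L2_vec F := forall j, L2 mu (fun x => F x 0 j).

Lemma dot_cintegrable F G : L2_vec F -> L2_vec G -> cintegrable (dot F G).
Proof.
move=> LF LG.
exact: (cintegral_sum (index_enum 'I_m) (fun j => L2_cintegrable (LF j) (LG j))).1.
Qed.

Lemma ip_vec_dot F G : L2_vec F -> L2_vec G -> ip_vec mu F G = cintegral mu setT (dot F G).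
Proof.
move=> LF LG.
by rewrite (cintegral_sum (index_enum 'I_m) (fun j => L2_cintegrable (LF j) (LG j))).2.
Qed.

Lemma Re_ip_vec_self_ge0 F : 0 <= Re (ip_vec mu F F).
Proof.
rewrite /ip_vec Re_sum; apply: sumr_ge0 => j _; rewrite Re_ip_self.
by apply: Rintegral_ge0 => x _; rewrite addr_ge0 ?sqr_ge0.
Qed.

Lemma norm2_vec_sqr F :
  norm2_vec mu F ^+ 2 = \sum_(j < m) \int[mu]_x sqnorm (fun x => F x 0 j) x.
Proof.
rewrite sqr_sqrtr ?Re_ip_vec_self_ge0// /ip_vec Re_sum.
by apply: eq_bigr => j _; rewrite Re_ip_self.
Qed.

(** The optimal weight [s = U / V] may be zero or undefined. Shifting both entries by a small [t]
    costs at most [t * (U + V)], which the choice of [t] keeps below [e]. *)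
Lemma le_mul_of_weighted (x U V : R) : 0 <= U -> 0 <= V ->
  (forall s, 0 < s -> x <= (s * V ^+ 2 + s^-1 * U ^+ 2) / 2) -> x <= V * U.
Proof.
move=> U0 V0 H; apply/ler_addgt0Pr => e e0.
pose t := e / (U + V + 1).
have W : 0 < U + V + 1 by lra.
have t0 : 0 < t by rewrite divr_gt0.
have Ut : 0 < U + t by lra.
have Vt : 0 < V + t by lra.
have := H ((U + t) / (V + t)) (divr_gt0 Ut Vt).
rewrite invf_div => /le_trans; apply.
have h1 : (U + t) / (V + t) * V ^+ 2 <= (U + t) * V.
  rewrite mulrAC ler_pdivrMr// -mulrA ler_wpM2l ?(ltW Ut)//; nra.
have h2 : (V + t) / (U + t) * U ^+ 2 <= (V + t) * U.
  rewrite mulrAC ler_pdivrMr// -mulrA ler_wpM2l ?(ltW Vt)//; nra.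
have h3 : t * (U + V) <= e.
  have -> : e = t * (U + V + 1) by rewrite /t divfK// gt_eqF.
  by apply: ler_wpM2l; lra.
lra.
Qed.

(** Cauchy-Schwarz: the weighted arithmetic-geometric inequality is applied pointwise, integrated,
    and then optimised over the weight. It is stated for the L^1 norms of the real and imaginary
    parts because those control the pairing. *)
Lemma dot_L1_bound F G : L2_vec F -> L2_vec G ->
  \int[mu]_x `|Re (dot F G x)| <= norm2_vec mu F * norm2_vec mu G /\
  \int[mu]_x `|Im (dot F G x)| <= norm2_vec mu F * norm2_vec mu G.
Proof.
move=> LF LG; have [I1 I2] := dot_cintegrable LF LG.
have SF := Rintegral_sum (index_enum 'I_m) (@measurableT _ X)
  (fun j => L2_sqnorm_integrable (LF j)).
have SG := Rintegral_sum (index_enum 'I_m) (@measurableT _ X)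
  (fun j => L2_sqnorm_integrable (LG j)).
have b s x : 0 < s ->
   `|Re (dot F G x)| <= 2^-1 * (s * (\sum_(j < m) sqnorm (fun x => F x 0 j) x)
      + s^-1 * (\sum_(j < m) sqnorm (fun x => G x 0 j) x)) /\
   `|Im (dot F G x)| <= 2^-1 * (s * (\sum_(j < m) sqnorm (fun x => F x 0 j) x)
      + s^-1 * (\sum_(j < m) sqnorm (fun x => G x 0 j) x)).
  move=> s0; rewrite /dot Re_sum Im_sum !mulr_sumr -big_split/= mulr_sumr; split.
  - apply: (le_trans (ler_norm_sum _ _ _)); apply: ler_sum => j _.
    rewrite [leRHS]mulrC.
    by have [] := conj_mul_bound (fun x => F x 0 j) (fun x => G x 0 j) x s0.
  - apply: (le_trans (ler_norm_sum _ _ _)); apply: ler_sum => j _.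
    rewrite [leRHS]mulrC.
    by have [] := conj_mul_bound (fun x => F x 0 j) (fun x => G x 0 j) x s0.
have key (h : X -> R) : mu.-integrable setT (EFin \o h) ->
   (forall s x, 0 < s -> `|h x| <= 2^-1 * (s * (\sum_(j < m) sqnorm (fun x => F x 0 j) x)
      + s^-1 * (\sum_(j < m) sqnorm (fun x => G x 0 j) x))) ->
   \int[mu]_x `|h x| <= norm2_vec mu F * norm2_vec mu G.
  move=> Ih hb; apply: le_mul_of_weighted; [exact: sqrtr_ge0|exact: sqrtr_ge0|].
  move=> s s0; rewrite !norm2_vec_sqr -SF.2 -SG.2 mulrC.
  have J1 := integrable_EFinZl measurableT s SF.1.
  have J2 := integrable_EFinZl measurableT s^-1 SG.1.
  have J := integrable_EFinD measurableT J1 J2.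
  rewrite -(RintegralZl s measurableT SF.1) -(RintegralZl s^-1 measurableT SG.1).
  rewrite -(RintegralD measurableT J1 J2) -(RintegralZl 2^-1 measurableT J).
  apply: le_Rintegral => //; [exact: integrable_EFin_norm|exact: integrable_EFinZl|].
  by move=> x _; exact: hb.
by split; apply: key => // s x /(b s x)[].
Qed.

Lemma norm2_vec_eq0_ip_vec F G : L2_vec F -> L2_vec G ->
  norm2_vec mu F = 0 \/ norm2_vec mu G = 0 -> ip_vec mu F G = 0.
Proof.
move=> LF LG N0; rewrite ip_vec_dot//.
have [b1 b2] := dot_L1_bound LF LG; have [I1 I2] := dot_cintegrable LF LG.
have z : norm2_vec mu F * norm2_vec mu G = 0 by case: N0 => ->; rewrite ?mul0r ?mulr0.
rewrite z in b1 b2.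
apply: complex_ext => /=; apply/eqP; rewrite -normr_le0.
- exact: le_trans (le_normr_Rintegral measurableT I1) b1.
- exact: le_trans (le_normr_Rintegral measurableT I2) b2.
Qed.

End Vector.

Lemma norm2_eq0_ip f g : L2 mu f -> L2 mu g ->
  norm2 mu f = 0 \/ norm2 mu g = 0 -> ip mu f g = 0.
Proof.
move=> Lf Lg fg0.
pose F x : 'rV[R[i]]_1 := const_mx (f x); pose G x : 'rV[R[i]]_1 := const_mx (g x).
have e (a : X -> R[i]) : (fun x => (const_mx (a x) : 'rV[R[i]]_1) 0 0) = a.
  by apply/funext => x; rewrite mxE.
have LF : L2_vec F by move=> j; rewrite ord1 /F e.
have LG : L2_vec G by move=> j; rewrite ord1 /G e.
have : ip_vec mu F G = 0.
  by apply: norm2_vec_eq0_ip_vec => //; rewrite /norm2_vec /ip_vec !big_ord1 /F /G !e.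
by rewrite /ip_vec big_ord1 /F /G !e.
Qed.

Lemma ip_lin I (s : seq I) (c : I -> R[i]) f (F : I -> X -> R[i]) :
  L2 mu f -> (forall i, L2 mu (F i)) ->
  ip mu f (fun x => \sum_(i <- s) c i * F i x) = \sum_(i <- s) c i * ip mu f (F i).
Proof.
move=> Lf LF; rewrite /ip.
have H i : cintegrable (fun x => c i * ((f x)^*%C * F i x)).
  by apply: cintegrableZ; exact: L2_cintegrable.
transitivity (cintegral mu setT (fun x => \sum_(i <- s) (c i * ((f x)^*%C * F i x)))).
  by apply: eq_cintegral => x; rewrite mulr_sumr; apply: eq_bigr => i _; ring.
rewrite (cintegral_sum s H).2; apply: eq_bigr => i _.
by rewrite cintegralZ//; exact: L2_cintegrable.
Qed.

End ComplexIntegrals.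

Section FourierOfPairing.
Context {R : realType} {n : nat} (D : set 'rV[R]_n.+1).
Local Notation mu := (volume D).
Local Notation leb := (@lebesgue_measure R).
Implicit Types (k : R -> volume_space D -> R) (q : volume_space D -> R[i]) (T b t : R).

Definition cpairing k q t : R[i] :=
  cintegral mu setT (fun x => (k t x)%:C%C * q x).

Lemma Re_cpairing k q t : Re (cpairing k q t) = pairing k (fun x => Re (q x)) t.
Proof. by apply: eq_Rintegral => x _; rewrite Re_mul/= mul0r subr0. Qed.

Lemma Im_cpairing k q t : Im (cpairing k q t) = pairing k (fun x => Im (q x)) t.
Proof. by apply: eq_Rintegral => x _; rewrite Im_mul/= mul0r addr0. Qed.

Lemma smooth_periodic_le T B B' (f : R -> R) : B <= B' ->
  smooth_periodic T B f -> smooth_periodic T B' f.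
Proof.
move=> BB [f1 [f2 [f3 [dc fT fB]]]]; exists f1, f2, f3; split=> // x /fB[b0 b2 b3].
by split; exact: le_trans BB.
Qed.

Lemma cpairing_smooth T k : 0 < T -> C_per 3 T k ->
  exists b, [/\ 0 <= b, forall t, 0 <= t <= T -> ess_bounded mu (k t) b &
    forall q Q, cintegrable mu q -> \int[mu]_x `|Re (q x)| <= Q ->
      \int[mu]_x `|Im (q x)| <= Q -> csmooth_periodic T (b * Q) (cpairing k q)].
Proof.
move=> T0 kC; have [b [b0 kb H]] := pairing_smooth_periodic T0 kC.
exists b; split=> // q Q [q1 q2] Q1 Q2; split.
- under [X in smooth_periodic _ _ X]funext => t do rewrite Re_cpairing.
  by apply: smooth_periodic_le (H _ q1); rewrite ler_wpM2l.
- under [X in smooth_periodic _ _ X]funext => t do rewrite Im_cpairing.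
  by apply: smooth_periodic_le (H _ q2); rewrite ler_wpM2l.
Qed.

(** Four real applications of Fubini: cosine and sine against the real and the imaginary part of
    [q]. Integrability of the product also comes out of Fubini, without an essential bound on the
    Fourier coefficient itself. *)
Lemma fourier_coef_pairing T k b B q (l : int) :
  bounded_set D -> 0 < T -> 0 <= b ->
  measurable_fun setT (fun z : volume_space D * measurableTypeR R => k z.2 z.1) ->
  (forall t, 0 <= t <= T -> ess_bounded mu (k t) b) ->
  cintegrable mu q -> csmooth_periodic T B (cpairing k q) ->
  cintegrable mu (fun x => fourier_coef T k l x * q x) /\
  cintegral mu setT (fun x => fourier_coef T k l x * q x) =
    time_coef T (cpairing k q) l.
Proof.
move=> bD T0 b0 mk kb [I1 I2] [s1 s2].
have mI : measurable (`[0, T]%classic : set (measurableTypeR R)) by [].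
pose pc (t : R) := cos (l%:~R * (2 * pi / T * t)).
pose ps (t : R) := sin (l%:~R * (2 * pi / T * t)).
have cpc : continuous pc.
  have := @continuous_cos_harmonic R T 0 l.
  by under eq_fun do rewrite subr0.
have cps : continuous ps.
  apply: (@derive_continuous _ _
    (fun t => l%:~R * (2 * pi / T) * cos (l%:~R * (2 * pi / T * t)))) => x.
  by apply: is_derive_eq; rewrite /GRing.scale/=; ring.
pose C x := \int[leb]_(t in `[0, T]) (k t x * pc t).
pose S x := \int[leb]_(t in `[0, T]) (k t x * ps t).
have FE x : fourier_coef T k l x = (T^-1)%:C%C * (C x +i* S x)%C.
  rewrite /fourier_coef; congr (_ * (_ +i* _)%C); apply: eq_Rintegral => t _.
  - by rewrite cexp_harmonic Re_mul/= mul0r subr0.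
  - by rewrite cexp_harmonic Im_mul/= mul0r addr0.
have F p g := @Fubini_volume R n D k g p T b bD T0 b0 mk kb.
have [Jc1 Ec1] := F pc _ I1 cpc (fun t => cos_max _).
have [Jc2 Ec2] := F pc _ I2 cpc (fun t => cos_max _).
have [Js1 Es1] := F ps _ I1 cps (fun t => sin_max _).
have [Js2 Es2] := F ps _ I2 cps (fun t => sin_max _).
have H : cintegrable mu (fun x => (C x +i* S x)%C * q x).
  split.
  - under [X in EFin \o X]funext => x do rewrite Re_mul/=.
    exact: integrable_EFinB.
  - under [X in EFin \o X]funext => x do rewrite Im_mul/=.
    exact: integrable_EFinD.
have E : (fun x => fourier_coef T k l x * q x) =
   (fun x => (T^-1)%:C%C * ((C x +i* S x)%C * q x)).
  by apply/funext => x; rewrite FE mulrA.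
rewrite E; split; first exact: cintegrableZ.
rewrite cintegralZ// /time_coef; congr (_ * _).
have c1 : continuous (pairing k (fun x => Re (q x))).
  have := smooth_periodic_continuous s1.
  by under [X in continuous X -> _]funext => t do rewrite Re_cpairing.
have c2 : continuous (pairing k (fun x => Im (q x))).
  have := smooth_periodic_continuous s2.
  by under [X in continuous X -> _]funext => t do rewrite Im_cpairing.
have J (g p : R -> R) : continuous g -> continuous p ->
    leb.-integrable `[0, T] (EFin \o (fun t => g t * p t)).
  move=> cg cp; apply: continuous_integrable_itv => x.
  by apply: continuousM; [exact: cg|exact: cp].
apply: complex_ext.
- transitivity (\int[mu]_x (C x * Re (q x) - S x * Im (q x))).
    by apply: eq_Rintegral => x _; rewrite Re_mul.
  rewrite RintegralB// Ec1 Es2 -(RintegralB mI (J _ _ c1 cpc) (J _ _ c2 cps)).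
  by apply: eq_Rintegral => t _; rewrite cexp_harmonic Re_mul Re_cpairing Im_cpairing.
- transitivity (\int[mu]_x (C x * Im (q x) + S x * Re (q x))).
    by apply: eq_Rintegral => x _; rewrite Im_mul.
  rewrite RintegralD// Ec2 Es1 addrC -(RintegralD mI (J _ _ c1 cps) (J _ _ c2 cpc)).
  by apply: eq_Rintegral => t _; rewrite cexp_harmonic Im_mul Re_cpairing Im_cpairing.
Qed.
End FourierOfPairing.

(** * Discrete spaces and the Riesz representative *)

Section TimeDerivative.
Context {R : realType} {n : nat}.
Local Notation sp := (sobolev_pair R n).

Lemma cderive_exp_sum I (r : seq I) (lam w : I -> R[i]) (t : R) :
  cderive (fun s => \sum_(i <- r) cexp (lam i * s%:C%C) * w i) t =
  \sum_(i <- r) cexp (lam i * t%:C%C) * (lam i * w i).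
Proof.
have H : is_derive t (1 : R) (fun s => Re (\sum_(i <- r) cexp (lam i * s%:C%C) * w i))
      (Re (\sum_(i <- r) cexp (lam i * t%:C%C) * (lam i * w i))) /\
   is_derive t (1 : R) (fun s => Im (\sum_(i <- r) cexp (lam i * s%:C%C) * w i))
      (Im (\sum_(i <- r) cexp (lam i * t%:C%C) * (lam i * w i))).
  elim: r => [|i r [IH1 IH2]].
    rewrite !big_nil/=.
    under [X in is_derive _ _ X]eq_fun do rewrite big_nil/=.
    under [X in _ /\ is_derive _ _ X _]eq_fun do rewrite big_nil/=.
    by split; exact: is_derive_cst.
  have T1 : is_derive t (1 : R) (fun s => Re (cexp (lam i * s%:C%C) * w i))
      (Re (cexp (lam i * t%:C%C) * (lam i * w i))).
    case: (lam i) (w i) => a b [u v].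
    rewrite (_ : (fun s => _) = (fun s => expR (a * s) * (cos (b * s) * u - sin (b * s) * v))).
      apply: is_derive_eq.
      by rewrite /cexp/= /GRing.scale/= !(mulr0, mul0r, subr0, addr0, add0r, mulr1); ring.
    apply/funext => s; rewrite /cexp/= !(mulr0, mul0r, subr0, addr0, add0r); ring.
  have T2 : is_derive t (1 : R) (fun s => Im (cexp (lam i * s%:C%C) * w i))
      (Im (cexp (lam i * t%:C%C) * (lam i * w i))).
    case: (lam i) (w i) => a b [u v].
    rewrite (_ : (fun s => _) = (fun s => expR (a * s) * (cos (b * s) * v + sin (b * s) * u))).
      apply: is_derive_eq.
      by rewrite /cexp/= /GRing.scale/= !(mulr0, mul0r, subr0, addr0, add0r, mulr1); ring.
    apply/funext => s; rewrite /cexp/= !(mulr0, mul0r, subr0, addr0, add0r); ring.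
  rewrite !big_cons Re_add Im_add; split.
  - rewrite (_ : (fun s => _) = (fun s => Re (cexp (lam i * s%:C%C) * w i) +
      Re (\sum_(j <- r) cexp (lam j * s%:C%C) * w j))); first exact: is_deriveD.
    by apply/funext => s; rewrite big_cons Re_add.
  - rewrite (_ : (fun s => _) = (fun s => Im (cexp (lam i * s%:C%C) * w i) +
      Im (\sum_(j <- r) cexp (lam j * s%:C%C) * w j))); first exact: is_deriveD.
    by apply/funext => s; rewrite big_cons Im_add.
case: H => H1 H2; rewrite /cderive !derive1E.
apply: complex_ext => /=; exact: derive_val.
Qed.

Lemma fval_lin I (r : seq I) (c : I -> R[i]) (w : I -> sp) x :
  (\sum_(i <- r) c i *: w i).1 x = \sum_(i <- r) c i * (w i).1 x.
Proof.
exact: (big_morph (fun p : sp => p.1 x) (id1 := 0) (op1 := +%R)).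
Qed.

Lemma grad_lin I (r : seq I) (c : I -> R[i]) (w : I -> sp) x j :
  (\sum_(i <- r) c i *: w i).2 x 0 j = \sum_(i <- r) c i * (w i).2 x 0 j.
Proof.
rewrite (big_morph (fun p : sp => p.2 x 0 j) (id1 := 0) (op1 := +%R))/=.
- by apply: eq_bigr => i _; rewrite mxE.
- by move=> p q; rewrite mxE.
- by rewrite mxE.
Qed.

(** These sums are closed under [time_deriv], which multiplies each weight by its exponent; the
    second derivative of a mode is obtained by using this twice. *)
Definition exp_family I (r : seq I) (lam : I -> R[i]) (w : I -> sp) (t : R) : sp :=
  \sum_(i <- r) cexp (lam i * t%:C%C) *: w i.

Lemma time_deriv_exp_family I (r : seq I) (lam : I -> R[i]) (w : I -> sp) (t : R) :
  time_deriv (exp_family r lam w) t = exp_family r lam (fun i => lam i *: w i) t.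
Proof.
rewrite /time_deriv [RHS]surjective_pairing; congr pair.
  apply/funext => x; rewrite /exp_family fval_lin.
  under eq_fun do rewrite fval_lin.
  exact: cderive_exp_sum.
apply/funext => x; apply/rowP => j; rewrite mxE grad_lin.
under eq_fun do rewrite grad_lin.
rewrite cderive_exp_sum; apply: eq_bigr => i _; by rewrite mxE.
Qed.
End TimeDerivative.

Section Riesz.
Context {R : realType} {n : nat} (D : set 'rV[R]_n.+1).
Local Notation sp := (sobolev_pair R n).
Local Notation mu := (volume D).

Lemma ip_antilin d (X : measurableType d) (nu : {measure set X -> \bar R}) I (s : seq I)
    (c : I -> R[i]) (F : I -> X -> R[i]) g :
  L2 nu g -> (forall i, L2 nu (F i)) ->
  ip nu (fun x => \sum_(i <- s) c i * F i x) g = \sum_(i <- s) (c i)^*%C * ip nu (F i) g.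
Proof.
move=> Lg LF; rewrite /ip.
have H i : cintegrable nu (fun x => (c i)^*%C * ((F i x)^*%C * g x)).
  by apply: cintegrableZ; exact: L2_cintegrable.
transitivity (cintegral nu setT (fun x => \sum_(i <- s) ((c i)^*%C * ((F i x)^*%C * g x)))).
  apply: eq_cintegral => x; rewrite sumr_conj mulr_suml; apply: eq_bigr => i _.
  by rewrite rmorphM mulrA.
rewrite (cintegral_sum s H).2; apply: eq_bigr => i _.
by rewrite cintegralZ//; exact: L2_cintegrable.
Qed.

Definition L2_grad (p : sp) := L2_vec mu (grad (D := D) p).

Lemma grad_form_lin I (s : seq I) (c : I -> R[i]) (b : I -> sp) v :
  L2_grad v -> (forall i, L2_grad (b i)) ->
  grad_form D v (\sum_(i <- s) c i *: b i) = \sum_(i <- s) c i * grad_form D v (b i).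
Proof.
move=> Lv Lb; rewrite /grad_form /ip_vec.
transitivity (\sum_(j < n.+1) \sum_(i <- s) c i * ip mu (fun x => grad (D := D) v x 0 j)
   (fun x => grad (D := D) (b i) x 0 j)).
  apply: eq_bigr => j _; rewrite -(ip_lin s c (Lv j) (fun i => Lb i j)).
  by congr ip; apply/funext => x; exact: grad_lin.
rewrite exchange_big/=; apply: eq_bigr => i _.
by rewrite mulr_sumr.
Qed.

Lemma grad_form_antilin I (s : seq I) (c : I -> R[i]) (b : I -> sp) v :
  L2_grad v -> (forall i, L2_grad (b i)) ->
  grad_form D (\sum_(i <- s) c i *: b i) v = \sum_(i <- s) (c i)^*%C * grad_form D (b i) v.
Proof.
move=> Lv Lb; rewrite /grad_form /ip_vec.
transitivity (\sum_(j < n.+1) \sum_(i <- s) (c i)^*%C *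
    ip mu (fun x => grad (D := D) (b i) x 0 j) (fun x => grad (D := D) v x 0 j)).
  apply: eq_bigr => j _; rewrite -(ip_antilin s c (Lv j) (fun i => Lb i j)).
  by congr ip; apply/funext => x; exact: grad_lin.
rewrite exchange_big/=; apply: eq_bigr => i _.
by rewrite mulr_sumr.
Qed.

(** The right-hand side is the quadratic form of the Gram matrix, so a kernel vector of that matrix
    yields a combination with vanishing gradient, even if the family [b] is linearly dependent. *)
Lemma L2_grad_span N (b : 'I_N -> sp) (c : 'I_N -> R[i]) : (forall i, L2_grad (b i)) ->
  (forall p, (exists c, p = \sum_(i < N) c i *: b i) -> L2_grad p) ->
  norm2_vec mu (grad (D := D) (\sum_(i < N) c i *: b i)) ^+ 2 =
  Re (\sum_(i < N) (c i)^*%C * \sum_(j < N) c j * grad_form D (b i) (b j)).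
Proof.
move=> Lb Lspan; set p := (X in norm2_vec mu (grad X)).
have Lp : L2_grad p by apply: Lspan; exists c.
transitivity (Re (grad_form D p p)); first by rewrite sqr_sqrtr// Re_ip_vec_self_ge0.
congr Re; rewrite {1}/p (grad_form_antilin _ _ Lp Lb).
by apply: eq_bigr => i _; rewrite (grad_form_lin _ _ (Lb i) Lb).
Qed.

(* The Gram matrix G of the family b may be singular, but its kernel consists of
   combinations with vanishing gradient, which L annihilates; hence the system
   c G^T = (L (b i))_i is solvable. *)
Lemma riesz_span N (b : 'I_N -> sp) (L : sp -> R[i]) :
  (forall p, (exists c, p = \sum_(i < N) c i *: b i) -> L2_grad p) ->
  (forall c, L (\sum_(i < N) c i *: b i) = \sum_(i < N) (c i)^*%C * L (b i)) ->
  (forall c, norm2_vec mu (grad (D := D) (\sum_(i < N) c i *: b i)) = 0 ->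
    L (\sum_(i < N) c i *: b i) = 0) ->
  exists c', forall c, L (\sum_(i < N) c i *: b i) =
    grad_form D (\sum_(i < N) c i *: b i) (\sum_(i < N) c' i *: b i).
Proof.
move=> Lspan Lanti Lker.
have Lb i : L2_grad (b i).
  apply: Lspan; exists (fun j => (j == i)%:R).
  by rewrite (bigD1 i)//= eqxx scale1r big1 ?addr0// => j /negbTE ->; rewrite scale0r.
pose G : 'M[R[i]]_N := \matrix_(j, i) grad_form D (b i) (b j).
pose l : 'rV[R[i]]_N := \row_i L (b i).
have lG : (l <= G)%MS.
  (* Solvability means that [l] annihilates every column of the cokernel of [G]. A column is turned
     into coefficients by conjugation, because both [L] and the first slot of [grad_form] are
     conjugate-linear. *)
  rewrite submxE; apply/eqP/rowP => k; rewrite [RHS]mxE mxE.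
  pose y i := ((cokermx G) i k)^*%C.
  have z i : \sum_(j < N) grad_form D (b j) (b i) * (cokermx G) j k = 0.
    have := mulmx_coker G => /matrixP /(_ i k); rewrite [LHS]mxE [RHS]mxE => z.
    by rewrite -[RHS]z; apply: eq_bigr => j _; rewrite [G i j]mxE.
  have : L (\sum_(i < N) y i *: b i) = 0.
    apply: Lker; apply/eqP; rewrite -sqrf_eq0 L2_grad_span//.
    under eq_bigr do rewrite mulr_sumr.
    rewrite exchange_big/= big1// => i _.
    rewrite (eq_bigr (fun j => y i * (grad_form D (b j) (b i) * (cokermx G) j k))).
      by rewrite -mulr_sumr z mulr0.
    by move=> j _; rewrite /y conjcK; ring.
  rewrite Lanti => z0; rewrite -[RHS]z0; apply: eq_bigr => i _.
  by rewrite [l _ _]mxE /y conjcK mulrC.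
have /submxP[c' lE] := lG.
exists (fun j => c' 0 j) => c.
have Lc' : L2_grad (\sum_(j < N) c' 0 j *: b j) by apply: Lspan; exists (fun j => c' 0 j).
rewrite Lanti (grad_form_antilin _ _ Lc' Lb).
apply: eq_bigr => i _; congr (_ * _).
rewrite (grad_form_lin _ _ (Lb i) Lb).
have := congr1 (fun M : 'rV_N => M 0 i) lE; rewrite !mxE => ->.
by apply: eq_bigr => j _; rewrite mxE.
Qed.
End Riesz.

Section IpMore.
Context d (X : measurableType d) (R : realType) (mu : {measure set X -> \bar R}).
Implicit Types (f g h : X -> R[i]).

Lemma ip_lin2 f g h (a c : R[i]) : L2 mu f -> L2 mu g -> L2 mu h ->
  ip mu f (fun x => a * g x + c * h x) = a * ip mu f g + c * ip mu f h.
Proof.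
move=> Lf Lg Lh; rewrite /ip.
have I1 := L2_cintegrable Lf Lg; have I2 := L2_cintegrable Lf Lh.
rewrite -(cintegralZ a I1) -(cintegralZ c I2).
rewrite -(cintegralD (cintegrableZ a I1) (cintegrableZ c I2)).
by apply: eq_cintegral => x; ring.
Qed.

Lemma ip_scale f g (a : R[i]) : L2 mu f -> L2 mu g ->
  ip mu f (fun x => a * g x) = a * ip mu f g.
Proof.
move=> Lf Lg; rewrite /ip -(cintegralZ a (L2_cintegrable Lf Lg)).
by apply: eq_cintegral => x; ring.
Qed.

Lemma cintegral0 : cintegral mu setT (fun _ : X => 0 : R[i]) = 0.
Proof.
have z : \int[mu]_x (0 : R) = 0 by rewrite Rintegral_cst// mul0r.
by apply: complex_ext; exact: z.
Qed.

Lemma ip0l g : ip mu (fun=> 0) g = 0.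
Proof.
rewrite -[RHS]cintegral0; apply: eq_cintegral => x.
by rewrite conjc0 mul0r.
Qed.

Lemma norm2_0 : norm2 mu (fun=> 0) = 0.
Proof. by rewrite /norm2 ip0l sqrtr0. Qed.

End IpMore.

Section DiscreteSpace.
Context {R : realType} {n : nat} (D : set 'rV[R]_n.+1).
Local Notation sp := (sobolev_pair R n).
Local Notation mu := (volume D).
Local Notation sigma := (surface (boundary D)).
Local Notation fv := (fval (D := D)).
Local Notation gd := (grad (D := D)).
Variables (tr : sp -> boundary_space D -> R[i]) (trP : trace_operator tr).
Variables (X : set sp) (ci : R).
Hypothesis Xfin : fin_dim_subspace D X.
Hypothesis Xinv : forall p, X p -> norm2_vec mu (gd p) <= ci * norm2 mu (fv p).

Let XH1 p : X p -> H1 D p. Proof. exact: Xfin.1. Qed.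

Lemma subspace_L2 p : X p -> L2 mu (fv p). Proof. by move=> /XH1[]. Qed.
Lemma subspace_L2_grad p : X p -> L2_vec mu (gd p). Proof. by move=> /XH1[_ H _]. Qed.
Lemma subspace_L2_trace p : X p -> L2 sigma (tr p).
Proof. by move=> /XH1; case: trP => H _ _ _; exact: H. Qed.

Lemma subspace0 : X 0.
Proof.
have [_ [N [b ->]]] := Xfin; exists (fun=> 0).
by rewrite big1// => i _; rewrite scale0r.
Qed.

Lemma subspace_lin2 (a c : R[i]) p q : X p -> X q -> X (a *: p + c *: q).
Proof.
have [_ [N [b ->]]] := Xfin => -[x ->] [y ->]; exists (fun i => a * x i + c * y i).
rewrite !scaler_sumr -big_split/=; apply: eq_bigr => i _.
by rewrite scalerDl !scalerA.
Qed.

Lemma subspace_sum I (s : seq I) (c : I -> R[i]) (w : I -> sp) : (forall i, X (w i)) ->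
  X (\sum_(i <- s) c i *: w i).
Proof.
move=> Xw; elim: s => [|i s IH]; first by rewrite big_nil; exact: subspace0.
by rewrite big_cons -[\sum_(j <- s) _]scale1r; exact: subspace_lin2.
Qed.

Lemma trace_null p : X p -> norm2 mu (fv p) = 0 -> norm2 sigma (tr p) = 0.
Proof.
move=> Xp p0; have [_ _ [M HM] _] := trP.
have g0 : norm2_vec mu (gd p) = 0.
  apply/eqP; rewrite eq_le sqrtr_ge0 andbT.
  by have := Xinv Xp; rewrite p0 mulr0.
have := HM p (XH1 Xp); rewrite /norm_H1 p0 g0 expr0n/= addr0 sqrtr0 mulr0 => le0.
by apply/eqP; rewrite eq_le le0 sqrtr_ge0.
Qed.

Lemma trace_sum I (s : seq I) (c : I -> R[i]) (w : I -> sp) : (forall i, X (w i)) ->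
  {ae sigma, forall x, tr (\sum_(i <- s) c i *: w i) x = \sum_(i <- s) c i * tr (w i) x}.
Proof.
have [_ trlin _ _] := trP.
move=> Xw; elim: s => [|i s IH].
  (* Linearity of the trace is available only almost everywhere and for [a *: p + q]; with [a = -1]
     and [p = q = 0] it makes the trace of 0 vanish almost everywhere. *)
  have := trlin (- 1) 0 0 (XH1 subspace0) (XH1 subspace0).
  by apply: filterS => x; rewrite !big_nil scaler0 addr0 mulN1r addNr.
have := trlin (c i) _ _ (XH1 (Xw i)) (XH1 (subspace_sum s c Xw)).
apply: filterS2 IH => x; rewrite !big_cons => -> -> //.
Qed.

Lemma ip_trace_sum I (s : seq I) (c : I -> R[i]) (w : I -> sp) v :
  X v -> (forall i, X (w i)) ->
  ip sigma (tr v) (tr (\sum_(i <- s) c i *: w i)) =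
  \sum_(i <- s) c i * ip sigma (tr v) (tr (w i)).
Proof.
move=> Xv Xw; have Lw i := subspace_L2_trace (Xw i).
have Lv := subspace_L2_trace Xv; rewrite -(ip_lin s c Lv Lw).
have Ls : cintegrable sigma (fun x => (tr v x)^*%C * \sum_(i <- s) c i * tr (w i) x).
  have [H _] := cintegral_sum s (fun i => cintegrableZ (c i) (L2_cintegrable Lv (Lw i))).
  move: H; congr cintegrable; apply/funext => x; rewrite mulr_sumr.
  by apply: eq_bigr => i _; ring.
rewrite /ip; apply: ae_eq_cintegral.
- exact: L2_cintegrable Lv (subspace_L2_trace (subspace_sum s c Xw)).
- by apply/measurable_EFinP; exact: measurable_int Ls.1.
- by apply/measurable_EFinP; exact: measurable_int Ls.2.
- by apply: filterS (trace_sum s c Xw) => x ->.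
Qed.

Lemma ip_fval_sum I (s : seq I) (c : I -> R[i]) (w : I -> sp) v :
  X v -> (forall i, X (w i)) ->
  ip mu (fv v) (fv (\sum_(i <- s) c i *: w i)) =
  \sum_(i <- s) c i * ip mu (fv v) (fv (w i)).
Proof.
move=> Xv Xw; rewrite -(ip_lin s c (subspace_L2 Xv) (fun i => subspace_L2 (Xw i))).
by congr ip; apply/funext => x; exact: fval_lin.
Qed.

(* A function of X with vanishing L^2 norm has, by the inverse inequality, a
   vanishing gradient, hence a vanishing trace. *)
Lemma weak_eq_trace (a : R[i]) p q : X p -> X q ->
  (forall v, X v -> ip mu (fv v) (fv q) = a * ip mu (fv v) (fv p)) ->
  forall v, X v -> ip sigma (tr v) (tr q) = a * ip sigma (tr v) (tr p).
Proof.
move=> Xp Xq H v Xv.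
(* Writes [y = q - a p] as a sum over booleans, so that the lemmas on sums apply. As [y] lies in [X]
   and is orthogonal to [X], it is orthogonal to itself. *)
pose w (b : bool) := if b then p else q; pose c (b : bool) : R[i] := if b then - a else 1.
have Xw b : X (w b) by case: b.
pose s := [:: true; false].
have Xy := subspace_sum s c Xw.
set y := \sum_(b <- s) _ in Xy.
have E e : X e -> ip mu (fv e) (fv y) = - a * ip mu (fv e) (fv p) + ip mu (fv e) (fv q).
  by move=> Xe; rewrite /y ip_fval_sum// /s !big_cons big_nil/= addr0 mul1r.
have Et : ip sigma (tr v) (tr y) = - a * ip sigma (tr v) (tr p) + ip sigma (tr v) (tr q).
  by rewrite /y ip_trace_sum// /s !big_cons big_nil/= addr0 mul1r.
have y0 : norm2 mu (fv y) = 0 by rewrite /norm2 (E _ Xy) (H _ Xy) mulNr addNr sqrtr0.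
have := norm2_eq0_ip (subspace_L2_trace Xv) (subspace_L2_trace Xy)
  (or_intror (trace_null Xy y0)).
rewrite Et mulNr => /eqP.
by rewrite addrC subr_eq0 => /eqP.
Qed.

End DiscreteSpace.

(** * The eigenvalue problem *)

Section EigenEquation.
Context {R : realType} {n : nat} (D : set 'rV[R]_n.+1).
Local Notation sp := (sobolev_pair R n).
Local Notation mu := (volume D).
Local Notation sigma := (surface (boundary D)).
Local Notation fv := (fval (D := D)).
Local Notation gd := (grad (D := D)).
Variables (tr : sp -> boundary_space D -> R[i]) (trP : trace_operator tr).
Variables (X : set sp) (ci : R).
Hypothesis Xfin : fin_dim_subspace D X.
Hypothesis Xinv : forall p, X p -> norm2_vec mu (gd p) <= ci * norm2 mu (fv p).
Variables (T kappa0 : R) (k : R -> volume_space D -> R) (K : nat).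
Hypothesis fourier_integrable : forall (l : int) q, cintegrable mu q ->
  cintegrable mu (fun x => fourier_coef T k l x * q x).

Let L2v p := subspace_L2 Xfin (p := p).
Let L2g p := subspace_L2_grad Xfin (p := p).
Let L2t p := subspace_L2_trace trP Xfin (p := p).

Definition fourier_form (l : int) (v w : sp) : R[i] :=
  cintegral mu setT (fun x => fourier_coef T k l x * dot (gd v) (gd w) x).

(** Testing with one nonzero harmonic isolates row [i] of the coupled system. *)
Definition single (v : sp) (i : 'I_(2 * K + 1)) : harmonics R n K :=
  fun j => if j == i then v else 0.

Lemma single_in v i : X v -> forall j, X (single v i j).
Proof. by move=> Xv j; rewrite /single; case: ifP => // _; exact: subspace0 Xfin. Qed.

Lemma ip_K_single v i (w : harmonics R n K) : ip_K D (single v i) w = ip mu (fv v) (fv (w i)).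
Proof.
rewrite /ip_K (bigD1 i)//= /single eqxx big1 ?addr0// => j /negbTE ->.
exact: ip0l.
Qed.

Lemma ip_grad_K_single v i G : ip_grad_K (D := D) (single v i) G = ip_vec mu (gd v) (G i).
Proof.
rewrite /ip_grad_K (bigD1 i)//= /single eqxx big1 ?addr0// => j /negbTE ->.
rewrite /ip_vec big1// => m _.
have -> : (fun x => gd 0 x 0 m) = (fun=> 0) by apply/funext => x; rewrite mxE.
exact: ip0l.
Qed.

Lemma ip_boundary_K_single v i (w : harmonics R n K) : (forall j, X (w j)) ->
  ip_boundary_K tr (single v i) w = ip sigma (tr v) (tr (w i)).
Proof.
move=> Xw; rewrite /ip_boundary_K (bigD1 i)//= /single eqxx big1 ?addr0// => j /negbTE ->.
have X0 := subspace0 Xfin.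
apply: norm2_eq0_ip; [exact: L2t X0|exact: L2t (Xw j)|left].
by apply: (trace_null trP Xfin Xinv X0); exact: norm2_0.
Qed.

Lemma ip_vec_T_op v (u : harmonics R n K) i : X v -> (forall j, X (u j)) ->
  ip_vec mu (gd v) (T_op T k u i) = \sum_j fourier_form (harm i - harm j) v (u j).
Proof.
move=> Xv Xu.
pose q m (j : 'I_(2 * K + 1)) (x : volume_space D) := (gd v x 0 m)^*%C * gd (u j) x 0 m.
have Iq m j : cintegrable mu (q m j) := L2_cintegrable (L2g Xv m) (L2g (Xu j) m).
have If m j : cintegrable mu (fun x => fourier_coef T k (harm i - harm j) x * q m j x).
  exact: fourier_integrable.
transitivity (\sum_(m < n.+1) \sum_j cintegral mu setT
    (fun x => fourier_coef T k (harm i - harm j) x * q m j x)).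
  apply: eq_bigr => m _.
  rewrite -(cintegral_sum (index_enum 'I_(2 * K + 1)) (If m)).2; apply: eq_cintegral => x.
  rewrite /T_op summxE mulr_sumr; apply: eq_bigr => j _.
  by rewrite mxE /q; ring.
rewrite exchange_big/=; apply: eq_bigr => j _.
rewrite -(cintegral_sum (index_enum 'I_n.+1) (fun m => If m j)).2.
by apply: eq_cintegral => x; rewrite mulr_sumr.
Qed.

Definition frequency (omega : R[i]) (i : 'I_(2 * K + 1)) : R[i] :=
  omega + (harm i)%:~R * (2 * pi / T)%:C%C.

Lemma eigen_equation omega (u : harmonics R n K) i v :
  eigenmode T k kappa0 tr X omega u -> X v ->
  - frequency omega i ^+ 2 * ip mu (fv v) (fv (u i))
  + \sum_j fourier_form (harm i - harm j) v (u j)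
  - 'i%C * kappa0%:C%C * frequency omega i * ip sigma (tr v) (tr (u i)) = 0.
Proof.
move=> [z [[Xu Xz] _ Heq]] Xv.
have E1 e : X e ->
    ip mu (fv e) (fv (z i)) = - 'i%C * frequency omega i * ip mu (fv e) (fv (u i)).
  move=> Xe; have [] := Heq (single e i) (single e i) (single_in i Xe) (single_in i Xe).
  rewrite !ip_K_single => H _; move: H.
  have -> : fv (D_op T u i - z i) =
      (fun x => (- 'i%C * (harm i)%:~R * (2 * pi / T)%:C%C) * fv (u i) x + (-1) * fv (z i) x).
    by apply/funext => x; rewrite mulN1r.
  rewrite (ip_lin2 _ _ (L2v Xe) (L2v (Xu i)) (L2v (Xz i))) => H.
  transitivity (- 'i%C * (harm i)%:~R * (2 * pi / T)%:C%C * ip mu (fv e) (fv (u i)) -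
      'i%C * omega * ip mu (fv e) (fv (u i))); last by rewrite /frequency; ring.
  by rewrite -H; ring.
have E2 := weak_eq_trace trP Xfin Xinv (Xu i) (Xz i) E1 Xv.
have [_] := Heq (single v i) (single v i) (single_in i Xv) (single_in i Xv).
rewrite !ip_K_single ip_grad_K_single ip_boundary_K_single// ip_vec_T_op//.
have -> : fv (D_op T z i) =
    (fun x => (- 'i%C * (harm i)%:~R * (2 * pi / T)%:C%C) * fv (z i) x).
  by apply/funext => x.
rewrite (ip_scale _ (L2v Xv) (L2v (Xz i))) E2 (E1 _ Xv) => H.
have i2 : 'i%C * 'i%C = -1 :> R[i] by rewrite -expr2 sqr_i.
move: H; set S := \sum_j _; set A := ip mu _ _; set B := ip sigma _ _ => H.
transitivity (- 'i%C * (harm i)%:~R * (2 * pi / T)%:C%C * (- 'i%C * frequency omega i * A) + S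
  + kappa0%:C%C * (- 'i%C * frequency omega i * B)
  - 'i%C * omega * (- 'i%C * frequency omega i * A)); last by rewrite H subrr.
have -> : - frequency omega i ^+ 2 * A =
    'i%C * 'i%C * (frequency omega i * frequency omega i) * A.
  by rewrite i2; ring.
have -> : - 'i%C * (harm i)%:~R * (2 * pi / T)%:C%C = - 'i%C * (frequency omega i - omega).
  by rewrite /frequency; ring.
ring.
Qed.

End EigenEquation.

Lemma absz_harm_le K (i : 'I_(2 * K + 1)) : (`|harm i| <= K)%N.
Proof. by have := ltn_ord i; rewrite /harm; lia. Qed.

Lemma absz_harmB K (i j : 'I_(2 * K + 1)) :
  `|harm i - harm j|%N = `|j%:Z - i%:Z|%N.
Proof. by rewrite /harm; lia. Qed.

(** * Sums and convolutions of inverse squares *)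

Section InverseSquareSums.
Context {R : realFieldType}.

(* a bounded primitive of (1 + |x|)^-2 *)
Let psi (x : R) : R := x / (1 + `|x|).

(** Each term is at most [2 * (psi (d + 1) - psi d)] on either side of the peak at [z]. The sum
    telescopes, and [|psi| <= 1] gives 4 whatever the shift and the length. *)
Lemma sum_inv_squares (z : int) m :
  \sum_(i < m) (1 + `|i%:Z - z|%N%:R) ^- 2 <= 4 :> R.
Proof.
have step (d : int) : (1 + `|d|%N%:R) ^- 2 <= 2 * (psi (d + 1)%:~R - psi d%:~R) :> R.
  have -> : `|d|%N%:R = `|d%:~R| :> R by rewrite -intr_norm -abszE.
  rewrite intrD /psi; have [d0|d0] := leP 0 d.
    have x0 : 0 <= d%:~R :> R by rewrite ler0z.
    move: (d%:~R) x0 => x x0; rewrite (ger0_norm x0) ger0_norm ?addr_ge0//.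
    have -> : 2 * ((x + 1) / (1 + (x + 1)) - x / (1 + x)) =
        (2 * (1 + x) / (2 + x)) / (1 + x) ^+ 2.
      by field; apply/andP; split; apply: lt0r_neq0; lra.
    rewrite -[leLHS]mul1r; apply: ler_wpM2r; first by rewrite invr_ge0 sqr_ge0.
    by rewrite ler_pdivlMr; lra.
  have x1 : d%:~R <= -1 :> R by rewrite -[-1]/((-1)%:~R) ler_int; lia.
  move: (d%:~R) x1 => x x1; rewrite !ler0_norm; try lra.
  have -> : 2 * ((x + 1) / (1 - (x + 1)) - x / (1 - x)) =
      (2 * (1 - x) / (- x)) / (1 - x) ^+ 2.
    field; apply/and3P; split; [apply: lt0r_neq0|apply: ltr0_neq0|apply: lt0r_neq0]; lra.
  rewrite -[leLHS]mul1r; apply: ler_wpM2r; first by rewrite invr_ge0 sqr_ge0.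
  by rewrite ler_pdivlMr; lra.
have psi1 x : `|psi x| <= 1.
  have h : 0 < 1 + `|x| by rewrite ltr_pwDl.
  by rewrite /psi normrM normfV (gtr0_norm h) ler_pdivrMr// mul1r lerDr.
apply: (@le_trans _ _ (\sum_(0 <= i < m)
    (2 * psi (i.+1%:Z - z)%:~R - 2 * psi (i%:Z - z)%:~R))).
  rewrite big_mkord; apply: ler_sum => i _; rewrite (le_trans (step _))// -mulrBr.
  by rewrite (_ : i%:Z - z + 1 = i.+1%:Z - z)//; lia.
rewrite telescope_sumr//.
have := psi1 (m%:Z - z)%:~R; have := psi1 (0%:Z - z)%:~R.
by rewrite !ler_norml => /andP[? ?] /andP[? ?]; lra.
Qed.

(** With [x = |harm i|] and [y = K - x] the product [(1 + x) ^- 2 * (1 + y) ^- 2] is at most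
    [2 / K ^+ 2] times the sum of its two factors. As [y] is the distance from [i] to one of the
    ends [0] and [2 * K], three shifted sums of inverse squares remain, each at most 4, whence
    24. *)
Lemma sum_harm_convolution (K : nat) : (0 < K)%N ->
  \sum_(i < 2 * K + 1) ((1 + `|harm i|%N%:R) ^- 2 * (K%:R + 1 - `|harm i|%N%:R) ^- 2)
    <= 24 / K%:R ^+ 2 :> R.
Proof.
move=> K0; have K0R : 0 < K%:R :> R by rewrite ltr0n.
have term (i : 'I_(2 * K + 1)) :
  (1 + `|harm i|%N%:R) ^- 2 * (K%:R + 1 - `|harm i|%N%:R) ^- 2 <=
  2 / K%:R ^+ 2 * ((1 + `|i%:Z - K%:Z|%N%:R) ^- 2 +
    ((1 + `|i%:Z - (2 * K)%N%:Z|%N%:R) ^- 2 + (1 + `|i%:Z - 0|%N%:R) ^- 2)) :> R.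
  have iK := ltn_ord i.
  rewrite -/(harm i); set h := `|harm i|%N.
  have hK : (h <= K)%N := absz_harm_le i.
  have [q [qE qK]] : exists q : nat,
      (q = `|i%:Z - (2 * K)%N%:Z|%N \/ q = `|i%:Z - 0|%N) /\ (q + h = K)%N.
    have [iK'|iK'] := leqP K i.
      by exists `|i%:Z - (2 * K)%N%:Z|%N; split; [left|rewrite /h /harm; lia].
    by exists `|i%:Z - 0|%N; split; [right|rewrite /h /harm; lia].
  have -> : K%:R + 1 - h%:R = 1 + q%:R :> R by rewrite -qK natrD; ring.
  have le : (1 + q%:R) ^- 2 <=
      ((1 + `|i%:Z - (2 * K)%N%:Z|%N%:R) ^- 2 + (1 + `|i%:Z - 0|%N%:R) ^- 2) :> R.
    by case: qE => ->; rewrite ?lerDl ?lerDr invr_ge0 sqr_ge0.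
  apply: (@le_trans _ _ (2 / K%:R ^+ 2 * ((1 + h%:R) ^- 2 + (1 + q%:R) ^- 2))); last first.
    apply: ler_wpM2l; first by rewrite divr_ge0 ?sqr_ge0.
    by rewrite lerD2l.
  have -> : K%:R = q%:R + h%:R :> R by rewrite -qK natrD.
  have : 0 <= q%:R :> R by []; have : 0 <= h%:R :> R by [].
  have : 0 < q%:R + h%:R :> R by rewrite -natrD qK.
  move: (q%:R) (h%:R) => y x s0 x0 y0.
  have -> : 2 / (y + x) ^+ 2 * ((1 + x) ^- 2 + (1 + y) ^- 2) =
     (2 * ((1 + x) ^+ 2 + (1 + y) ^+ 2) / (y + x) ^+ 2) * ((1 + x) ^- 2 * (1 + y) ^- 2).
    by field; rewrite !gt_eqF//; lra.
  rewrite -[leLHS]mul1r; apply: ler_wpM2r.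
    by rewrite mulr_ge0// invr_ge0 sqr_ge0.
  rewrite ler_pdivlMr ?exprn_gt0// mul1r.
  have := sqr_ge0 (x - y); nra.
apply: (le_trans (ler_sum _ (fun i _ => term i))).
rewrite -mulr_sumr !big_split/=.
have s1 := sum_inv_squares K%:Z (2 * K + 1).
have s2 := sum_inv_squares (2 * K)%N%:Z (2 * K + 1).
have s3 := sum_inv_squares 0 (2 * K + 1).
rewrite (_ : 24 / _ = 2 / K%:R ^+ 2 * (4 + (4 + 4))); last by ring.
apply: ler_wpM2l; first by rewrite divr_ge0 ?sqr_ge0.
by rewrite !lerD.
Qed.
End InverseSquareSums.

(** * Decay of the harmonics of an eigenmode *)

Section Decay.
Context {R : realType} {n : nat} (D : set 'rV[R]_n.+1).
Local Notation sp := (sobolev_pair R n).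
Local Notation mu := (volume D).
Local Notation sigma := (surface (boundary D)).
Local Notation fv := (fval (D := D)).
Local Notation gd := (grad (D := D)).
Variables (tr : sp -> boundary_space D -> R[i]) (trP : trace_operator tr).
Variables (X : set sp) (ci c0 : R).
Hypothesis Xfin : fin_dim_subspace D X.
Hypothesis Xinv : forall p, X p -> norm2_vec mu (gd p) <= ci * norm2 mu (fv p).
Hypothesis c0_gt0 : 0 < c0.
Hypothesis c0_le : c0 <= ci.
Variables (T b : R) (k : R -> volume_space D -> R).
Hypothesis T_gt0 : 0 < T.
Hypothesis b_ge0 : 0 <= b.
Hypothesis smooth_pairing : forall q Q, cintegrable mu q ->
  \int[mu]_x `|Re (q x)| <= Q -> \int[mu]_x `|Im (q x)| <= Q ->
  csmooth_periodic T (b * Q) (cpairing k q).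
Hypothesis fourier_pairing : forall (l : int) q, cintegrable mu q ->
  cintegrable mu (fun x => fourier_coef T k l x * q x) /\
  cintegral mu setT (fun x => fourier_coef T k l x * q x) = time_coef T (cpairing k q) l.

Let w : R := 2 * pi / T.
Let w_gt0 : 0 < w. Proof. by rewrite divr_gt0// mulr_gt0// pi_gt0. Qed.

Let L2g p := subspace_L2_grad Xfin (p := p).

Lemma pairing_dot_smooth v p : X v -> X p ->
  csmooth_periodic T (b * (norm2_vec mu (gd v) * norm2_vec mu (gd p)))
    (cpairing k (dot (gd v) (gd p))).
Proof.
move=> Xv Xp; have [b1 b2] := dot_L1_bound (L2g Xv) (L2g Xp).
exact: smooth_pairing (dot_cintegrable (L2g Xv) (L2g Xp)) b1 b2.
Qed.

Definition coef_constant : R := 2 + 16 / w ^+ 3.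

Lemma coef_constant_ge0 : 0 <= coef_constant.
Proof. by rewrite addr_ge0// divr_ge0// exprn_ge0// ltW. Qed.

Lemma fourier_form_bound v p (l : int) : X v -> X p ->
  normc (fourier_form T k l v p) <=
  coef_constant * (b * (norm2_vec mu (gd v) * norm2_vec mu (gd p))) / (1 + `|l|%N%:R) ^+ 2.
Proof.
move=> Xv Xp; rewrite /fourier_form.
rewrite (fourier_pairing l (dot_cintegrable (L2g Xv) (L2g Xp))).2.
exact: time_coef_bound (pairing_dot_smooth Xv Xp).
Qed.

(** Here [P0] and [g0] stand for the squared norms of a harmonic in the domain and on the boundary.
    Taking real parts gives [|m|^2 |Re m| P0 <= |m| |G|]; dividing by [|m|] and using
    [|Re m| <= |m|] concludes. Neither the size nor the sign of [k0] matters. *)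
Lemma Re_scaled_equation (m P G : R[i]) (P0 g0 k0 : R) :
  - m ^+ 2 * P0%:C%C + G - 'i%C * k0%:C%C * m * g0%:C%C = 0 ->
  0 <= P0 -> Re m ^+ 2 * P0 <= normc G.
Proof.
move=> E P0_ge0.
have GE : G = m ^+ 2 * P0%:C%C + 'i%C * k0%:C%C * m * g0%:C%C.
  apply/eqP; rewrite -subr_eq0; apply/eqP; rewrite -[RHS]E; ring.
(* multiplying by the conjugate of m makes the boundary term purely imaginary *)
have H : Re ((m^*)%C * G) = normc m ^+ 2 * (Re m * P0).
  rewrite GE normc_sqr; case: m {E GE} => x y /=; ring.
have [m0|m0] := eqVneq (normc m) 0.
  have := Re_le_normc m; rewrite m0 normr_le0 => /eqP ->.
  by rewrite expr0n/= mul0r normc_ge0.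
have mp : 0 < normc m by rewrite lt0r m0 normc_ge0.
have := Re_le_normc ((m^*)%C * G); rewrite H ComplexField.Normc.normcM.
have -> : normc (m^*)%C = normc m by case: m {E GE H m0 mp} => x y /=; rewrite sqrrN.
rewrite normrM (ger0_norm (sqr_ge0 _)) expr2 -mulrA ler_pM2l// => H2.
apply: le_trans H2; rewrite normrM (ger0_norm P0_ge0) mulrA ler_wpM2r//.
rewrite -(real_normK (num_real (Re m))) expr2 ler_wpM2r//; exact: Re_le_normc.
Qed.

(** The first summand is for nonzero harmonics: 4 from the sum of inverse squares times 16 from the
    lower bound on the frequency. The second is for harmonic 0, through [1 <= c0 ^- 2 * ci ^+ 2]. *)
Definition decay_constant : R := 64 * coef_constant * b / w ^+ 2 + c0 ^- 2.

Lemma decay_constant_ge0 : 0 <= decay_constant.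
Proof.
rewrite addr_ge0 ?invr_ge0 ?sqr_ge0// divr_ge0 ?sqr_ge0// !mulr_ge0//.
exact: coef_constant_ge0.
Qed.

Lemma harmonic_decay kappa0 (K : nat) omega (u : harmonics R n K) i :
  eigenmode T k kappa0 tr X omega u ->
  - w / 2 < Re omega <= w / 2 -> norm_K D u = 1 ->
  norm2 mu (fv (u i)) <= decay_constant * ci ^+ 2 / (1 + `|harm i|%N%:R) ^+ 2.
Proof.
move=> em /andP[ro1 ro2] u1.
have Xu j : X (u j) by case: em => z [[H _] _ _]; exact: H.
have ci0 : 0 < ci := lt_le_trans c0_gt0 c0_le.
have N0 j : 0 <= norm2 mu (fv (u j)) by exact: sqrtr_ge0.
have N1 j : norm2 mu (fv (u j)) <= 1.
  have : \sum_j norm2 mu (fv (u j)) ^+ 2 = 1.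
    have E : ip_K D u u = (\sum_j norm2 mu (fv (u j)) ^+ 2)%:C%C.
      by rewrite /ip_K rmorph_sum; apply: eq_bigr => j' _; rewrite ip_self.
    move: u1; rewrite /norm_K E/= => /(congr1 (fun y => y ^+ 2)).
    by rewrite sqr_sqrtr ?expr1n// sumr_ge0// => j' _; exact: sqr_ge0.
  move=> s1; rewrite -(@ler_pXn2r _ 2) ?nnegrE// expr1n -s1 (bigD1 j)//= lerDl.
  by apply: sumr_ge0 => j' _; exact: sqr_ge0.
have Cp : 0 <= coef_constant * b * ci ^+ 2.
  exact: mulr_ge0 (mulr_ge0 coef_constant_ge0 b_ge0) (sqr_ge0 ci).
have EQ := eigen_equation trP Xfin Xinv (fun l q Iq => (fourier_pairing l Iq).1) i em (Xu i).
rewrite !ip_self in EQ.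
have := Re_scaled_equation 0 EQ (sqr_ge0 _).
set G := \sum_j _ => H.
(* All neighbours [u j] have norm at most 1, so their gradients are at most [ci]; the quadratic
   decay of the coefficients makes the sum over [j] bounded independently of [K]. *)
have GB : normc G <= 4 * (coef_constant * b * ci ^+ 2) * norm2 mu (fv (u i)).
  apply: (le_trans (normc_sum _ _)).
  have tb j : normc (fourier_form T k (harm i - harm j) (u i) (u j)) <=
     coef_constant * b * ci ^+ 2 * norm2 mu (fv (u i)) * (1 + `|j%:Z - i%:Z|%N%:R) ^- 2.
    apply: (le_trans (fourier_form_bound _ (Xu i) (Xu j))).
    rewrite absz_harmB ler_wpM2r ?invr_ge0 ?sqr_ge0// -!mulrA ler_wpM2l ?coef_constant_ge0//.
    rewrite ler_wpM2l//.
    have h1 := Xinv (Xu i); have h2 := Xinv (Xu j).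
    have h2' : norm2_vec mu (gd (u j)) <= ci.
      by apply: le_trans h2 _; rewrite -[leRHS]mulr1 ler_wpM2l// ltW.
    apply: le_trans (ler_pM _ _ h1 h2') _; [exact: sqrtr_ge0|exact: sqrtr_ge0|].
    by rewrite le_eqVlt; apply/orP; left; apply/eqP; ring.
  apply: (le_trans (ler_sum _ (fun j _ => tb j))); rewrite -mulr_sumr.
  rewrite [leRHS](_ : _ = coef_constant * b * ci ^+ 2 * norm2 mu (fv (u i)) * 4); last by ring.
  apply: ler_wpM2l; last exact: sum_inv_squares.
  exact: mulr_ge0.
have {}H : Re (frequency T omega i) ^+ 2 * norm2 mu (fv (u i)) <=
    4 * (coef_constant * b * ci ^+ 2).
  have [z|nz] := eqVneq (norm2 mu (fv (u i))) 0.
    by rewrite z mulr0 mulr_ge0.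
  have np : 0 < norm2 mu (fv (u i)) by rewrite lt0r nz N0.
  by rewrite -(ler_pM2r np) -[leLHS]mulrA -expr2; exact: le_trans H GB.
set N := norm2 _ _ in H N0 N1 *.
rewrite ler_pdivlMr; last by rewrite exprn_gt0// ltr_pwDl.
rewrite /decay_constant mulrDl.
have t2 : 1 <= c0 ^- 2 * ci ^+ 2.
  by rewrite mulrC ler_pdivlMr ?exprn_gt0// mul1r lerXn2r ?nnegrE// ltW.
have t1 : 0 <= 64 * coef_constant * b / w ^+ 2 * ci ^+ 2.
  rewrite (_ : _ * ci ^+ 2 = 64 / w ^+ 2 * (coef_constant * b * ci ^+ 2)); last by ring.
  by rewrite mulr_ge0// divr_ge0// sqr_ge0.
have [h0|h0] := eqVneq (harm i) 0.
  have := N1 i; rewrite -/N h0 absz0 addr0 expr1n mulr1; lra.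
have hE : `|harm i|%N%:R = `|(harm i)%:~R| :> R by rewrite -intr_norm -abszE.
have h1 : 1 <= `|harm i|%N%:R :> R by rewrite ler1n absz_gt0.
have Rf : Re (frequency T omega i) = Re omega + (harm i)%:~R * w.
  by rewrite /frequency Re_add Re_mul Re_int Im_int mul0r subr0.
(* Since [|Re omega| <= w / 2], the modulus is at least [(|n| - 1 / 2) * w] for the harmonic [n],
   and [|n| - 1 / 2 >= (1 + |n|) / 4] once [|n| >= 1]. *)
have a1 : w / 4 * (1 + `|harm i|%N%:R) <= `|Re (frequency T omega i)|.
  have o3 : `|Re omega| <= w / 2 by rewrite ler_norml; apply/andP; split; lra.
  rewrite Rf; have := ler_normB (Re omega + (harm i)%:~R * w) (Re omega).
  rewrite addrAC subrr add0r normrM -hE (gtr0_norm w_gt0); nra.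
have a2 : w ^+ 2 / 16 * (1 + `|harm i|%N%:R) ^+ 2 <= Re (frequency T omega i) ^+ 2.
  rewrite -(real_normK (num_real (Re (frequency T omega i)))).
  rewrite (_ : w ^+ 2 / 16 * _ = (w / 4 * (1 + `|harm i|%N%:R)) ^+ 2); last by field.
  rewrite lerXn2r ?nnegrE//; apply: mulr_ge0; last exact: addr_ge0.
  by apply: divr_ge0 => //; exact: ltW.
apply: (@le_trans _ _ (64 * coef_constant * b / w ^+ 2 * ci ^+ 2)); last by lra.
have : w ^+ 2 / 16 * (1 + `|harm i|%N%:R) ^+ 2 * N <= 4 * (coef_constant * b * ci ^+ 2).
  apply: le_trans H; apply: ler_wpM2r => //; exact: N0.
rewrite -(@ler_pM2l _ (16 / w ^+ 2)); last by rewrite divr_gt0// exprn_gt0.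
have w2 : w ^+ 2 != 0 by rewrite expf_neq0// gt_eqF.
rewrite (_ : 16 / w ^+ 2 * (w ^+ 2 / 16 * _ * N) = N * (1 + `|harm i|%N%:R) ^+ 2); last first.
  by move: (w ^+ 2) w2 => W W0; field.
by rewrite (_ : 16 / w ^+ 2 * (4 * _) = 64 * coef_constant * b / w ^+ 2 * ci ^+ 2)//; ring.
Qed.
End Decay.

(** * Residual of the time-dependent mode and its Riesz representative *)

Section Defect.
Context {R : realType} {n : nat} (D : set 'rV[R]_n.+1).
Local Notation sp := (sobolev_pair R n).
Local Notation mu := (volume D).
Local Notation sigma := (surface (boundary D)).
Local Notation fv := (fval (D := D)).
Local Notation gd := (grad (D := D)).
Variables (tr : sp -> boundary_space D -> R[i]) (trP : trace_operator tr).
Variables (X : set sp) (ci c0 : R).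
Hypothesis Xfin : fin_dim_subspace D X.
Hypothesis Xinv : forall p, X p -> norm2_vec mu (gd p) <= ci * norm2 mu (fv p).
Hypothesis c0_gt0 : 0 < c0.
Hypothesis c0_le : c0 <= ci.
Variables (T b : R) (k : R -> volume_space D -> R).
Hypothesis T_gt0 : 0 < T.
Hypothesis b_ge0 : 0 <= b.
Hypothesis k_Linf : forall t, Linf (k t).
Hypothesis smooth_pairing : forall q Q, cintegrable mu q ->
  \int[mu]_x `|Re (q x)| <= Q -> \int[mu]_x `|Im (q x)| <= Q ->
  csmooth_periodic T (b * Q) (cpairing k q).
Hypothesis fourier_pairing : forall (l : int) q, cintegrable mu q ->
  cintegrable mu (fun x => fourier_coef T k l x * q x) /\
  cintegral mu setT (fun x => fourier_coef T k l x * q x) = time_coef T (cpairing k q) l.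
Variables (kappa0 : R) (K : nat) (omega : R[i]) (u : harmonics R n K).
Hypothesis em : eigenmode T k kappa0 tr X omega u.

Let Xu j : X (u j). Proof. by case: em => z [[H _] _ _]; exact: H. Qed.
Let L2v p := subspace_L2 Xfin (p := p).
Let L2g p := subspace_L2_grad Xfin (p := p).

Lemma cintegrable_Linf (f : volume_space D -> R) q : Linf f -> cintegrable mu q ->
  cintegrable mu (fun x => (f x)%:C%C * q x).
Proof.
move=> Lf [q1 q2]; split.
- under [Y in EFin \o Y]funext => x do rewrite Re_mul/= mul0r subr0.
  exact: Linf_integrable.
- under [Y in EFin \o Y]funext => x do rewrite Im_mul/= mul0r addr0.
  exact: Linf_integrable.
Qed.

Definition phase (t : R) (m : 'I_(2 * K + 1)) : R[i] :=
  cexp (- 'i%C * frequency T omega m * t%:C%C).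

Definition window_defect (t : R) (v : sp) (m : 'I_(2 * K + 1)) : R[i] :=
  cpairing k (dot (gd v) (gd (u m))) t -
  \sum_(i < 2 * K + 1) fourier_form T k (harm i - harm m) v (u m) *
     cexp (- 'i%C * (harm i - harm m)%:~R * (2 * pi / T * t)%:C%C).

Definition defect_form (t : R) (v : sp) : R[i] :=
  \sum_m phase t m * window_defect t v m.

Lemma phase_shift t i m :
  phase t i = phase t m * cexp (- 'i%C * (harm i - harm m)%:~R * (2 * pi / T * t)%:C%C).
Proof.
rewrite /phase -cexpD /frequency intrB (rmorphM (real_complex R) (2 * pi / T) t); congr cexp; ring.
Qed.

Lemma ip_vec_coefficient t v : X v ->
  ip_vec mu (gd v) (fun x => (k t x)%:C%C *: gd (mode T omega u t) x) =
  \sum_m phase t m * cpairing k (dot (gd v) (gd (u m))) t.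
Proof.
move=> Xv.
pose q j (m : 'I_(2 * K + 1)) (x : volume_space D) := (gd v x 0 j)^*%C * gd (u m) x 0 j.
have Iq j m : cintegrable mu (q j m) := L2_cintegrable (L2g Xv j) (L2g (Xu m) j).
have If j m : cintegrable mu (fun x => phase t m * ((k t x)%:C%C * q j m x)).
  by apply: cintegrableZ; exact: cintegrable_Linf.
transitivity (\sum_(j < n.+1) \sum_m cintegral mu setT
    (fun x => phase t m * ((k t x)%:C%C * q j m x))).
  apply: eq_bigr => j _.
  rewrite -(cintegral_sum (index_enum 'I_(2 * K + 1)) (If j)).2; apply: eq_cintegral => x.
  rewrite mxE /grad /mode grad_lin !mulr_sumr; apply: eq_bigr => m _.
  by rewrite /q /phase /frequency /grad; ring.
rewrite exchange_big/=; apply: eq_bigr => m _.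
rewrite -(cintegral_sum (index_enum 'I_n.+1) (fun j => If j m)).2.
rewrite /cpairing -cintegralZ; last exact: cintegrable_Linf (dot_cintegrable (L2g Xv) (L2g (Xu m))).
by apply: eq_cintegral => x; rewrite /dot !mulr_sumr.
Qed.

(** Multiplying row [i] by [phase t i] and summing turns time derivatives and boundary term into
    minus the truncated convolution, so only the difference between exact and truncated products
    survives. *)
Lemma wave_form_defect t v : X v ->
  wave_form k kappa0 tr (mode T omega u) t v = defect_form t v.
Proof.
move=> Xv.
pose lam (i : 'I_(2 * K + 1)) : R[i] := - 'i%C * frequency T omega i.
have mE : mode T omega u = exp_family (index_enum 'I_(2 * K + 1)) lam u by [].
have d1 : time_deriv (mode T omega u) =
    exp_family (index_enum 'I_(2 * K + 1)) lam (fun i => lam i *: u i).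
  by apply/funext => s; rewrite mE time_deriv_exp_family.
have d2 : time_deriv (time_deriv (mode T omega u)) t =
    exp_family (index_enum 'I_(2 * K + 1)) lam (fun i => lam i *: (lam i *: u i)) t.
  by rewrite d1 time_deriv_exp_family.
rewrite /wave_form d2 d1 ip_vec_coefficient//.
have i2 : 'i%C * 'i%C = -1 :> R[i] by rewrite -expr2 sqr_i.
have -> : ip mu (fv v) (fv (exp_family (index_enum 'I_(2 * K + 1)) lam
      (fun i => lam i *: (lam i *: u i)) t)) =
    \sum_i phase t i * (- frequency T omega i ^+ 2 * ip mu (fv v) (fv (u i))).
  rewrite /exp_family; under eq_bigr do rewrite !scalerA.
  rewrite (ip_fval_sum Xfin _ _ Xv Xu); apply: eq_bigr => i _.
  transitivity (phase t i * ('i%C * 'i%C * frequency T omega i ^+ 2 * ip mu (fv v) (fv (u i)))).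
    by rewrite /lam -/(phase t i); ring.
  by rewrite i2; ring.
have -> : ip sigma (tr v) (tr (exp_family (index_enum 'I_(2 * K + 1)) lam
      (fun i => lam i *: u i) t)) =
    \sum_i phase t i * (- 'i%C * frequency T omega i * ip sigma (tr v) (tr (u i))).
  rewrite /exp_family; under eq_bigr do rewrite !scalerA.
  rewrite (ip_trace_sum trP Xfin _ _ Xv Xu); apply: eq_bigr => i _.
  by rewrite /lam -/(phase t i); ring.
(* The discrete equations are indexed by the row [i], the defect by the column [m]; [phase_shift]
   converts the phases when the double sum is regrouped. *)
have -> : defect_form t v =
   \sum_m phase t m * cpairing k (dot (gd v) (gd (u m))) t -
   \sum_i phase t i * \sum_j fourier_form T k (harm i - harm j) v (u j).
  rewrite /defect_form; under eq_bigr do rewrite mulrBr.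
  rewrite sumrB; congr (_ - _).
  under eq_bigr do rewrite mulr_sumr.
  under [RHS]eq_bigr do rewrite mulr_sumr.
  rewrite exchange_big/=; apply: eq_bigr => i _; apply: eq_bigr => m _.
  by rewrite (phase_shift t i m); ring.
rewrite mulr_sumr addrAC -big_split/= addrC; congr (_ + _).
rewrite -sumrN; apply: eq_bigr => i _.
have EQ := eigen_equation trP Xfin Xinv (fun l q Iq => (fourier_pairing l Iq).1) i em Xv.
move: EQ; set F := \sum_j _; set A := ip mu _ _; set B := ip sigma _ _ => EQ.
transitivity (phase t i * (- frequency T omega i ^+ 2 * A + F
  - 'i%C * kappa0%:C%C * frequency T omega i * B) - phase t i * F); first by ring.
by rewrite EQ mulr0 sub0r.
Qed.

Lemma antilin_cintegral N (bs : 'I_N -> sp) (c : 'I_N -> R[i])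
    (F : volume_space D -> R[i]) p : (forall i, X (bs i)) -> X p ->
  (forall q, cintegrable mu q -> cintegrable mu (fun x => F x * q x)) ->
  cintegral mu setT (fun x => F x * dot (gd (\sum_(i < N) c i *: bs i)) (gd p) x) =
  \sum_(i < N) (c i)^*%C * cintegral mu setT (fun x => F x * dot (gd (bs i)) (gd p) x).
Proof.
move=> Xb Xp HF.
have Iq i := HF _ (dot_cintegrable (L2g (Xb i)) (L2g Xp)).
transitivity (\sum_(i < N) cintegral mu setT
    (fun x => (c i)^*%C * (F x * dot (gd (bs i)) (gd p) x))); last first.
  by apply: eq_bigr => i _; exact: cintegralZ (Iq i).
rewrite -(cintegral_sum (index_enum 'I_N) (fun i => cintegrableZ ((c i)^*)%C (Iq i))).2.
apply: eq_cintegral => x; rewrite /dot.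
under eq_bigr do rewrite /grad grad_lin sumr_conj mulr_suml.
rewrite exchange_big/= mulr_sumr; apply: eq_bigr => i _.
rewrite mulrCA; congr (_ * _); rewrite mulr_sumr; apply: eq_bigr => j _.
by rewrite rmorphM mulrA.
Qed.

Lemma defect_form_antilin t N (bs : 'I_N -> sp) (c : 'I_N -> R[i]) : (forall i, X (bs i)) ->
  defect_form t (\sum_(i < N) c i *: bs i) = \sum_(i < N) (c i)^*%C * defect_form t (bs i).
Proof.
move=> Xb; rewrite /defect_form.
under [RHS]eq_bigr do rewrite mulr_sumr.
rewrite exchange_big/=; apply: eq_bigr => m _.
under [RHS]eq_bigr do rewrite mulrCA.
rewrite -mulr_sumr; congr (_ * _); rewrite /window_defect.
under [RHS]eq_bigr do rewrite mulrBr.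
rewrite sumrB; congr (_ - _).
  by rewrite /cpairing antilin_cintegral// => q; exact: cintegrable_Linf.
under [RHS]eq_bigr do rewrite mulr_sumr.
rewrite exchange_big/=; apply: eq_bigr => i _.
rewrite /fourier_form antilin_cintegral//; last by move=> q Iq; exact: (fourier_pairing _ Iq).1.
by rewrite mulr_suml; apply: eq_bigr => j _; ring.
Qed.

Let w : R := 2 * pi / T.

Lemma window_defect_bound t v m : X v ->
  normc (window_defect t v m) <= 16 / w ^+ 3 *
    (b * (norm2_vec mu (gd v) * norm2_vec mu (gd (u m)))) / (K%:R + 1 - `|harm m|%N%:R) ^+ 2.
Proof.
move=> Xv; have sm := pairing_dot_smooth Xfin smooth_pairing Xv (Xu m).
have := window_error t T_gt0 sm (absz_harm_le m); rewrite /window_defect /time_term.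
suff -> : \sum_(i < 2 * K + 1) fourier_form T k (harm i - harm m) v (u m) *
     cexp (- 'i%C * (harm i - harm m)%:~R * (2 * pi / T * t)%:C%C) =
  \sum_(i < 2 * K + 1) time_coef T (cpairing k (dot (gd v) (gd (u m)))) (i%:Z - K%:Z - harm m) *
    cexp (- 'i%C * (i%:Z - K%:Z - harm m)%:~R * (2 * pi / T * t)%:C%C) by [].
apply: eq_bigr => i _; congr (_ * _).
exact: (fourier_pairing _ (dot_cintegrable (L2g Xv) (L2g (Xu m)))).2.
Qed.

Lemma normc_phase t m : normc (phase t m) = expR (Im omega * t).
Proof.
rewrite /phase normc_cexp; congr expR.
rewrite /frequency !(Re_mul, Im_mul, Re_add, Im_add, Re_opp, Im_opp, Re_int, Im_int)/=; ring.
Qed.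

(** The factor [norm2_vec mu (gd v)] stands alone so that the form visibly vanishes on functions
    with zero gradient, the kernel condition of [riesz_span]. *)
Lemma defect_form_bound t v : X v -> normc (defect_form t v) <=
  norm2_vec mu (gd v) * (16 / w ^+ 3 * b * expR (Im omega * t) *
    \sum_m norm2_vec mu (gd (u m)) * (K%:R + 1 - `|harm m|%N%:R) ^- 2).
Proof.
move=> Xv; apply: (le_trans (normc_sum _ _)).
rewrite !mulr_sumr; apply: ler_sum => m _.
rewrite ComplexField.Normc.normcM normc_phase.
apply: (le_trans (ler_wpM2l (expR_ge0 _) (window_defect_bound t m Xv))).
by rewrite le_eqVlt; apply/orP; left; apply/eqP; ring.
Qed.

Lemma defect_exists t : exists delta, H1 D delta /\
  forall v, X v -> defect_form t v = grad_form D v delta.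
Proof.
have [XH1 [N [bs XE]]] := Xfin.
have Xspan p : (exists c, p = \sum_(i < N) c i *: bs i) -> X p by rewrite XE.
have Xb i : X (bs i).
  apply: Xspan; exists (fun j => (j == i)%:R).
  by rewrite (bigD1 i)//= eqxx scale1r big1 ?addr0// => j /negbTE ->; rewrite scale0r.
have [c' Hc'] : exists c', forall c, defect_form t (\sum_(i < N) c i *: bs i) =
    grad_form D (\sum_(i < N) c i *: bs i) (\sum_(i < N) c' i *: bs i).
  apply: riesz_span.
  - by move=> p /Xspan /L2g.
  - by move=> c; exact: defect_form_antilin.
  - move=> c N0; have Xc : X (\sum_(i < N) c i *: bs i) by apply: Xspan; exists c.
    apply: ComplexField.Normc.eq0_normc; apply/eqP; rewrite eq_le normc_ge0 andbT.
    by have := defect_form_bound t Xc; rewrite N0 mul0r.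
exists (\sum_(i < N) c' i *: bs i); split; first by apply: XH1; apply: Xspan; exists c'.
by move=> v; rewrite XE => -[c ->].
Qed.

(** 384 is 16 from the truncation error times 24 from the convolution of inverse squares. *)
Definition defect_constant : R := 384 / w ^+ 3 * b * decay_constant c0 T b.

Lemma defect_estimate t v : (0 < K)%N -> X v -> norm2 mu (fv v) = 1 ->
  - w / 2 < Re omega <= w / 2 -> norm_K D u = 1 ->
  normc (defect_form t v) <=
    defect_constant * (ci ^+ 4 / K%:R ^+ 2) * expR (Im omega * t).
Proof.
move=> K0 Xv v1 ro u1.
have ci0 : 0 < ci := lt_le_trans c0_gt0 c0_le.
have w0 : 0 < w by rewrite divr_gt0// mulr_gt0// pi_gt0.
have dc0 : 0 <= decay_constant c0 T b by exact: decay_constant_ge0.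
have gv : norm2_vec mu (gd v) <= ci by have := Xinv Xv; rewrite v1 mulr1.
have E0 := expR_ge0 (Im omega * t).
have w3 : 0 <= 16 / w ^+ 3 * b * expR (Im omega * t).
  by rewrite !mulr_ge0// invr_ge0 exprn_ge0// ltW.
have S : \sum_m norm2_vec mu (gd (u m)) * (K%:R + 1 - `|harm m|%N%:R) ^- 2 <=
    ci * (decay_constant c0 T b * ci ^+ 2) * (24 / K%:R ^+ 2).
  apply: (@le_trans _ _ (ci * (decay_constant c0 T b * ci ^+ 2) *
     \sum_(m < 2 * K + 1) ((1 + `|harm m|%N%:R) ^- 2 * (K%:R + 1 - `|harm m|%N%:R) ^- 2))).
    rewrite mulr_sumr; apply: ler_sum => m _; rewrite [leRHS]mulrA.
    apply: ler_wpM2r; first by rewrite invr_ge0 sqr_ge0.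
    apply: (le_trans (Xinv (Xu m))); rewrite -[leRHS]mulrA; apply: ler_wpM2l; first exact: ltW.
    exact: (harmonic_decay trP Xfin Xinv c0_gt0 c0_le T_gt0 b_ge0
      smooth_pairing fourier_pairing m em ro u1).
  apply: ler_wpM2l; last exact: sum_harm_convolution.
  by rewrite !mulr_ge0 ?sqr_ge0// ltW.
have S0 : 0 <= \sum_m norm2_vec mu (gd (u m)) * (K%:R + 1 - `|harm m|%N%:R) ^- 2.
  apply: sumr_ge0 => m _; apply: mulr_ge0; first exact: sqrtr_ge0.
  by rewrite invr_ge0 sqr_ge0.
apply: (le_trans (defect_form_bound t Xv)).
apply: (@le_trans _ _ (ci * (16 / w ^+ 3 * b * expR (Im omega * t) *
   (ci * (decay_constant c0 T b * ci ^+ 2) * (24 / K%:R ^+ 2))))).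
  apply: ler_pM => //; [exact: sqrtr_ge0|exact: mulr_ge0|exact: ler_wpM2l].
by rewrite le_eqVlt; apply/orP; left; apply/eqP; rewrite /defect_constant; ring.
Qed.
End Defect.

(* C depends on D, kappa and T = 2 pi / Omega, and on a lower bound c0 for the
   constants Cinv h; since Cinv h --> +oo, the restriction c0 <= Cinv h only
   excludes values of h away from 0. *)
Theorem lemma4p2 (R : realType) (n : nat) (D : set 'rV[R]_n.+1)
    (tr : sobolev_pair R n -> boundary_space D -> R[i])
    (T : R) (kappa : R -> volume_space D -> R) (c0 : R) :
  lipschitz_domain D -> trace_operator tr ->
  0 < T -> coefficient T kappa -> C_per 3 T kappa -> 0 < c0 ->
  let Omega := 2 * pi / T in
  exists C : R,
  forall (kappa0 : R) (X : R -> set (sobolev_pair R n)) (Cinv : R -> R),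
  0 < kappa0 -> discrete_spaces D X Cinv ->
  forall h : R, 0 < h -> c0 <= Cinv h ->
  forall (K : nat) (omega : R[i]) (u : harmonics R n K), (0 < K)%N ->
  eigenmode T kappa kappa0 tr (X h) omega u ->
  - Omega / 2 < complex.Re omega <= Omega / 2 ->
  norm_K D u = 1 ->
  forall t : R, 0 <= t ->
  exists delta : sobolev_pair R n,
  [/\ H1 D delta,
      forall v, X h v ->
        wave_form kappa kappa0 tr (mode T omega u) t v = grad_form D v delta &
      (ereal_sup [set (ComplexField.Normc.normc (grad_form D v delta))%:E
                 | v in [set v | X h v /\ (norm2 (volume D) (fval (D:=D) v) = 1)%R]]
       <= (C * (Cinv h ^+ 4 / K%:R ^+ 2) * expR (complex.Im omega * t))%:E)%E].
Proof.
move=> lipD trP T0 [mk _ _ _] kC c0_gt0 Omega.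
have bD : bounded_set D by case: lipD.
have [b [b0 kb sp]] := cpairing_smooth T0 kC.
have kL : forall t, Linf (kappa t) by case: kC => -[].
have fp (l : int) q : cintegrable (volume D) q ->
    cintegrable (volume D) (fun x => fourier_coef T kappa l x * q x) /\
    cintegral (volume D) setT (fun x => fourier_coef T kappa l x * q x) =
      time_coef T (cpairing kappa q) l.
  move=> Iq.
  (* The smoothness statement [sp] asks for one number dominating the integrals of both [|Re q|] and
     [|Im q|]; their sum serves. *)
  apply: (@fourier_coef_pairing R n D T kappa b (b * (\int[volume D]_x `|Re (q x)| +
    \int[volume D]_x `|Im (q x)|)) q l bD T0 b0 mk kb Iq).
  by apply: sp => //; rewrite ?lerDl ?lerDr; exact: Rintegral_ge0.
exists (defect_constant c0 T b).
move=> kappa0 X Cinv _ [Xfin Xinv _] h h0 ch K omega u K0 em ro u1 t _.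
have Xf := Xfin h h0; have Xi p := Xinv h p h0.
have [delta [Hd dE]] := defect_exists Xf T0 kL sp fp em t.
exists delta; split => // [v Xv|].
  by rewrite -(dE v Xv); exact: (wave_form_defect trP Xf Xi kL fp em).
apply: ge_ereal_sup => _ [v [Xv v1] <-]; rewrite lee_fin -(dE v Xv).
exact: (defect_estimate trP Xf Xi c0_gt0 ch T0 b0 sp fp em).
Qed.
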